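(* Let $\mathcal{S}$ be a triangulated category. (1) Let $G,H\in\mathcal{S}$ and $G\in\langle H\rangle$. If $\mathrm{findim}(\mathcal{S},G)<\infty$, then $\mathrm{findim}(\mathcal{S},H)<\infty$. (2) Suppose that $\mathcal{S}$ has a bounded $t$-structure. For any $G\in\mathcal{S}$, if either $\mathrm{findim}(\mathcal{S},G)<\infty$ or $\mathrm{findim}(\mathcal{S}^{\mathrm{op}},G^{\mathrm{op}})<\infty$, then $G$ is a classical generator of $\mathcal{S}$. (3) Suppose that $\mathcal{S}$ has an algebraic $t$-structure $(\mathcal{S}^{\leq0},\mathcal{S}^{\geq0})$. Let $G$ be the direct sum of the isomorphism classes of simple objects in the heart of $(\mathcal{S}^{\leq0},\mathcal{S}^{\geq0})$. Then $\mathrm{findim}(\mathcal{S},G)=\mathrm{findim}(\mathcal{S}^{\mathrm{op}},G^{\mathrm{op}})=0$. (4) Suppose that $\mathcal{S}=\langle G\rangle^{(-\infty,m]}$ for some $G\in\mathcal{S}$ and $m\in\mathbb{Z}$. Then $\mathrm{findim}(\mathcal{S},G)=0$. In particular, if there are integers $n\leq m$ with $\mathcal{S}=\langle G\rangle^{[n,m]}$, then both $\mathrm{findim}(\mathcal{S})$ and $\mathrm{findim}(\mathcal{S}^{\mathrm{op}})$ are finite. (5) Let $R$ be a ring. Then $\mathrm{findim}(\mathcal{K}^b(R\text{-proj}),R)=\mathrm{findim}(R)$. In particular, $\mathrm{findim}(R)<\infty$ if and only if $\mathrm{findim}(\mathcal{K}^b(R\text{-proj}))<\infty$.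
   Context: For an object $G$ of a triangulated category $\mathcal{S}$ and (possibly infinite) integers $A\leq B$, $G[A,B]:=\{G[-i]\mid i\in\mathbb{Z},A\leq i\leq B\}$ (round brackets at infinite ends), and $\langle G\rangle^{[A,B]}$ is the full subcategory of all direct summands of objects obtained by iterated extensions of finite direct sums of objects of $G[A,B]$. In particular $\langle G\rangle^{(-\infty,n]}$ (resp. $\langle G\rangle^{[n,\infty)}$) is the smallest full subcategory containing $G[-n]$ and closed under extensions, direct summands and positive (resp. negative) shifts, and $\langle G\rangle:=\langle G\rangle^{(-\infty,\infty)}$ is the smallest full triangulated subcategory containing $G$ and closed under direct summands. $G$ is a classical generator of $\mathcal{S}$ if $\mathcal{S}=\langle G\rangle$. $\mathcal{A}^{\perp}:=\{Y\in\mathcal{S}\mid\mathrm{Hom}_{\mathcal{S}}(A,Y)=0\ \forall A\in\mathcal{A}\}$. $\mathrm{findim}(\mathcal{S},G):=\inf\{n\in\mathbb{N}\mid G(-\infty,-1]^{\perp}\subseteq\langle G\rangle^{[0,\infty)}[n]\}$ ($\inf\emptyset=\infty$). $\mathrm{findim}(\mathcal{S})<\infty$ (is finite) means that $\mathrm{findim}(\mathcal{S},G)<\infty$ for some object $G$. $G^{\mathrm{op}}$ is $G$ viewed in $\mathcal{S}^{\mathrm{op}}$. A $t$-structure $(\mathcal{S}^{\leq0},\mathcal{S}^{\geq0})$ (with $\mathcal{S}^{\leq n}=\mathcal{S}^{\leq0}[-n]$, $\mathcal{S}^{\geq n}=\mathcal{S}^{\geq0}[-n]$, standard axioms of Beilinson–Bernstein–Deligne)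 is bounded if $\mathcal{S}=\bigcup_n\mathcal{S}^{\leq n}=\bigcup_n\mathcal{S}^{\geq-n}$; its heart is $\mathcal{S}^{\leq0}\cap\mathcal{S}^{\geq0}$. A bounded $t$-structure is algebraic if its heart is a length category (every object has a finite filtration with simple factors) with finitely many isomorphism classes of simple objects; $G$ in (3) is the direct sum of one representative of each class. For a ring $R$ (associative with identity), $\mathcal{K}^b(R\text{-proj})$ is the bounded homotopy category of finitely generated projective left $R$-modules, and $\mathrm{findim}(R)\in\mathbb{N}\cup\{\infty\}$ is the supremum of the projective dimensions of those left $R$-modules having a finite projective resolution by finitely generated projective $R$-modules. *)

(* Defs.v *)
From HB Require Import structures.
From mathcomp Require Import all_boot all_order all_algebra.
From mathcomp Require Import ring_quotient.
From mathcomp Require Import boolp.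

Set Implicit Arguments.
Unset Strict Implicit.
Unset Printing Implicit Defensive.

Import Order.TTheory GRing.Theory Num.Theory.
Local Open Scope ring_scope.

Record preadditive := Preadditive {
  ob :> Type;
  hom : ob -> ob -> zmodType;
  idm : forall X, hom X X;
  comp : forall X Y Z, hom Y Z -> hom X Y -> hom X Z;
  comp1m : forall X Y (f : hom X Y), comp (idm Y) f = f;
  compm1 : forall X Y (f : hom X Y), comp f (idm X) = f;
  compA : forall X Y Z W (h : hom Z W) (g : hom Y Z) (f : hom X Y),
    comp h (comp g f) = comp (comp h g) f;
  compDl : forall X Y Z (g g' : hom Y Z) (f : hom X Y),
    comp (g + g') f = comp g f + comp g' f;
  compDr : forall X Y Z (g : hom Y Z) (f f' : hom X Y),
    comp g (f + f') = comp g f + comp g f'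
}.

Arguments idm {_} X.
Arguments comp {_ X Y Z} g f.
Notation "g ∘ f" := (comp g f) (at level 40, left associativity).

Definition opcat (C : preadditive) : preadditive :=
  @Preadditive C (fun X Y => @hom C Y X) (fun X => idm X)
    (fun _ _ _ g f => f ∘ g)
    (fun _ _ f => compm1 f) (fun _ _ f => comp1m f)
    (fun _ _ _ _ h g f => esym (compA f g h))
    (fun _ _ _ g g' f => compDr f g g') (fun _ _ _ g f f' => compDl f f' g).

Definition full_sub (C : preadditive) (A : C -> Prop) : preadditive :=
  @Preadditive {X : C | A X} (fun X Y => hom (sval X) (sval Y))
    (fun X => idm (sval X)) (fun _ _ _ g f => g ∘ f)
    (fun _ _ f => comp1m f) (fun _ _ f => compm1 f)
    (fun _ _ _ _ h g f => compA h g f)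
    (fun _ _ _ g g' f => compDl g g' f) (fun _ _ _ g f f' => compDr g f f').

Section Preadditive.
Variable C : preadditive.
Implicit Types X Y Z : C.

Definition is_iso X Y (f : hom X Y) : Prop :=
  exists g : hom Y X, g ∘ f = idm X /\ f ∘ g = idm Y.

Definition isomorphic X Y : Prop := exists f : hom X Y, is_iso f.

Definition is_zero X : Prop := idm X = 0.

Record is_biprod X Y Z (i1 : hom X Z) (i2 : hom Y Z) (p1 : hom Z X)
    (p2 : hom Z Y) : Prop := IsBiprod {
  biprod_p1i1 : p1 ∘ i1 = idm X;
  biprod_p2i2 : p2 ∘ i2 = idm Y;
  biprod_p1i2 : p1 ∘ i2 = 0;
  biprod_p2i1 : p2 ∘ i1 = 0;
  biprod_sum : i1 ∘ p1 + i2 ∘ p2 = idm Z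
}.

Definition direct_summand X Z : Prop :=
  exists Y (i1 : hom X Z) (i2 : hom Y Z) (p1 : hom Z X) (p2 : hom Z Y),
    is_biprod i1 i2 p1 p2.

(* Z is a direct sum of the finite family X; for n = 0 this says that Z is a
   zero object. *)
Definition is_dsum n (X : 'I_n -> C) Z : Prop :=
  exists (i : forall k, hom (X k) Z) (p : forall k, hom Z (X k)),
    [/\ forall k, p k ∘ i k = idm (X k),
        forall j k, j != k -> p j ∘ i k = 0
      & \sum_k i k ∘ p k = idm Z].

Definition is_mono X Y (f : hom X Y) : Prop :=
  forall Z (g : hom Z X), f ∘ g = 0 -> g = 0.

Definition is_coker X Y Z (f : hom X Y) (c : hom Y Z) : Prop :=
  c ∘ f = 0 /\
  forall W (g : hom Y W), g ∘ f = 0 -> exists! g' : hom Z W, g' ∘ c = g.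

Definition is_simple X : Prop :=
  ~ is_zero X /\
  forall Y (f : hom Y X), is_mono f -> is_zero Y \/ is_iso f.

Inductive finite_filtration : C -> Prop :=
| filtration_zero X : is_zero X -> finite_filtration X
| filtration_step X' X Q (f : hom X' X) (c : hom X Q) :
    finite_filtration X' -> is_mono f -> is_coker f c -> is_simple Q ->
    finite_filtration X.

Definition length_category : Prop := forall X, finite_filtration X.

Definition simple_representatives n (s : 'I_n -> C) : Prop :=
  [/\ forall k, is_simple (s k),
      forall j k, isomorphic (s j) (s k) -> j = k
    & forall X, is_simple X -> exists k, isomorphic X (s k)].

Definition right_perp (A : C -> Prop) Y : Prop :=
  forall X, A X -> forall f : hom X Y, f = 0.

Definition finite_sums (A : C -> Prop) Z : Prop :=
  exists n (X : 'I_n -> C), (forall k, A (X k)) /\ is_dsum X Z.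

End Preadditive.

Record functor (C D : preadditive) := Functor {
  fob :> C -> D;
  fmap : forall X Y : C, hom X Y -> hom (fob X) (fob Y);
  fmap1 : forall X, fmap (idm X) = idm (fob X);
  fmapM : forall (X Y Z : C) (g : hom Y Z) (f : hom X Y),
    fmap (g ∘ f) = fmap g ∘ fmap f;
  fmapD : forall (X Y : C) (f f' : hom X Y), fmap (f + f') = fmap f + fmap f'
}.

Definition opfunctor C D (F : functor C D) : functor (opcat C) (opcat D) :=
  @Functor (opcat C) (opcat D) F (fun X Y f => @fmap C D F Y X f)
    (fun X => fmap1 F X) (fun _ _ _ g f => fmapM F f g)
    (fun _ _ f f' => fmapD F f f').

Definition triangle_iso (C : preadditive) (S : functor C C)
    (X Y Z : C) (f : hom X Y) (g : hom Y Z) (h : hom Z (S X))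
    (X' Y' Z' : C) (f' : hom X' Y') (g' : hom Y' Z') (h' : hom Z' (S X'))
    : Prop :=
  exists (a : hom X X') (b : hom Y Y') (c : hom Z Z'),
    [/\ is_iso a, is_iso b & is_iso c] /\
    [/\ b ∘ f = f' ∘ a, c ∘ g = g' ∘ b & fmap S a ∘ h = h' ∘ c].

(* The suspension is an additive autoequivalence, with a chosen
   quasi-inverse. *)
Record triangulated_data := TriangulatedData {
  tri_cat :> preadditive;
  shift : functor tri_cat tri_cat;
  unshift : functor tri_cat tri_cat;
  shift_unit : forall X, hom X (shift (unshift X));
  shift_counit : forall X, hom (unshift (shift X)) X;
  dist : forall X Y Z : tri_cat, hom X Y -> hom Y Z -> hom Z (shift X) -> Prop
}.

Arguments shift {_}.
Arguments unshift {_}.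
Arguments shift_unit {_} X.
Arguments shift_counit {_} X.
Arguments dist {_ X Y Z} f g h.

Record is_triangulated (S : triangulated_data) : Prop := IsTriangulated {
  has_zero : exists Z : S, is_zero Z;
  has_biprod : forall X Y : S, exists (Z : S) (i1 : hom X Z) (i2 : hom Y Z)
    (p1 : hom Z X) (p2 : hom Z Y), is_biprod i1 i2 p1 p2;
  shift_unit_iso : forall X : S, is_iso (shift_unit X);
  shift_unit_nat : forall (X Y : S) (f : hom X Y),
    shift_unit Y ∘ f = fmap shift (fmap unshift f) ∘ shift_unit X;
  shift_counit_iso : forall X : S, is_iso (shift_counit X);
  shift_counit_nat : forall (X Y : S) (f : hom X Y),
    f ∘ shift_counit X = shift_counit Y ∘ fmap unshift (fmap shift f);
  TR1_iso : forall (X Y Z : S) (f : hom X Y) (g : hom Y Z)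
      (h : hom Z (shift X)) (X' Y' Z' : S) (f' : hom X' Y') (g' : hom Y' Z')
      (h' : hom Z' (shift X')),
    triangle_iso f g h f' g' h' -> dist f g h -> dist f' g' h';
  TR1_id : forall X Z : S, is_zero Z ->
    dist (idm X) (0 : hom X Z) (0 : hom Z (shift X));
  TR1_cone : forall (X Y : S) (f : hom X Y),
    exists (Z : S) (g : hom Y Z) (h : hom Z (shift X)), dist f g h;
  TR2 : forall (X Y Z : S) (f : hom X Y) (g : hom Y Z) (h : hom Z (shift X)),
    dist f g h <-> dist g h (- fmap shift f);
  TR3 : forall (X Y Z : S) (f : hom X Y) (g : hom Y Z) (h : hom Z (shift X))
      (X' Y' Z' : S) (f' : hom X' Y') (g' : hom Y' Z') (h' : hom Z' (shift X'))
      (a : hom X X') (b : hom Y Y'),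
    dist f g h -> dist f' g' h' -> b ∘ f = f' ∘ a ->
    exists c : hom Z Z', c ∘ g = g' ∘ b /\ fmap shift a ∘ h = h' ∘ c;
  TR4 : forall (X Y Z X' Y' Z' : S) (f : hom X Y) (g : hom Y Z)
      (f1 : hom Y Z') (f2 : hom Z' (shift X))
      (g1 : hom Z X') (g2 : hom X' (shift Y))
      (h1 : hom Z Y') (h2 : hom Y' (shift X)),
    dist f f1 f2 -> dist g g1 g2 -> dist (g ∘ f) h1 h2 ->
    exists (u : hom Z' Y') (v : hom Y' X'),
      dist u v (fmap shift f1 ∘ g2) /\
      [/\ u ∘ f1 = h1 ∘ g, h2 ∘ u = f2, v ∘ h1 = g1
        & g2 ∘ v = fmap shift f ∘ h2]
}.

Record triangulated := Triangulated {
  tri_data :> triangulated_data;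
  triP : is_triangulated tri_data
}.

(* A triangle X -f-> Y -g-> Z -h-> S^-1 X of the opposite category (so that
   f : Y -> X, g : Z -> Y and h : S^-1 X -> Z in the original one) is
   distinguished iff Z -g-> Y -f-> X -> S Z is, where the last map is S h
   precomposed with X ~= S (S^-1 X). *)
Definition op (S : triangulated_data) : triangulated_data :=
  @TriangulatedData (opcat S) (opfunctor unshift) (opfunctor shift)
    (fun X => @shift_counit S X) (fun X => @shift_unit S X)
    (fun X Y Z f g h =>
       @dist S Z Y X g f (@fmap S S shift _ _ h ∘ @shift_unit S X)).

(* The infimum of a set of natural numbers in N ∪ {∞}, with None for ∞. *)
Definition inf_nat (P : nat -> Prop) : option nat :=
  if pselect (exists n, `[< P n >]) is left h then Some (ex_minn h) else None.

Definition le_enat (a b : option nat) : Prop :=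
  match a, b with
  | _, None => True
  | None, Some _ => False
  | Some m, Some n => (m <= n)%N
  end.

Definition sup_enat (A : option nat -> Prop) : option nat :=
  inf_nat (fun n => forall a, A a -> le_enat a (Some n)).

Definition finite_enat (a : option nat) : Prop := exists n, a = Some n.

Section Generation.
Variable S : triangulated_data.
Implicit Types (X Y Z G : S) (A : S -> Prop) (I : interval int).

Definition shiftz X (n : int) : S :=
  match n with
  | Posz k => iter k shift X
  | Negz k => iter k.+1 unshift X
  end.

(* The full subcategory A[n], closed under isomorphism. *)
Definition shift_class A (n : int) Y : Prop :=
  exists X, A X /\ isomorphic Y (shiftz X n).

Definition shifts G I X : Prop := exists2 i : int, i \in I & X = shiftz G (- i).

Inductive ext_closure A : S -> Prop :=
| ext_base X : A X -> ext_closure A X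
| ext_step X Y Z (f : hom X Y) (g : hom Y Z) (h : hom Z (shift X)) :
    dist f g h -> ext_closure A X -> ext_closure A Z -> ext_closure A Y.

Definition generated G I X : Prop :=
  exists Y, ext_closure (finite_sums (shifts G I)) Y /\ direct_summand X Y.

Definition classical_generator G : Prop := forall X, generated G `]-oo, +oo[ X.

Definition findim G : option nat :=
  inf_nat (fun n => forall Y, right_perp (shifts G `]-oo, -1]) Y ->
    shift_class (generated G `[0, +oo[) n Y).

Definition findim_finite : Prop := exists G, finite_enat (findim G).

Record t_structure := TStructure {
  t_le0 : S -> Prop;
  t_ge0 : S -> Prop;
  t_le0_iso : forall X Y, isomorphic X Y -> t_le0 X -> t_le0 Y;
  t_ge0_iso : forall X Y, isomorphic X Y -> t_ge0 X -> t_ge0 Y;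
  t_le01 : forall X, t_le0 X -> shift_class t_le0 (- 1) X;
  t_ge10 : forall X, shift_class t_ge0 (- 1) X -> t_ge0 X;
  t_hom0 : forall X Y (f : hom X Y),
    t_le0 X -> shift_class t_ge0 (- 1) Y -> f = 0;
  t_trunc : forall X, exists Y Z (f : hom Y X) (g : hom X Z)
      (h : hom Z (shift Y)),
    [/\ t_le0 Y, shift_class t_ge0 (- 1) Z & dist f g h]
}.

Definition t_le (t : t_structure) (n : int) := shift_class (t_le0 t) (- n).
Definition t_ge (t : t_structure) (n : int) := shift_class (t_ge0 t) (- n).

Definition t_bounded (t : t_structure) : Prop :=
  (forall X, exists n : int, t_le t n X) /\
  (forall X, exists n : int, t_ge t (- n) X).

Definition heart (t : t_structure) : preadditive :=
  full_sub (fun X => t_le0 t X /\ t_ge0 t X).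

Definition t_algebraic (t : t_structure) : Prop :=
  [/\ t_bounded t, length_category (heart t)
    & exists n (s : 'I_n -> heart t), simple_representatives s].

End Generation.

Section Calculus.
Variable C : preadditive.
Implicit Types X Y Z : C.

Lemma comp0m X Y Z (f : hom X Y) : (0 : hom Y Z) ∘ f = 0.
Proof. by apply: (addrI (0 ∘ f)); rewrite -compDl !addr0. Qed.

Lemma compm0 X Y Z (g : hom Y Z) : g ∘ (0 : hom X Y) = 0.
Proof. by apply: (addrI (g ∘ 0)); rewrite -compDr !addr0. Qed.

Lemma compNm X Y Z (g : hom Y Z) (f : hom X Y) : - g ∘ f = - (g ∘ f).
Proof. by apply: (addrI (g ∘ f)); rewrite -compDl !subrr comp0m. Qed.

Lemma compmN X Y Z (g : hom Y Z) (f : hom X Y) : g ∘ - f = - (g ∘ f).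
Proof. by apply: (addrI (g ∘ f)); rewrite -compDr !subrr compm0. Qed.

Lemma compBl X Y Z (g g' : hom Y Z) (f : hom X Y) :
  (g - g') ∘ f = g ∘ f - g' ∘ f.
Proof. by rewrite compDl compNm. Qed.

Lemma compBr X Y Z (g : hom Y Z) (f f' : hom X Y) :
  g ∘ (f - f') = g ∘ f - g ∘ f'.
Proof. by rewrite compDr compmN. Qed.

Lemma compMzl X Y Z (g : hom Y Z) (f : hom X Y) (n : int) :
  (g *~ n) ∘ f = (g ∘ f) *~ n.
Proof.
have nat_case (k : nat) : (g *+ k) ∘ f = (g ∘ f) *+ k.
  by elim: k => [|k IH]; rewrite ?mulr0n ?comp0m // !mulrS compDl IH.
by case: n => k; rewrite ?NegzE ?mulrNz ?compNm -!pmulrn nat_case.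
Qed.

Lemma compMzr X Y Z (g : hom Y Z) (f : hom X Y) (n : int) :
  g ∘ (f *~ n) = (g ∘ f) *~ n.
Proof.
have nat_case (k : nat) : g ∘ (f *+ k) = (g ∘ f) *+ k.
  by elim: k => [|k IH]; rewrite ?mulr0n ?compm0 // !mulrS compDr IH.
by case: n => k; rewrite ?NegzE ?mulrNz ?compmN -!pmulrn nat_case.
Qed.

End Calculus.

Section Complexes.
Variable A : preadditive.

(* cast X i j is the identity if i = j, and 0 otherwise. *)
Definition cast (X : int -> A) (i j : int) : hom (X i) (X j) :=
  match i =P j with
  | ReflectT e =>
      match e in _ = k return hom (X i) (X k) with erefl => idm (X i) end
  | ReflectF _ => 0
  end.

Lemma cast_id (X : int -> A) i : cast X i i = idm (X i).
Proof. by rewrite /cast; case: eqP => // e; rewrite (eq_axiomK e). Qed.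

Lemma cast_neq (X : int -> A) i j : i != j -> cast X i j = 0.
Proof. by rewrite /cast; case: eqP. Qed.

(* Cohomological grading. The differential is given for all pairs of indices
   and vanishes unless j = i + 1; this avoids transports along i + 1 - 1 = i. *)
Record complex := Complex {
  cx :> int -> A;
  cd : forall i j, hom (cx i) (cx j);
  cd_shape : forall i j, j != i + 1 -> cd i j = 0;
  cd_sq : forall i j k, cd j k ∘ cd i j = 0;
  cx_bounded : exists a b : int, forall i : int, ~~ (a <= i <= b) -> is_zero (cx i)
}.

Record chain_map (X Y : complex) := ChainMap {
  cm :> forall i, hom (X i) (Y i);
  cm_comm : forall i j, cd Y i j ∘ cm i = cm j ∘ cd X i j
}.

Lemma chain_mapP (X Y : complex) (f g : chain_map X Y) :
  (forall i, f i = g i) -> f = g.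
Proof.
case: f g => [f fP] [g gP] /= fg.
have {}fg : f = g by apply: functional_extensionality_dep.
by case: _ / fg gP => gP; rewrite (Prop_irrelevance fP gP).
Qed.

Definition cm_id (X : complex) : chain_map X X.
Proof.
by exists (fun i => idm (X i)) => i j; rewrite comp1m compm1.
Defined.

Definition cm_comp (X Y Z : complex) (g : chain_map Y Z) (f : chain_map X Y) :
  chain_map X Z.
Proof.
exists (fun i => g i ∘ f i) => i j.
by rewrite compA cm_comm -compA cm_comm compA.
Defined.

Section ChainMapZmodule.
Variables X Y : complex.

Definition cm_zero : chain_map X Y.
Proof. by exists (fun i => 0) => i j; rewrite compm0 comp0m. Defined.

Definition cm_opp (f : chain_map X Y) : chain_map X Y.
Proof.
by exists (fun i => - f i) => i j; rewrite compmN compNm cm_comm.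
Defined.

Definition cm_add (f g : chain_map X Y) : chain_map X Y.
Proof.
by exists (fun i => f i + g i) => i j; rewrite compDr compDl !cm_comm.
Defined.

HB.instance Definition _ := gen_eqMixin (chain_map X Y).
HB.instance Definition _ := gen_choiceMixin (chain_map X Y).

Lemma cm_addA : associative cm_add.
Proof. by move=> f g h; apply: chain_mapP => i /=; rewrite addrA. Qed.
Lemma cm_addC : commutative cm_add.
Proof. by move=> f g; apply: chain_mapP => i /=; rewrite addrC. Qed.
Lemma cm_add0 : left_id cm_zero cm_add.
Proof. by move=> f; apply: chain_mapP => i /=; rewrite add0r. Qed.
Lemma cm_addN : left_inverse cm_zero cm_opp cm_add.
Proof. by move=> f; apply: chain_mapP => i /=; rewrite addNr. Qed.

HB.instance Definition _ :=
  GRing.isZmodule.Build (chain_map X Y) cm_addA cm_addC cm_add0 cm_addN.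

Definition null_homotopic (f : chain_map X Y) : Prop :=
  exists s : forall i j, hom (X i) (Y j),
    forall h i j, i = h + 1 -> j = i + 1 ->
      f i = cd Y h i ∘ s i h + s j i ∘ cd X i j.

Definition null_homotopicb : {pred chain_map X Y} :=
  fun f => `[< null_homotopic f >].

Lemma null_homotopic_zmod_closed : zmod_closed null_homotopicb.
Proof.
split=> [|f g /asboolP[s sP] /asboolP[t tP]]; apply/asboolP.
  by exists (fun _ _ => 0) => h i j _ _; rewrite compm0 comp0m addr0.
exists (fun i j => s i j - t i j) => h i j ei ej /=.
rewrite (sP h i j) // (tP h i j) // compBr compBl.
by rewrite opprD !addrA; congr (_ - _); rewrite -!addrA; congr (_ + _); rewrite addrC.
Qed.

HB.instance Definition _ := GRing.isZmodClosed.Build (chain_map X Y)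
  null_homotopicb null_homotopic_zmod_closed.

Definition kb_hom : zmodType :=
  Quotient.quot (null_homotopicb : zmodClosed (chain_map X Y)).

Definition kb_class (f : chain_map X Y) : kb_hom := (\pi_kb_hom f)%qT.

Definition kb_repr (f : kb_hom) : chain_map X Y := repr f.

Lemma kb_reprK f : kb_class (kb_repr f) = f.
Proof. exact: reprK. Qed.

Lemma kb_classP (f g : chain_map X Y) :
  kb_class f = kb_class g <-> null_homotopic (f - g).
Proof.
split=> [/eqP | fg].
  by rewrite -Quotient.idealrBE => /asboolP.
by apply/eqP; rewrite -Quotient.idealrBE; apply/asboolP.
Qed.

Lemma kb_classD (f g : chain_map X Y) :
  kb_class (f + g) = kb_class f + kb_class g.
Proof. by rewrite /kb_class !piE. Qed.

End ChainMapZmodule.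

Lemma null_homotopic_compl (X Y Z : complex) (g : chain_map Y Z)
    (f : chain_map X Y) : null_homotopic f -> null_homotopic (cm_comp g f).
Proof.
move=> [s sP]; exists (fun i j => g j ∘ s i j) => h i j ei ej /=.
by rewrite (sP h i j) // compDr !compA cm_comm.
Qed.

Lemma null_homotopic_compr (X Y Z : complex) (g : chain_map Y Z)
    (f : chain_map X Y) : null_homotopic g -> null_homotopic (cm_comp g f).
Proof.
move=> [s sP]; exists (fun i j => s i j ∘ f i) => h i j ei ej /=.
by rewrite (sP h i j) // compDl -!compA cm_comm.
Qed.

Definition kb_comp (X Y Z : complex) (g : kb_hom Y Z) (f : kb_hom X Y) :
  kb_hom X Z := kb_class (cm_comp (kb_repr g) (kb_repr f)).

Lemma kb_compE (X Y Z : complex) (g : chain_map Y Z) (f : chain_map X Y) :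
  kb_comp (kb_class g) (kb_class f) = kb_class (cm_comp g f).
Proof.
set g' := kb_repr (kb_class g); set f' := kb_repr (kb_class f).
have /kb_classP gP : kb_class g' = kb_class g by rewrite kb_reprK.
have /kb_classP fP : kb_class f' = kb_class f by rewrite kb_reprK.
transitivity (kb_class (cm_comp g f')); apply/kb_classP.
  have -> : cm_comp g' f' - cm_comp g f' = cm_comp (g' - g) f'.
    by apply: chain_mapP => i /=; rewrite compBl.
  exact: null_homotopic_compr.
have -> : cm_comp g f' - cm_comp g f = cm_comp g (f' - f).
  by apply: chain_mapP => i /=; rewrite compBr.
exact: null_homotopic_compl.
Qed.

Lemma kb_comp1m X Y (f : kb_hom X Y) : kb_comp (kb_class (cm_id Y)) f = f.
Proof.
rewrite -[f]kb_reprK kb_compE; congr kb_class.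
by apply: chain_mapP => i /=; rewrite comp1m.
Qed.

Lemma kb_compm1 X Y (f : kb_hom X Y) : kb_comp f (kb_class (cm_id X)) = f.
Proof.
rewrite -[f]kb_reprK kb_compE; congr kb_class.
by apply: chain_mapP => i /=; rewrite compm1.
Qed.

Lemma kb_compA X Y Z W (h : kb_hom Z W) (g : kb_hom Y Z) (f : kb_hom X Y) :
  kb_comp h (kb_comp g f) = kb_comp (kb_comp h g) f.
Proof.
rewrite -[h]kb_reprK -[g]kb_reprK -[f]kb_reprK !kb_compE; congr kb_class.
by apply: chain_mapP => i /=; rewrite compA.
Qed.

Lemma kb_compDl X Y Z (g g' : kb_hom Y Z) (f : kb_hom X Y) :
  kb_comp (g + g') f = kb_comp g f + kb_comp g' f.
Proof.
rewrite -[g]kb_reprK -[g']kb_reprK -[f]kb_reprK -kb_classD !kb_compE.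
by rewrite -kb_classD; congr kb_class; apply: chain_mapP => i /=; rewrite compDl.
Qed.

Lemma kb_compDr X Y Z (g : kb_hom Y Z) (f f' : kb_hom X Y) :
  kb_comp g (f + f') = kb_comp g f + kb_comp g f'.
Proof.
rewrite -[g]kb_reprK -[f]kb_reprK -[f']kb_reprK -kb_classD !kb_compE.
by rewrite -kb_classD; congr kb_class; apply: chain_mapP => i /=; rewrite compDr.
Qed.

Definition kb_cat : preadditive :=
  @Preadditive complex kb_hom (fun X => kb_class (cm_id X)) kb_comp
    kb_comp1m kb_compm1 kb_compA kb_compDl kb_compDr.

Section Shift.
Variable n : int.

(* X[n]^i = X^{i+n}, with differential multiplied by (-1)^n. *)
Definition cx_shift (X : complex) : complex.
Proof.
exists (fun i => X (i + n))
  (fun i j => cd X (i + n) (j + n) *~ (-1) ^+ `|n|%N).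
- move=> i j ji; rewrite cd_shape ?mul0rz // addrAC.
  by apply: contra ji => /eqP/addIr->.
- by move=> i j k; rewrite compMzl compMzr cd_sq !mul0rz.
- have [a [b abP]] := cx_bounded X; exists (a - n), (b - n) => i ni.
  by apply: (abP (i + n)); rewrite -[_ <= b]lerBrDr -[a <= _]lerBlDr.
Defined.

Definition cm_shift X Y (f : chain_map X Y) :
  chain_map (cx_shift X) (cx_shift Y).
Proof.
exists (fun i => f (i + n)) => i j /=.
by rewrite compMzl compMzr cm_comm.
Defined.

Lemma null_homotopic_shift X Y (f : chain_map X Y) :
  null_homotopic f -> null_homotopic (cm_shift f).
Proof.
move=> [s sP].
exists (fun i j => s (i + n) (j + n) *~ (-1) ^+ `|n|%N) => h i j ei ej /=.
rewrite (sP (h + n) (i + n) (j + n)); last 2 first.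
- by rewrite ei addrAC.
- by rewrite ej addrAC.
by rewrite !compMzl !compMzr -!mulrzA -!expr2 !sqrr_sign !mulr1z.
Qed.

Definition kb_fmap X Y (f : kb_hom X Y) : kb_hom (cx_shift X) (cx_shift Y) :=
  kb_class (cm_shift (kb_repr f)).

Lemma kb_fmapE X Y (f : chain_map X Y) :
  kb_fmap (kb_class f) = kb_class (cm_shift f).
Proof.
apply/kb_classP.
have /kb_classP/null_homotopic_shift : kb_class (kb_repr (kb_class f)) =
  kb_class f by rewrite kb_reprK.
by congr null_homotopic; apply: chain_mapP.
Qed.

Lemma kb_fmap1 X : kb_fmap (kb_class (cm_id X)) = kb_class (cm_id (cx_shift X)).
Proof. by rewrite kb_fmapE; congr kb_class; apply: chain_mapP. Qed.

Lemma kb_fmapM X Y Z (g : kb_hom Y Z) (f : kb_hom X Y) :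
  kb_fmap (kb_comp g f) = kb_comp (kb_fmap g) (kb_fmap f).
Proof.
rewrite -[g]kb_reprK -[f]kb_reprK kb_compE !kb_fmapE kb_compE.
by congr kb_class; apply: chain_mapP.
Qed.

Lemma kb_fmapD X Y (f f' : kb_hom X Y) :
  kb_fmap (f + f') = kb_fmap f + kb_fmap f'.
Proof.
rewrite -[f]kb_reprK -[f']kb_reprK -kb_classD !kb_fmapE -kb_classD.
by congr kb_class; apply: chain_mapP.
Qed.

Definition kb_shift : functor kb_cat kb_cat :=
  @Functor kb_cat kb_cat cx_shift kb_fmap kb_fmap1 kb_fmapM kb_fmapD.

End Shift.

Definition kb_unit_map (X : complex) :
  chain_map X (cx_shift 1 (cx_shift (-1) X)).
Proof.
exists (fun i => cast X i (i + 1 - 1)) => i j /=.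
by rewrite !addrK !cast_id comp1m compm1 -mulrzA.
Defined.

Definition kb_counit_map (X : complex) :
  chain_map (cx_shift (-1) (cx_shift 1 X)) X.
Proof.
exists (fun i => cast X (i - 1 + 1) i) => i j /=.
by rewrite !subrK !cast_id comp1m compm1 -mulrzA.
Defined.

(* W is a mapping cone of phi, with canonical maps iota : Y -> W and
   pi : W -> X[1]: in each degree W^i = X^{i+1} (+) Y^i, and the differential
   maps (x, y) to (- d x, phi x + d y). *)
Definition is_cone (X Y W : complex) (phi : chain_map X Y)
    (iota : chain_map Y W) (pi : chain_map W (cx_shift 1 X)) : Prop :=
  exists (u : forall i, hom (X (i + 1)) (W i)) (r : forall i, hom (W i) (Y i)),
    (forall i, is_biprod (u i) (iota i) (pi i) (r i)) /\
    (forall i j, cd W i j ∘ u i =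
       - (u j ∘ cd X (i + 1) (j + 1)) + iota j ∘ cast Y (i + 1) j ∘ phi (i + 1)).

Definition kb_dist (X Y Z : kb_cat) (f : hom X Y) (g : hom Y Z)
    (h : hom Z (kb_shift 1 X)) : Prop :=
  exists (X' Y' W : complex) (phi : chain_map X' Y') (iota : chain_map Y' W)
      (pi : chain_map W (cx_shift 1 X')),
    is_cone phi iota pi /\
    @triangle_iso kb_cat (kb_shift 1) X Y Z f g h X' Y' W
      (kb_class phi) (kb_class iota) (kb_class pi).

Definition Kb : triangulated_data :=
  @TriangulatedData kb_cat (kb_shift 1) (kb_shift (-1))
    (fun X => kb_class (kb_unit_map X)) (fun X => kb_class (kb_counit_map X))
    kb_dist.

Section Stalk.
Variables (O P : A) (O0 : is_zero O).

Definition stalk : complex.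
Proof.
exists (fun i : int => if i == 0 then P else O) (fun i j => 0) => //.
- by move=> i j k; rewrite compm0.
- exists 0, 0 => i; rewrite -eq_le eq_sym.
  by case: (i == 0).
Defined.

End Stalk.

End Complexes.

Section Modules.
Variable R : pzRingType.

Definition surjective (U V : Type) (f : U -> V) : Prop :=
  forall y, exists x, f x = y.

Definition finitely_generated (M : lmodType R) : Prop :=
  exists n (v : 'I_n -> M), forall x, exists a : 'I_n -> R,
    x = \sum_k a k *: v k.

Definition projective (P : lmodType R) : Prop :=
  forall (U V : lmodType R) (g : {linear U -> V}) (f : {linear P -> V}),
    surjective g -> exists h : {linear P -> U}, forall x, g (h x) = f x.

(* 0 -> P_n -> ... -> P_0 -> M -> 0 is exact, with every P_i in the class C. *)
Definition has_resolution (C : lmodType R -> Prop) (n : nat) (M : lmodType R)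
    : Prop :=
  exists (P : nat -> lmodType R) (d : forall i, {linear P i.+1 -> P i})
      (e : {linear P 0%N -> M}),
    [/\ forall i, C (P i),
        forall i, (n < i)%N -> forall x : P i, x = 0,
        surjective e,
        forall x, e x = 0 <-> exists y, d 0%N y = x
      & forall i x, d i x = 0 <-> exists y, d i.+1 y = x].

Definition fg_projective (P : lmodType R) : Prop :=
  finitely_generated P /\ projective P.

Definition proj_dim (M : lmodType R) : option nat :=
  inf_nat (fun n => has_resolution projective n M).

Definition findim_ring : option nat :=
  sup_enat (fun a => exists M : lmodType R,
    (exists n, has_resolution fg_projective n M) /\ a = proj_dim M).

Section LinearZmodule.
Variables U V : lmodType R.

HB.instance Definition _ := gen_eqMixin {linear U -> V}.
HB.instance Definition _ := gen_choiceMixin {linear U -> V}.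

Lemma linear_mapP (f g : {linear U -> V}) : (forall x, f x = g x) -> f = g.
Proof.
case: f g => [f fP] [g gP] /= fg.
have {}fg : f = g by apply: functional_extensionality_dep.
case: _ / fg gP => gP; congr GRing.Linear.Pack.
case: fP gP => [[a] [b]] [[c] [d]].
by rewrite (Prop_irrelevance a c) (Prop_irrelevance b d).
Qed.

Definition lin_zero : {linear U -> V} := (\0 : U -> V).
Definition lin_opp (f : {linear U -> V}) : {linear U -> V} := (\- f : U -> V).
Definition lin_add (f g : {linear U -> V}) : {linear U -> V} :=
  (f \+ g : U -> V).

Lemma lin_addA : associative lin_add.
Proof. by move=> f g h; apply: linear_mapP => x /=; rewrite addrA. Qed.
Lemma lin_addC : commutative lin_add.
Proof. by move=> f g; apply: linear_mapP => x /=; rewrite addrC. Qed.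
Lemma lin_add0 : left_id lin_zero lin_add.
Proof. by move=> f; apply: linear_mapP => x /=; rewrite add0r. Qed.
Lemma lin_addN : left_inverse lin_zero lin_opp lin_add.
Proof. by move=> f; apply: linear_mapP => x /=; rewrite addNr. Qed.

HB.instance Definition _ :=
  GRing.isZmodule.Build {linear U -> V} lin_addA lin_addC lin_add0 lin_addN.

End LinearZmodule.

Definition lin_id (U : lmodType R) : {linear U -> U} := (idfun : U -> U).
Definition lin_comp (U V W : lmodType R) (g : {linear V -> W})
  (f : {linear U -> V}) : {linear U -> W} := (g \o f : U -> W).

Lemma lin_comp1m (U V : lmodType R) (f : {linear U -> V}) : lin_comp (lin_id V) f = f.
Proof. exact: linear_mapP. Qed.
Lemma lin_compm1 (U V : lmodType R) (f : {linear U -> V}) : lin_comp f (lin_id U) = f.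
Proof. exact: linear_mapP. Qed.
Lemma lin_compA (U V W T : lmodType R) (h : {linear W -> T}) (g : {linear V -> W})
    (f : {linear U -> V}) :
  lin_comp h (lin_comp g f) = lin_comp (lin_comp h g) f.
Proof. exact: linear_mapP. Qed.
Lemma lin_compDl (U V W : lmodType R) (g g' : {linear V -> W}) (f : {linear U -> V}) :
  lin_comp (g + g') f = lin_comp g f + lin_comp g' f.
Proof. exact: linear_mapP. Qed.
Lemma lin_compDr (U V W : lmodType R) (g : {linear V -> W}) (f f' : {linear U -> V}) :
  lin_comp g (f + f') = lin_comp g f + lin_comp g f'.
Proof. by apply: linear_mapP => x /=; rewrite raddfD. Qed.

Definition lmod_cat : preadditive :=
  @Preadditive (lmodType R) (fun U V => {linear U -> V}) lin_id lin_comp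
    lin_comp1m lin_compm1 lin_compA lin_compDl lin_compDr.

Definition fgproj_cat : preadditive := @full_sub lmod_cat fg_projective.

Lemma fg_projective_regular : fg_projective R^o.
Proof.
split; first by exists 1%N, (fun=> 1) => x; exists (fun=> x);
  rewrite big_ord1 /GRing.scale /= mulr1.
move=> U V g f g_surj; have [u gu] := g_surj (f 1).
pose h (x : R^o) := x *: u.
have h_lin : linear h by move=> a x y; rewrite /h scalerDl scalerA.
pose hM := GRing.isLinear.Build R R^o U _ h h_lin.
pose hL : {linear R^o -> U} := HB.pack h hM.
exists hL => x; rewrite /= /h linearZ gu -linearZ /=.
by congr (f _); rewrite /GRing.scale /= mulr1.
Qed.

Lemma fg_projective_zero : fg_projective 'rV[R]_0.
Proof.
split.
  by exists 0%N, (fun=> 0) => x; exists (fun=> 0); rewrite big_ord0 [x]thinmx0.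
move=> U V g f _; exists (lin_zero 'rV[R]_0 U) => x /=.
by rewrite [x]thinmx0 !linear0.
Qed.

Definition fgproj_regular : fgproj_cat :=
  exist _ (R^o : lmodType R) fg_projective_regular.
Definition fgproj_zero : fgproj_cat :=
  exist _ ('rV[R]_0 : lmodType R) fg_projective_zero.

Lemma fgproj_zeroP : is_zero fgproj_zero.
Proof. by apply: linear_mapP => x; rewrite [x]thinmx0 linear0. Qed.

Definition Kb_proj : triangulated_data := Kb fgproj_cat.
Definition Kb_regular : Kb_proj := stalk fgproj_regular fgproj_zeroP.

End Modules.

(* Main.v *)
From HB Require Import structures.
From mathcomp Require Import all_boot all_order all_algebra.
From mathcomp Require Import ring_quotient.
From mathcomp Require Import boolp zify.
Require Import Defs.

(** Why the theorem holds.

    A class of objects is called extension-closed here when it contains the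
    zero objects and is stable under extensions and retracts. The class
    generated by a set of shifts of G is the smallest extension-closed class
    containing those shifts (gen_min, gen_closed), so that membership in other
    classes and vanishing of Hom are tested on the shifts of G alone. The
    notions in play are self-dual: extension-closed classes of a category and
    of its opposite are the same, and the degrees change sign (op_sgen).

    Change of generator. If G is built from the shifts H[-N], ..., H[N], then
    an object orthogonal to the positive shifts of H becomes, after N shifts
    down, orthogonal to the positive shifts of G, and an object built from G
    in degrees at least a is built from H in degrees at least a - N. Hence
    finiteness passes from G to H, with a loss of 2 N. If everything is built
    from G in degrees at most m, then, shifting, everything is built from the
    positive shifts of G, and the orthogonal of these is zero.

    Bounded t-structures. Some shift of a given object lies so high that
    it receives no map from the positive shifts of G; so if the orthogonal
    of these is contained in the subcategory generated by G, every object
    is. In the algebraic case a mono of the heart has its cone in the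
    heart (cone_mono_heart), so that the steps of a filtration with simple
    factors are triangles and the heart is built from G. The orthogonal of
    the positive shifts of G is then the coaisle in degrees at least 0:
    the lowest slice of an object in a negative degree is built from a
    positive shift of G, its map to the object vanishes, and it can be cut
    off (nonneg_tge). Boundedness lets one build such an object from its
    finitely many slices (sgen_interval). The only input, that the heart
    is built from G, is self-dual.

    Rings. The triangles of the homotopy category are, up to isomorphism,
    the degreewise split short exact sequences (split_dist); from this
    come the axioms of a triangulated category and the triangles of brutal
    truncations. A complex Y is built from R in degrees at least m exactly
    when its projection to the truncation in degrees below m is null-
    homotopic, that is, when Y has a contracting homotopy in degrees below
    m (gen_contracts): one direction is orthogonality, and in the other
    one Y is a retract of its truncation in degrees at least m. The
    complexes orthogonal to the positive shifts of R are those that are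
    exact in negative degrees; their part in nonpositive degrees is a
    finite resolution of the cokernel M of their differential from -1 to
    0. For such a resolution, a contraction in degrees below -n exists
    exactly when M has projective dimension at most n: by comparison with
    a resolution of length n (resolution_splits), respectively by cutting
    the resolution at the cokernel of its differential from n + 1 to n,
    which is projective (truncate_resolution). *)

Set Implicit Arguments.
Unset Strict Implicit.
Unset Printing Implicit Defensive.

Import Order.TTheory GRing.Theory Num.Theory.
Local Open Scope ring_scope.

(** * Retracts and isomorphisms *)

Section Preadditive.
Variable C : preadditive.
Implicit Types X Y Z W : C.

Definition hom_zero X Y : Prop := forall f : hom X Y, f = 0.

(** Direct summands are handled as retracts, which carry no complement; in a
    triangulated category the two notions agree (retract_summand). *)
Definition retract X Z : Prop :=
  exists (i : hom X Z) (p : hom Z X), p ∘ i = idm X.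

Lemma retract_refl X : retract X X.
Proof. by exists (idm X), (idm X); rewrite comp1m. Qed.

Lemma retract_trans Y X Z : retract X Y -> retract Y Z -> retract X Z.
Proof.
move=> [i [p pi]] [j [q qj]]; exists (j ∘ i), (p ∘ q).
by rewrite compA -(compA p) qj compm1.
Qed.

Lemma iso_retract X Y : isomorphic X Y -> retract X Y.
Proof. by move=> [f [g [gf _]]]; exists f, g. Qed.

Lemma summand_retract X Z : direct_summand X Z -> retract X Z.
Proof. by move=> [Y [i [j [p [q [pi _ _ _ _]]]]]]; exists i, p. Qed.

Lemma is_iso_id X : is_iso (idm X).
Proof. by exists (idm X); rewrite comp1m. Qed.

Lemma is_iso_comp X Y Z (g : hom Y Z) (f : hom X Y) :
  is_iso g -> is_iso f -> is_iso (g ∘ f).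
Proof.
move=> [g' [g'g gg']] [f' [f'f ff']]; exists (f' ∘ g'); split.
  by rewrite compA -(compA f') g'g compm1.
by rewrite compA -(compA g) ff' compm1.
Qed.

Lemma is_isoN X Y (f : hom X Y) : is_iso f -> is_iso (- f).
Proof.
by move=> [g [gf fg]]; exists (- g); rewrite !compNm !compmN !opprK.
Qed.

Lemma iso_refl X : isomorphic X X.
Proof. by exists (idm X); apply: is_iso_id. Qed.

Lemma iso_sym X Y : isomorphic X Y -> isomorphic Y X.
Proof. by move=> [f [g [gf fg]]]; exists g, f. Qed.

Lemma iso_trans Y X Z : isomorphic X Y -> isomorphic Y Z -> isomorphic X Z.
Proof. by move=> [f If] [g Ig]; exists (g ∘ f); apply: is_iso_comp. Qed.

Lemma iso_epi X Y Z (f : hom X Y) (g h : hom Y Z) :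
  is_iso f -> g ∘ f = h ∘ f -> g = h.
Proof.
by move=> [f' [_ ff']] e; rewrite -[g]compm1 -[h]compm1 -ff' !compA e.
Qed.

Lemma iso_mono X Y Z (f : hom Y Z) (g h : hom X Y) :
  is_iso f -> f ∘ g = f ∘ h -> g = h.
Proof.
by move=> [f' [f'f _]] e; rewrite -[g]comp1m -[h]comp1m -f'f -!compA e.
Qed.

Lemma retract_hom_zero X X' Y Y' :
  retract X X' -> retract Y Y' -> hom_zero X' Y' -> hom_zero X Y.
Proof.
move=> [i [p pi]] [j [q qj]] z f.
have -> : f = q ∘ (j ∘ f ∘ p) ∘ i by rewrite !compA qj comp1m -compA pi compm1.
by rewrite (z (j ∘ f ∘ p)) compm0 comp0m.
Qed.

Lemma iso_hom_zero X X' Y Y' :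
  isomorphic X X' -> isomorphic Y Y' -> hom_zero X' Y' -> hom_zero X Y.
Proof. by move=> /iso_retract IX /iso_retract IY; apply: retract_hom_zero. Qed.

Lemma zero_hom X Y : is_zero X -> hom_zero X Y.
Proof. by move=> X0 f; rewrite -[f]compm1 X0 compm0. Qed.

Lemma hom_zero_to X Y : is_zero Y -> hom_zero X Y.
Proof. by move=> Y0 f; rewrite -[f]comp1m Y0 comp0m. Qed.

End Preadditive.

Section Functors.
Variables (C D : preadditive) (F : functor C D).

Lemma fmap0 X Y : fmap F (0 : hom X Y) = 0.
Proof. by apply: (addrI (fmap F 0)); rewrite -fmapD !addr0. Qed.

Lemma fmapN X Y (f : hom X Y) : fmap F (- f) = - fmap F f.
Proof. by apply: (addrI (fmap F f)); rewrite -fmapD !subrr fmap0. Qed.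

Lemma fmap_iso X Y (f : hom X Y) : is_iso f -> is_iso (fmap F f).
Proof.
by move=> [g [gf fg]]; exists (fmap F g); rewrite -!fmapM gf fg !fmap1.
Qed.

Lemma fob_iso X Y : isomorphic X Y -> isomorphic (F X) (F Y).
Proof. by move=> [f If]; exists (fmap F f); apply: fmap_iso. Qed.

Lemma retract_fob X Y : retract X Y -> retract (F X) (F Y).
Proof.
by move=> [i [p pi]]; exists (fmap F i), (fmap F p); rewrite -fmapM pi fmap1.
Qed.

Lemma is_zero_fob X : is_zero X -> is_zero (F X).
Proof. by rewrite /is_zero -fmap1 => ->; rewrite fmap0. Qed.

Lemma fob_dsum n (X : 'I_n -> C) Z :
  is_dsum X Z -> is_dsum (fun k => F (X k)) (F Z).
Proof.
move=> [i [p [pi pi0 e]]]; exists (fun k => fmap F (i k)), (fun k => fmap F (p k)).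
split=> [k|j k jk|].
- by rewrite -fmapM pi fmap1.
- by rewrite -fmapM pi0 // fmap0.
- rewrite -fmap1 -e; symmetry; elim/big_rec2: _ => [|k x y _ <-]; first exact: fmap0.
  by rewrite fmapD fmapM.
Qed.

End Functors.

(** * Triangles, exact sequences and the five lemma *)

(** The axioms from which everything below is derived. They pass to the opposite
    category (op_pretriangulated) and hold in homotopy categories
    (kb_pretriangulated). Rotation is asked forwards; dist_rot_back recovers the
    other direction. *)
Record pretriangulated (S : triangulated_data) : Prop := Pretriangulated {
  pt_zero : exists Z : S, is_zero Z;
  pt_unit_iso : forall X : S, is_iso (shift_unit X);
  pt_unit_nat : forall (X Y : S) (f : hom X Y),
    shift_unit Y ∘ f = fmap shift (fmap unshift f) ∘ shift_unit X;
  pt_counit_iso : forall X : S, is_iso (shift_counit X);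
  pt_counit_nat : forall (X Y : S) (f : hom X Y),
    f ∘ shift_counit X = shift_counit Y ∘ fmap unshift (fmap shift f);
  pt_iso : forall (X Y Z : S) (f : hom X Y) (g : hom Y Z)
      (h : hom Z (shift X)) (X' Y' Z' : S) (f' : hom X' Y') (g' : hom Y' Z')
      (h' : hom Z' (shift X')),
    triangle_iso f g h f' g' h' -> dist f g h -> dist f' g' h';
  pt_id : forall X Z : S, is_zero Z ->
    dist (idm X) (0 : hom X Z) (0 : hom Z (shift X));
  pt_cone : forall (X Y : S) (f : hom X Y),
    exists (Z : S) (g : hom Y Z) (h : hom Z (shift X)), dist f g h;
  pt_rot : forall (X Y Z : S) (f : hom X Y) (g : hom Y Z) (h : hom Z (shift X)),
    dist f g h -> dist g h (- fmap shift f);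
  pt_fill : forall (X Y Z : S) (f : hom X Y) (g : hom Y Z) (h : hom Z (shift X))
      (X' Y' Z' : S) (f' : hom X' Y') (g' : hom Y' Z') (h' : hom Z' (shift X'))
      (a : hom X X') (b : hom Y Y'),
    dist f g h -> dist f' g' h' -> b ∘ f = f' ∘ a ->
    exists c : hom Z Z', c ∘ g = g' ∘ b /\ fmap shift a ∘ h = h' ∘ c
}.

Lemma triangulated_pre (S : triangulated) : pretriangulated S.
Proof.
have [z b ui un ci cn i d c r f _] := triP S.
by split=> // X Y Z u v w /r.
Qed.

Section Pretriangulated.
Variables (S : triangulated_data) (HS : pretriangulated S).
Implicit Types X Y Z W : S.

Lemma shift_faithful X Y (f g : hom X Y) : fmap shift f = fmap shift g -> f = g.
Proof.
move=> e; apply: (iso_epi (pt_counit_iso HS X)).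
by rewrite !(pt_counit_nat HS) e.
Qed.

Lemma unshift_faithful X Y (f g : hom X Y) :
  fmap unshift f = fmap unshift g -> f = g.
Proof.
move=> e; apply: (iso_mono (pt_unit_iso HS Y)).
by rewrite !(pt_unit_nat HS) e.
Qed.

(** Conjugating the unshift of k with the counit gives a map whose shift agrees
    with k after unshifting, and the unshift is faithful. *)
Lemma shift_full X Y (k : hom (shift X) (shift Y)) :
  exists f : hom X Y, fmap shift f = k.
Proof.
have [c [cX Xc]] := pt_counit_iso HS X.
exists (shift_counit Y ∘ fmap unshift k ∘ c); apply: unshift_faithful.
apply: (iso_mono (pt_counit_iso HS Y)).
by rewrite -(pt_counit_nat HS) -compA cX compm1.
Qed.

Lemma shift_reflects_iso X Y (f : hom X Y) : is_iso (fmap shift f) -> is_iso f.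
Proof.
move=> [k [kf fk]]; have [g gk] := shift_full k; subst k; exists g.
by split; apply: shift_faithful; rewrite fmapM ?kf ?fk fmap1.
Qed.

Lemma shift_unshift X : isomorphic X (shift (unshift X)).
Proof. by exists (shift_unit X); apply: pt_unit_iso. Qed.

Lemma unshift_shift X : isomorphic (unshift (shift X)) X.
Proof. by exists (shift_counit X); apply: pt_counit_iso. Qed.

Lemma hom_zero_shift X Y : hom_zero (shift X) (shift Y) <-> hom_zero X Y.
Proof.
split=> z f; first by apply: shift_faithful; rewrite (z (fmap shift f)) fmap0.
by have [g <-] := shift_full f; rewrite (z g) fmap0.
Qed.

Lemma hom_zero_unshift X Y : hom_zero (unshift X) (unshift Y) <-> hom_zero X Y.
Proof.
by rewrite -hom_zero_shift; split; apply: iso_hom_zero;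
  try exact: shift_unshift; apply: iso_sym; apply: shift_unshift.
Qed.

Section Triangle.
Variables (X Y Z : S) (f : hom X Y) (g : hom Y Z) (h : hom Z (shift X)).
Hypothesis D : dist f g h.

Lemma dist_comp0 : g ∘ f = 0.
Proof.
have [O O0] := pt_zero HS.
have [|c [<- _]] := @pt_fill _ HS _ _ _ _ _ _ _ _ _ _ _ _ (idm X) f (pt_id HS X O0) D.
  by [].
by rewrite compm0.
Qed.

(** Exactness of Hom(W, -). A map from the rotated triangle of W -> W -> 0 to
    the rotation of the given one provides W[1] -> X[1], which desuspends. *)
Lemma dist_lift W (t : hom W Y) : g ∘ t = 0 -> exists w : hom W X, f ∘ w = t.
Proof.
move=> gt; have [O O0] := pt_zero HS.
have [|c [_ e]] := @pt_fill _ HS _ _ _ _ _ _ _ _ _ _ _ _ t (0 : hom O Z)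
  (pt_rot HS (pt_id HS W O0)) (pt_rot HS D).
  by rewrite gt compm0.
have [w wc] := shift_full c; exists w; apply: shift_faithful.
by rewrite fmapM wc; apply: oppr_inj; rewrite -compNm -e fmap1 compmN compm1.
Qed.

(** Exactness of Hom(-, W). Up to the unit, W is the third vertex of a triangle
    that starts with a zero object, and the filler into this triangle is the
    factorization, up to sign. *)
Lemma dist_desc W (t : hom Y W) : t ∘ f = 0 -> exists w : hom Z W, w ∘ g = t.
Proof.
move=> tf; have [O O0] := pt_zero HS.
have [u' [u'u uu']] := pt_unit_iso HS W.
have [|c [e _]] := @pt_fill _ HS _ _ _ _ _ _ _ _ _ _ _ _ (0 : hom X O)
  (shift_unit W ∘ t) D (pt_rot HS (pt_rot HS (pt_id HS (unshift W) O0))).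
  by rewrite -compA tf !compm0.
exists (- (u' ∘ c)).
by rewrite compNm -compA e fmap1 compNm comp1m compmN opprK compA u'u comp1m.
Qed.

End Triangle.

Lemma dist_lift2 X Y Z (f : hom X Y) (g : hom Y Z) (h : hom Z (shift X)) W
    (t : hom W Z) : dist f g h -> h ∘ t = 0 -> exists w : hom W Y, g ∘ w = t.
Proof. by move=> /(pt_rot HS) D; apply: (dist_lift D). Qed.

Lemma dist_lift3 X Y Z (f : hom X Y) (g : hom Y Z) (h : hom Z (shift X)) W
    (t : hom W (shift X)) : dist f g h -> fmap shift f ∘ t = 0 ->
  exists w : hom W Z, h ∘ w = t.
Proof.
move=> /(pt_rot HS)/(pt_rot HS) D ft; apply: (dist_lift D).
by rewrite compNm ft oppr0.
Qed.

Lemma dist_comp0_3 X Y Z (f : hom X Y) (g : hom Y Z) (h : hom Z (shift X)) :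
  dist f g h -> fmap shift f ∘ h = 0.
Proof.
by move=> /(pt_rot HS)/(pt_rot HS)/dist_comp0 /eqP; rewrite compNm oppr_eq0 => /eqP.
Qed.

(** The five lemma: by the exactness of Hom(W, -), composition with c is
    bijective on maps from every W. *)
Lemma dist_five X Y Z (f : hom X Y) (g : hom Y Z) (h : hom Z (shift X))
    X' Y' Z' (f' : hom X' Y') (g' : hom Y' Z') (h' : hom Z' (shift X'))
    (a : hom X X') (b : hom Y Y') (c : hom Z Z') :
  dist f g h -> dist f' g' h' ->
  b ∘ f = f' ∘ a -> c ∘ g = g' ∘ b -> fmap shift a ∘ h = h' ∘ c ->
  is_iso a -> is_iso b -> is_iso c.
Proof.
move=> D D' e1 e2 e3 Ia Ib.
have inj W (t : hom W Z) : c ∘ t = 0 -> t = 0.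
  move=> ct; have ht : h ∘ t = 0.
    apply: (iso_mono (fmap_iso shift Ia)).
    by rewrite compA e3 -compA ct !compm0.
  have [y yt] := dist_lift2 D ht; subst t.
  have [|x' x'y] := dist_lift D' (t := b ∘ y); first by rewrite compA -e2 -compA.
  have [a' [a'a aa']] := Ia.
  have -> : y = f ∘ (a' ∘ x').
    by apply: (iso_mono Ib); rewrite !compA e1 -(compA f') aa' compm1 x'y.
  by rewrite compA (dist_comp0 D) comp0m.
have surj W (t : hom W Z') : exists z, c ∘ z = t.
  have [a' [a'a aa']] := fmap_iso shift Ia; have [b' [b'b bb']] := Ib.
  have [|z zt] := dist_lift3 D (t := a' ∘ (h' ∘ t)).
    apply: (iso_mono (fmap_iso shift Ib)).
    rewrite compm0 !compA -fmapM e1 fmapM -(compA _ _ a') aa' compm1.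
    by rewrite (dist_comp0_3 D') comp0m.
  have [|y' y't] := dist_lift2 D' (t := t - c ∘ z).
    by rewrite compBr (compA h') -e3 -(compA _ h) zt (compA _ a') aa' comp1m subrr.
  exists (z + g ∘ (b' ∘ y')); rewrite compDr !compA e2 -(compA g') bb' compm1 y't.
  by rewrite addrC subrK.
have [k ck] := surj _ (idm Z'); exists k; split=> //.
apply/eqP; rewrite -subr_eq0; apply/eqP/inj.
by rewrite compBr compA ck comp1m compm1 subrr.
Qed.

Lemma dist_third_iso X Y Z (f : hom X Y) (g : hom Y Z) (h : hom Z (shift X))
    X' Y' Z' (f' : hom X' Y') (g' : hom Y' Z') (h' : hom Z' (shift X'))
    (a : hom X X') (b : hom Y Y') :
  dist f g h -> dist f' g' h' -> b ∘ f = f' ∘ a -> is_iso a -> is_iso b ->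
  exists c : hom Z Z', [/\ is_iso c, c ∘ g = g' ∘ b & fmap shift a ∘ h = h' ∘ c].
Proof.
move=> D D' e Ia Ib; have [c [e1 e2]] := pt_fill HS D D' e.
by exists c; split=> //; apply: (dist_five D D' e).
Qed.

(** Compare with a triangle on f: three rotations turn both into triangles
    starting with the same map, the negative of the shift of f, so that their
    third vertices are isomorphic, first after shifting and then before. *)
Lemma dist_rot_back X Y Z (f : hom X Y) (g : hom Y Z) (h : hom Z (shift X)) :
  dist g h (- fmap shift f) -> dist f g h.
Proof.
move=> D; have [Z' [g' [h' D']]] := pt_cone HS f.
have D1 := pt_rot HS (pt_rot HS D).
have D2 := pt_rot HS (pt_rot HS (pt_rot HS D')).
have [|c [Ic e1 e2]] := dist_third_iso D2 D1 (a := idm _) (b := idm _) _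
  (is_iso_id _) (is_iso_id _); first by rewrite comp1m compm1.
have [k kc] := shift_full c; subst c.
apply: (pt_iso HS _ D'); exists (idm X), (idm Y), k.
split; first by split; [exact: is_iso_id | exact: is_iso_id | exact: shift_reflects_iso].
split; first by rewrite comp1m compm1.
  rewrite compm1; apply: shift_faithful; apply: oppr_inj.
  by rewrite fmapM -compmN e1 compm1.
rewrite fmap1 comp1m; apply: shift_faithful; apply: oppr_inj.
by rewrite fmapM -compNm -e2 fmap1 comp1m.
Qed.

(** The middle term is the unshifted cone of h, reached by rotating back twice. *)
Lemma dist_mid X Z (h : hom Z (shift X)) :
  exists (Y : S) (f : hom X Y) (g : hom Y Z), dist f g h.
Proof.
have [V [k [l D]]] := pt_cone HS h.
have [u' [u'u uu']] := pt_unit_iso HS V.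
have [f fe] := shift_full (- (shift_unit V ∘ k)).
have [g ge] := shift_full (- (l ∘ u')).
exists (unshift V), f, g; do 2 apply: dist_rot_back.
rewrite fe ge !opprK; apply: (pt_iso HS _ D).
exists (idm _), (idm _), (shift_unit V); split.
  by split; [exact: is_iso_id | exact: is_iso_id | exact: pt_unit_iso].
by split; rewrite ?compm1 ?comp1m // fmap1 comp1m -compA u'u compm1.
Qed.

Lemma dist_fill_mid X Y Z (f : hom X Y) (g : hom Y Z) (h : hom Z (shift X))
    X' Y' Z' (f' : hom X' Y') (g' : hom Y' Z') (h' : hom Z' (shift X'))
    (a : hom X X') (c : hom Z Z') :
  dist f g h -> dist f' g' h' -> fmap shift a ∘ h = h' ∘ c ->
  exists b : hom Y Y', b ∘ f = f' ∘ a /\ c ∘ g = g' ∘ b.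
Proof.
move=> /(pt_rot HS)/(pt_rot HS) D /(pt_rot HS)/(pt_rot HS) D' e.
have [k [e1 e2]] := pt_fill HS D D' e; have [b bk] := shift_full k; subst k.
exists b; split; apply: shift_faithful; apply: oppr_inj.
  by rewrite !fmapM -compmN e1 compNm.
by rewrite !fmapM -compmN e2 compNm.
Qed.

Lemma dist_five_mid X Y Z (f : hom X Y) (g : hom Y Z) (h : hom Z (shift X))
    X' Y' Z' (f' : hom X' Y') (g' : hom Y' Z') (h' : hom Z' (shift X'))
    (a : hom X X') (b : hom Y Y') (c : hom Z Z') :
  dist f g h -> dist f' g' h' ->
  b ∘ f = f' ∘ a -> c ∘ g = g' ∘ b -> fmap shift a ∘ h = h' ∘ c ->
  is_iso a -> is_iso c -> is_iso b.
Proof.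
move=> /(pt_rot HS)/(pt_rot HS) D /(pt_rot HS)/(pt_rot HS) D' e1 e2 e3 Ia Ic.
apply: shift_reflects_iso; apply: (dist_five D D' e3) => //; last exact: fmap_iso.
  by rewrite compmN compNm -!fmapM e1.
by rewrite compmN compNm -!fmapM e2.
Qed.

Lemma dist_first0 X Y Z (f : hom X Y) (g : hom Y Z) (h : hom Z (shift X)) :
  dist f g h -> f = 0 -> retract Y Z.
Proof.
move=> D f0; have [|w wg] := dist_desc D (t := idm Y); first by rewrite f0 compm0.
by exists g, w.
Qed.

Lemma dist_second0 X Y Z (f : hom X Y) (g : hom Y Z) (h : hom Z (shift X)) :
  dist f g h -> g = 0 -> retract Y X.
Proof.
move=> D g0; have [|w wg] := dist_lift D (t := idm Y); first by rewrite g0 comp0m.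
by exists w, f.
Qed.

(** As i is split, its shift is split too and kills h only if h = 0. Hence g has
    a section, and subtracting its component along i makes it orthogonal to p. *)
Lemma dist_split X Z (i : hom X Z) (p : hom Z X) W (g : hom Z W)
    (h : hom W (shift X)) :
  p ∘ i = idm X -> dist i g h -> exists s : hom W Z, is_biprod i s p g.
Proof.
move=> pi D.
have h0 : h = 0.
  rewrite -[h]comp1m -(fmap1 shift X) -pi fmapM -compA.
  by rewrite (dist_comp0_3 D) compm0.
have [|s gs] := dist_lift2 D (t := idm W); first by rewrite h0 comp0m.
have gi := dist_comp0 D.
have [|t te] := dist_desc D (t := idm Z - i ∘ p).
  by rewrite compBl comp1m -compA pi compm1 subrr.
have ts : t = s - i ∘ p ∘ s.
  by rewrite -[t]compm1 -gs compA te compBl comp1m.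
exists t; split=> //.
- by rewrite ts compBr -compA compA gi comp0m subr0.
- by rewrite ts compBr -compA compA pi comp1m subrr.
- by rewrite te addrC subrK.
Qed.

Lemma retract_summand X Z : retract X Z -> direct_summand X Z.
Proof.
move=> [i [p pi]]; have [W [g [h D]]] := pt_cone HS i.
by have [s B] := dist_split pi D; exists W, i, s, p, g.
Qed.

(** * Extension-closed classes and generation *)

Record ext_closed (C : S -> Prop) : Prop := ExtClosed {
  ec_zero : forall X, is_zero X -> C X;
  ec_ext : forall X Y Z (f : hom X Y) (g : hom Y Z) (h : hom Z (shift X)),
    dist f g h -> C X -> C Z -> C Y;
  ec_retract : forall X Z, retract X Z -> C Z -> C X
}.

Lemma ec_iso C X Y : ext_closed C -> isomorphic X Y -> C X -> C Y.
Proof. by move=> HC /iso_sym/iso_retract; apply: ec_retract. Qed.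

(** The complement of the first summand is a sum of the others, and the split
    triangle through it puts Z back together. *)
Lemma ec_dsum C n (X : 'I_n -> S) Z :
  ext_closed C -> (forall k, C (X k)) -> is_dsum X Z -> C Z.
Proof.
move=> HC; elim: n => [|n IH] in X Z *.
  move=> _ [i [p [_ _ e]]]; apply: (ec_zero HC).
  by rewrite /is_zero -e big_ord0.
move=> CX [i [p [pi pi0 e]]].
have [W [g [h D]]] := pt_cone HS (i ord0).
have [s [_ gs ps gi e0]] := dist_split (pi ord0) D.
apply: (ec_ext HC D) => //.
apply: (IH (fun k => X (lift ord0 k))) => [//|].
have sg : s ∘ g = idm Z - i ord0 ∘ p ord0 by rewrite -e0 addrC addKr.
exists (fun k => g ∘ i (lift ord0 k)), (fun k => p (lift ord0 k) ∘ s); split.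
- move=> k; rewrite compA -(compA _ s) sg compBr compm1 compBl pi compA.
  by rewrite pi0 // !comp0m subr0.
- move=> j k jk; rewrite compA -(compA _ s) sg compBr compm1 compBl pi0.
    by rewrite compA pi0 // !comp0m subr0.
  by apply: contra jk => /eqP/lift_inj->.
- transitivity (g ∘ (\sum_k i k ∘ p k) ∘ s); last by rewrite e compm1.
  rewrite big_ord_recl compDr compDl [g ∘ _]compA gi !comp0m add0r.
  elim/big_ind2: _ => [|x y x' y' -> ->|k _]; first by rewrite compm0 comp0m.
    by rewrite compDr compDl.
  by rewrite !compA.
Qed.

Definition gen (A : S -> Prop) X : Prop :=
  exists Y, ext_closure (finite_sums A) Y /\ direct_summand X Y.

(** Together with gen_closed: gen A is the smallest extension-closed class that
    contains A. *)
Lemma gen_min A C : ext_closed C -> (forall X, A X -> C X) ->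
  forall X, gen A X -> C X.
Proof.
move=> HC AC X [Y [AY /summand_retract XY]]; apply: (ec_retract HC XY).
elim: AY => {XY} {}Y.
  by move=> [n [F [AF sF]]]; apply: (ec_dsum HC _ sF) => k; apply: AC.
by move=> V W f g h D _ CY _; apply: (ec_ext HC D).
Qed.

Lemma finite_sums1 A X : A X -> finite_sums A X.
Proof.
move=> AX; exists 1%N, (fun=> X); split=> //.
exists (fun=> idm X), (fun=> idm X); split=> [k|j k|].
- by rewrite comp1m.
- by rewrite !ord1.
- by rewrite big_ord1 comp1m.
Qed.

Lemma finite_sums0 A X : is_zero X -> finite_sums A X.
Proof.
move=> X0; exists 0%N, (fun=> X); split; first by case.
by exists (fun=> 0), (fun=> 0); split=> [[]//|[]//|]; rewrite big_ord0.
Qed.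

Lemma gen_base A X : A X -> gen A X.
Proof.
move=> AX; exists X; split; first exact/ext_base/finite_sums1.
exact/retract_summand/retract_refl.
Qed.

(** The point is stability under extensions after passing to retracts. Let X, Z
    be retracts of X', Z'. The class Z -> X[1] of an extension Y extends to Z'
    -> X'[1], hence to an extension Y' of Z' by X', with maps Y -> Y' -> Y over
    X -> X' -> X and Z -> Z' -> Z. The composite is invertible by the five
    lemma, so Y is a retract of Y'. *)
Lemma gen_closed A : ext_closed (gen A).
Proof.
split.
- move=> X X0; exists X; split; first exact/ext_base/finite_sums0.
  exact/retract_summand/retract_refl.
- move=> X Y Z f g h D [X' [AX /summand_retract[i [p pi]]]].
  move=> [Z' [AZ /summand_retract[j [q qj]]]].
  have [Y' [f' [g' D']]] := dist_mid (fmap shift i ∘ h ∘ q).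
  exists Y'; split; first exact: ext_step D' AX AZ.
  apply: retract_summand.
  have [|b [e1 e2]] := dist_fill_mid D D' (a := i) (c := j).
    by rewrite -compA qj compm1.
  have [|b' [e1' e2']] := dist_fill_mid D' D (a := p) (c := q).
    by rewrite !compA -fmapM pi fmap1 comp1m.
  have [k [kb _]] : is_iso (b' ∘ b).
    apply: (dist_five_mid D D (a := idm X) (c := idm Z)); try exact: is_iso_id.
    - by rewrite -compA e1 compA e1' -compA pi.
    - by rewrite compA -e2' -compA -e2 compA qj.
    - by rewrite fmap1 comp1m compm1.
  by exists b, (k ∘ b'); rewrite -compA.
- move=> X Z XZ [Y [AY /summand_retract ZY]]; exists Y; split=> //.
  exact/retract_summand/(retract_trans XZ).
Qed.

(** * Iterated shifts and degrees *)

Lemma shiftzS X n : isomorphic (shiftz X (n + 1)) (shift (shiftz X n)).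
Proof.
case: n => [n|[|n]].
- by rewrite -PoszD addn1; apply: iso_refl.
- exact: shift_unshift.
- have -> : Negz n.+1 + 1 = Negz n by rewrite !NegzE -addn1 PoszD opprD subrK.
  exact: shift_unshift.
Qed.

Lemma shiftzP X n : isomorphic (shiftz X (n - 1)) (unshift (shiftz X n)).
Proof.
case: n => [[|n]|n].
- exact: iso_refl.
- have -> : n.+1%:Z - 1 = n by rewrite -addn1 PoszD addrK.
  by apply: iso_sym; exact: unshift_shift.
- have -> : Negz n - 1 = Negz n.+1 by rewrite !NegzE -opprD -PoszD addn1.
  exact: iso_refl.
Qed.

Lemma shiftz_iso n X Y : isomorphic X Y -> isomorphic (shiftz X n) (shiftz Y n).
Proof.
move=> XY; case: n => n /=; last first.
  by apply: fob_iso; elim: n => //= n; apply: fob_iso.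
by elim: n => //= n; apply: fob_iso.
Qed.

Lemma int_step (P : int -> Prop) :
  P 0 -> (forall n, P n -> P (n + 1)) -> (forall n, P n -> P (n - 1)) ->
  forall n, P n.
Proof.
move=> P0 PS PP; case=> n.
  by elim: n => // n /PS; rewrite -PoszD addn1.
elim: n => [|n /PP]; first exact: PP P0.
by rewrite !NegzE -opprD -PoszD addn1.
Qed.

Lemma shiftzD X m n : isomorphic (shiftz (shiftz X m) n) (shiftz X (m + n)).
Proof.
elim/int_step: n => [|n IH|n IH]; first by rewrite addr0; apply: iso_refl.
  apply: iso_trans (shiftzS _ _) _; rewrite addrA.
  exact: iso_trans (fob_iso shift IH) (iso_sym (shiftzS _ _)).
apply: iso_trans (shiftzP _ _) _; rewrite addrA.
exact: iso_trans (fob_iso unshift IH) (iso_sym (shiftzP _ _)).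
Qed.

Lemma shiftzK X n : isomorphic X (shiftz (shiftz X n) (- n)).
Proof. by apply: iso_sym; have := shiftzD X n (- n); rewrite subrr. Qed.

Lemma shiftzNK X n : isomorphic X (shiftz (shiftz X (- n)) n).
Proof. by apply: iso_sym; have := shiftzD X (- n) n; rewrite addNr. Qed.

Lemma hom_zero_shiftz n X Y :
  hom_zero (shiftz X n) (shiftz Y n) <-> hom_zero X Y.
Proof.
elim/int_step: n => [//|n IH|n IH].
  rewrite -IH -(hom_zero_shift (shiftz X n)); split; apply: iso_hom_zero;
  by [exact: shiftzS | apply: iso_sym; exact: shiftzS].
rewrite -IH -(hom_zero_unshift (shiftz X n)); split; apply: iso_hom_zero;
by [exact: shiftzP | apply: iso_sym; exact: shiftzP].
Qed.

Lemma hom_zero_shiftz_l n X Y :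
  hom_zero (shiftz X n) Y <-> hom_zero X (shiftz Y (- n)).
Proof.
rewrite -(hom_zero_shiftz (- n)); split; apply: iso_hom_zero;
by try exact: iso_refl; try exact: shiftzK; apply: iso_sym; exact: shiftzK.
Qed.

Lemma dist_shift X Y Z (f : hom X Y) (g : hom Y Z) (h : hom Z (shift X)) :
  dist f g h -> dist (- fmap shift f) (- fmap shift g) (- fmap shift h).
Proof. by move=> D; do 3 apply: (pt_rot HS). Qed.

(** By naturality of the unit, the given triangle is isomorphic to the shift of
    the wanted one, up to the signs of three rotations. *)
Lemma dist_unshift X Y Z (f : hom X Y) (g : hom Y Z) (h : hom Z (shift X)) :
  dist f g h ->
  exists (f' : hom (unshift X) (unshift Y)) (g' : hom (unshift Y) (unshift Z)) h',
    dist f' g' h'.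
Proof.
move=> D; have [v [vu uv]] := pt_unit_iso HS Z.
have [h' h'E] := shift_full (- (fmap shift (shift_unit X) ∘ h ∘ v)).
exists (- fmap unshift f), (- fmap unshift g), h'.
do 3 apply: dist_rot_back; rewrite h'E !fmapN !opprK.
apply: (pt_iso HS _ D); exists (shift_unit X), (shift_unit Y), (shift_unit Z).
split; first by split; apply: pt_unit_iso.
by split; rewrite ?(pt_unit_nat HS) // -compA vu compm1.
Qed.

Lemma ec_shift C : ext_closed C -> ext_closed (fun X => C (shift X)).
Proof.
move=> HC; split=> [X X0|X Y Z f g h D|X Z /(retract_fob shift)].
- exact/(ec_zero HC)/is_zero_fob.
- exact: (ec_ext HC (dist_shift D)).
- exact: ec_retract.
Qed.

Lemma ec_unshift C : ext_closed C -> ext_closed (fun X => C (unshift X)).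
Proof.
move=> HC; split=> [X X0|X Y Z f g h D|X Z /(retract_fob unshift)].
- exact/(ec_zero HC)/is_zero_fob.
- by have [f' [g' [h' D']]] := dist_unshift D; apply: (ec_ext HC D').
- exact: ec_retract.
Qed.

Lemma ec_shiftz C n : ext_closed C -> ext_closed (fun X => C (shiftz X n)).
Proof.
have iterP (F : functor S S) (P : S -> Prop) k : ext_closed P ->
    (forall P, ext_closed P -> ext_closed (fun X => P (F X))) ->
    ext_closed (fun X => P (iter k F X)).
  by move=> HP HF; elim: k P HP => //= k IH P /HF/IH.
case: n => n HC /=; first by apply: (iterP shift) => // P; exact: ec_shift.
by apply: (iterP unshift _ n.+1) => // P; exact: ec_unshift.
Qed.

Lemma ec_hom_from Y : ext_closed (fun X => hom_zero X Y).
Proof.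
split=> [X X0|X V Z f g h D X0 Z0 t|X Z XZ]; first exact: zero_hom.
  have [|w <-] := dist_desc D (t := t); first exact: X0.
  by rewrite (Z0 w) comp0m.
by apply: retract_hom_zero XZ _; apply: retract_refl.
Qed.

Lemma ec_hom_to W : ext_closed (fun X => hom_zero W X).
Proof.
split=> [X X0|X V Z f g h D X0 Z0 t|X Z XZ]; first exact: hom_zero_to.
  have [|w <-] := dist_lift D (t := t); first exact: Z0.
  by rewrite (X0 w) compm0.
by apply: retract_hom_zero XZ; apply: retract_refl.
Qed.

(** The interval of degrees is replaced by any set of integers, which can be
    translated and reflected freely; G[-i] is in degree i. *)
Definition sgen G (p : int -> Prop) : S -> Prop :=
  gen (fun X => exists2 i : int, p i & X = shiftz G (- i)).

Lemma sgen_sub G (p q : int -> Prop) X :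
  (forall i, p i -> q i) -> sgen G p X -> sgen G q X.
Proof.
move=> pq; apply: gen_min; first exact: gen_closed.
by move=> V [i pi ->]; apply: gen_base; exists i => //; apply: pq.
Qed.

Lemma sgen_base G (p : int -> Prop) i : p i -> sgen G p (shiftz G (- i)).
Proof. by move=> pi; apply: gen_base; exists i. Qed.

Lemma sgen_shiftz n G (p : int -> Prop) X :
  sgen G p X -> sgen G (fun i => p (i + n)) (shiftz X n).
Proof.
apply: (gen_min (ec_shiftz n (gen_closed _))).
move=> V [i pi ->]; apply: (ec_iso (gen_closed _) (iso_sym (shiftzD _ _ _))).
rewrite (_ : - i + n = - (i - n)); last by rewrite opprB addrC.
by apply: sgen_base; rewrite subrK.
Qed.

Lemma sgen_trans H (p : int -> Prop) G (q r : int -> Prop) X :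
  (forall i j, p i -> q j -> r (i + j)) ->
  sgen H p G -> sgen G q X -> sgen H r X.
Proof.
move=> pqr HG; apply: (gen_min (gen_closed _)).
move=> V [j qj ->]; apply: sgen_sub (sgen_shiftz (- j) HG).
by move=> i /= pi; rewrite -(subrK j i); apply: pqr.
Qed.

(** The objects built from finitely many shifts of G already form an extension-
    closed class. *)
Lemma sgen_bounded G (p : int -> Prop) X :
  sgen G p X -> exists N : nat, sgen G (fun i => - N%:Z <= i <= N%:Z) X.
Proof.
move=> GX; pose C V := exists N : nat, sgen G (fun i => - N%:Z <= i <= N%:Z) V.
suff HC : ext_closed C.
  apply: (gen_min HC _ GX) => V [i _ ->]; exists `|i|%N; apply: sgen_base.
  by rewrite -ler_norml abszE.
split=> [V V0|V Y Z f g h D [M VM] [N ZN]|V Z VZ [N ZN]].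
- by exists 0%N; apply: (ec_zero (gen_closed _)).
- have le k l i : (k <= l)%N -> - k%:Z <= i <= k%:Z -> - l%:Z <= i <= l%:Z.
    by rewrite -lez_nat -!ler_norml => kl /le_trans->.
  exists (maxn M N); apply: (ec_ext (gen_closed _) D).
    by apply: sgen_sub VM => i; apply/le/leq_maxl.
  by apply: sgen_sub ZN => i; apply/le/leq_maxr.
- by exists N; apply: (ec_retract (gen_closed _) VZ).
Qed.

Lemma sgen_hom_zero G (p : int -> Prop) X Y :
  sgen G p X -> (forall i, p i -> hom_zero (shiftz G (- i)) Y) -> hom_zero X Y.
Proof.
move=> GX GY; apply: (gen_min (ec_hom_from Y) _ GX).
by move=> V [i pi ->]; apply: GY.
Qed.

Lemma shift_class_gen G (p : int -> Prop) n Y :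
  shift_class (sgen G p) n Y <-> sgen G (fun i => p (i + n)) Y.
Proof.
split=> [[X [GX XY]]|GY].
  exact: (ec_iso (gen_closed _) (iso_sym XY) (sgen_shiftz n GX)).
exists (shiftz Y (- n)); split; last exact: shiftzNK.
by apply: sgen_sub (sgen_shiftz (- n) GY) => i; rewrite subrK.
Qed.

(** Membership in the right orthogonal of the positive shifts of G. *)
Definition nonneg_for G Y : Prop := forall k : int, 1 <= k -> hom_zero (shiftz G k) Y.

Lemma right_perpE G Y : right_perp (shifts G `]-oo, -1]) Y <-> nonneg_for G Y.
Proof.
split=> [P k k1 f|P X [i i1 XE]].
  apply: (P (shiftz G k)); exists (- k); last by rewrite opprK.
  by rewrite in_itv /= lerN2.
by subst X => f; apply: P; move: i1; rewrite in_itv /= lerNr.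
Qed.

(** The condition on n whose least solution is the finitistic dimension, with
    the shift by n absorbed in the set of degrees. *)
Definition findim_le G (n : int) : Prop :=
  forall Y, nonneg_for G Y -> sgen G (fun i => 0 <= i + n) Y.

Lemma findimE G : findim G = inf_nat (fun n => findim_le G n).
Proof.
congr inf_nat; apply: functional_extensionality_dep => n.
apply: propositional_extensionality; split=> P Y.
  move/right_perpE/P/shift_class_gen; apply: sgen_sub => i.
  by rewrite in_itv /= andbT.
move/right_perpE/P => GY; apply/shift_class_gen; apply: sgen_sub GY => i.
by rewrite in_itv /= andbT.
Qed.

End Pretriangulated.

(** * Infima of sets of natural numbers *)

Lemma inf_natP (P : nat -> Prop) : finite_enat (inf_nat P) <-> exists n, P n.
Proof.
rewrite /inf_nat; case: pselect => [h|nh]; split.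
- by move=> _; have [n /asboolP] := h; exists n.
- by move=> _; exists (ex_minn h).
- by move=> [n].
- by move=> [n Pn]; case: nh; exists n; apply/asboolP.
Qed.

Lemma inf_nat_le (P : nat -> Prop) n : (forall m k, (m <= k)%N -> P m -> P k) ->
  le_enat (inf_nat P) (Some n) <-> P n.
Proof.
move=> mono; rewrite /inf_nat; case: pselect => [h|nh]; split=> //=.
- by case: ex_minnP => m /asboolP Pm _ /mono; apply.
- by move=> Pn; case: ex_minnP => m _; apply; apply/asboolP.
- by move=> Pn; case: nh; exists n; apply/asboolP.
Qed.

Lemma inf_nat0 (P : nat -> Prop) : P 0%N -> inf_nat P = Some 0%N.
Proof.
move=> P0; rewrite /inf_nat; case: pselect => [h|[]]; last by exists 0%N; apply/asboolP.
by congr Some; case: ex_minnP => m _ /(_ 0%N); rewrite leqn0 => /(_ (introT (asboolP _) P0))/eqP.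
Qed.

(** * The opposite category *)

Section Opposite.
Variables (S : triangulated_data) (HS : pretriangulated S).

Lemma op_is_iso (X Y : S) (f : hom Y X) : @is_iso S Y X f -> @is_iso (op S) X Y f.
Proof. by move=> [g [gf fg]]; exists g. Qed.

Lemma op_isomorphic (X Y : S) : @isomorphic (op S) X Y <-> @isomorphic S X Y.
Proof.
split=> [[f [g [gf fg]]]|[f [g [gf fg]]]].
  by exists g, f.
by exists g, f.
Qed.

Lemma op_distE (X Y Z : S) (f : hom Y X) (g : hom Z Y) (h : hom (unshift X) Z) :
  @dist (op S) X Y Z f g h <-> dist g f (fmap shift h ∘ shift_unit X).
Proof. by []. Qed.

(** In the opposite category the third map of a triangle is stored on the
    unshifted object; fullness of the shift produces it. *)
Lemma dist_op (X Y Z : S) (f : hom X Y) (g : hom Y Z) (h : hom Z (shift X)) :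
  dist f g h -> exists h', @dist (op S) Z Y X g f h'.
Proof.
move=> D; have [v [vu uv]] := pt_unit_iso HS Z.
have [h' e] := shift_full HS (h ∘ v); exists h'.
by rewrite op_distE e -compA vu compm1.
Qed.

Lemma dist_zero_id (X O : S) :
  is_zero O -> dist (0 : hom O X) (idm X) (0 : hom X (shift O)).
Proof.
move=> O0; apply: (dist_rot_back HS); rewrite fmap0 oppr0.
by apply: (pt_id HS); apply: is_zero_fob.
Qed.

(** A cone of g gives X[1] up to isomorphism, and rotating back gives X. *)
Lemma dist_second (Y Z : S) (g : hom Y Z) :
  exists (X : S) (f : hom X Y) (h : hom Z (shift X)), dist f g h.
Proof.
have [W [k [l D]]] := pt_cone HS g.
have [v [vu uv]] := pt_unit_iso HS W.
have [f fe] := shift_full HS (- (l ∘ v)).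
exists (unshift W), f, (shift_unit W ∘ k); apply: (dist_rot_back HS).
rewrite fe opprK; apply: (pt_iso HS _ D); exists (idm _), (idm _), (shift_unit W).
split; first by split; [exact: is_iso_id | exact: is_iso_id | exact: pt_unit_iso].
by split; rewrite ?compm1 ?comp1m // fmap1 comp1m -compA vu compm1.
Qed.

(** The unit X -> X[-1][1], with the sign that the rotation introduces,
    identifies the two triangles. *)
Lemma dist_op_rot (X Y Z : S) (f : hom Y X) (g : hom Z Y) (h : hom (unshift X) Z) :
  dist g f (fmap shift h ∘ shift_unit X) ->
  dist h g (fmap shift (- fmap unshift f) ∘ shift_unit Y).
Proof.
move=> D; rewrite fmapN compNm -(pt_unit_nat HS); apply: (dist_rot_back HS).
apply: (pt_iso HS _ D); exists (idm _), (idm _), (- shift_unit X); split.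
  by split; [exact: is_iso_id | exact: is_iso_id | apply/is_isoN/(pt_unit_iso HS)].
split; rewrite ?compm1 ?comp1m // ?compNm //.
by rewrite fmap1 comp1m compmN opprK.
Qed.

(** Filling the third vertex of an opposite triangle means filling the first
    vertex here, which a rotation moves to the third place. *)
Lemma dist_op_fill (X Y Z : S) (f : hom Y X) (g : hom Z Y) (h : hom (unshift X) Z)
    (X' Y' Z' : S) (f' : hom Y' X') (g' : hom Z' Y') (h' : hom (unshift X') Z')
    (a : hom X' X) (b : hom Y' Y) :
  dist g f (fmap shift h ∘ shift_unit X) ->
  dist g' f' (fmap shift h' ∘ shift_unit X') -> f ∘ b = a ∘ f' ->
  exists c : hom Z' Z, g ∘ c = b ∘ g' /\ h ∘ fmap unshift a = c ∘ h'.
Proof.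
move=> /(pt_rot HS) D /(pt_rot HS) D' /esym e.
have [k [e1 e2]] := pt_fill HS D' D e; have [c ck] := shift_full HS k; subst k.
exists c; split; apply: (shift_faithful HS).
  by apply: oppr_inj; rewrite !fmapM -compNm -e2 compmN.
apply: (iso_epi (pt_unit_iso HS X')).
by rewrite !fmapM -!compA -(pt_unit_nat HS) (compA (fmap shift h)) -e1.
Qed.

Lemma op_pretriangulated : pretriangulated (op S).
Proof.
split.
- exact: pt_zero HS.
- by move=> X; apply/op_is_iso/(pt_counit_iso HS).
- by move=> X Y f; apply: (pt_counit_nat HS).
- by move=> X; apply/op_is_iso/(pt_unit_iso HS).
- by move=> X Y f; apply: (pt_unit_nat HS).
- move=> X Y Z f g h X' Y' Z' f' g' h' [a [b [c [[Ia Ib Ic] [e1 e2 e3]]]]].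
  rewrite !op_distE => D; apply: (pt_iso HS _ D).
  have [a' [aa' a'a]] := Ia; have [b' [bb' b'b]] := Ib; have [c' [cc' c'c]] := Ic.
  exists c', b', a'; split.
    by split; [exists c | exists b | exists a].
  move: a b c a' b' c' Ia Ib Ic e1 e2 e3 aa' a'a bb' b'b cc' c'c; cbn.
  move=> a b c a' b' c' Ia Ib Ic e1 e2 e3 aa' a'a bb' b'b cc' c'c.
  have Hc : @is_iso S _ _ c by exists c'.
  have Hb : @is_iso S _ _ b by exists b'.
  have Ha : @is_iso S _ _ a by exists a'.
  split.
  + apply: (iso_mono Hb); apply: (iso_epi Hc).
    by rewrite !compA bb' comp1m -!compA c'c compm1 e2.
  + apply: (iso_mono Ha); apply: (iso_epi Hb).
    by rewrite !compA aa' comp1m -!compA b'b compm1 e1.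
  + rewrite -compA (pt_unit_nat HS) !compA -!fmapM; congr (fmap shift _ ∘ _).
    apply: (iso_mono Hc); rewrite !compA cc' comp1m -e3 -compA -fmapM aa'.
    by rewrite fmap1 compm1.
- move=> X O O0; rewrite op_distE fmap0 comp0m.
  exact: (dist_zero_id X O0).
- move=> X Y f; have [Z [g [k D]]] := @dist_second Y X f.
  have [h D'] := dist_op D; exists Z, g, h; exact: D'.
- by move=> X Y Z f g h; rewrite !op_distE; apply: dist_op_rot.
- move=> X Y Z f g h X' Y' Z' f' g' h' a b D D' e.
  exact: (dist_op_fill D D' e).
Qed.

End Opposite.

Section OppositeGeneration.
Variables (S : triangulated_data) (HS : pretriangulated S).

Let HO := op_pretriangulated HS.

Lemma op_shiftz (X : S) n : @shiftz (op S) X n = shiftz X (- n).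
Proof. by case: n => [[|n]|n]. Qed.

Lemma op_retract (X Y : S) : @retract (op S) X Y <-> @retract S X Y.
Proof. by split=> -[i [p pi]]; exists p, i. Qed.

Lemma op_ext_closed (C : S -> Prop) : @ext_closed (op S) C <-> ext_closed C.
Proof.
split=> [] [z e r]; split.
- exact: z.
- by move=> X Y Z f g h D CX CZ; have [h' D'] := dist_op HS D; apply: (e _ _ _ _ _ _ D').
- by move=> X Z /op_retract; apply: r.
- exact: z.
- by move=> X Y Z f g h D CX CZ; apply: (e _ _ _ _ _ _ D).
- by move=> X Z /op_retract; apply: r.
Qed.

(** Both sides are the smallest extension-closed class containing the same
    objects, as extension-closed classes do not see the direction of arrows. *)
Lemma op_sgen (G : S) (p : int -> Prop) (X : S) :
  @sgen (op S) G p X <-> sgen G (fun i => p (- i)) X.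
Proof.
split=> GX.
  apply: (gen_min HO (C := sgen G (fun i => p (- i))) _ _ GX).
    exact/op_ext_closed/gen_closed.
  move=> V [i pi ->]; rewrite op_shiftz.
  by apply: (sgen_base HS); rewrite opprK.
apply: (gen_min HS (C := @sgen (op S) G p) _ _ GX).
  exact/op_ext_closed/gen_closed.
move=> V [i pi ->]; have := @sgen_base _ HO G p _ pi.
by rewrite op_shiftz opprK.
Qed.

End OppositeGeneration.

(** * Change of generator *)

Section Finitistic.
Variables (S : triangulated_data) (HS : pretriangulated S).
Implicit Types G H X Y : S.

(** Let G be built from H in degrees -N to N. If Y is orthogonal to the positive
    shifts of H, then Y[-N] is orthogonal to those of G, hence built from G in
    degrees at least -n, hence from H in degrees at least -n - N. So Y itself is
    built from H in degrees at least -n - 2N. *)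
Lemma findim_finite_sgen G H : sgen H (fun=> True) G ->
  finite_enat (findim G) -> finite_enat (findim H).
Proof.
move=> /(sgen_bounded HS)[N HG].
rewrite !(findimE HS) !inf_natP => -[n Gn]; exists (n + N + N)%N => Y HY.
have GY : nonneg_for G (shiftz Y (- N%:Z)).
  move=> k k1; apply: (hom_zero_shiftz_l HS N%:Z _ _).1.
  apply: (iso_hom_zero (shiftzD HS _ _ _) (iso_refl Y)).
  apply: (sgen_hom_zero HS (sgen_shiftz HS (k + N%:Z) HG)) => i iN.
  by apply: HY; lia.
have HY' : sgen H (fun i => 0 <= i + n%:Z + N%:Z) (shiftz Y (- N%:Z)).
  by apply: (sgen_trans HS) HG (Gn _ GY) => i j; lia.
apply: (ec_iso (gen_closed HS _) (iso_sym (shiftzNK HS Y N%:Z))).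
by apply: (sgen_sub HS) (sgen_shiftz HS N%:Z HY') => i; lia.
Qed.

(** All objects, being shifts of other objects, are built from the positive
    shifts of G. An object orthogonal to these is thus orthogonal to itself. *)
Lemma findim_all_le G m : (forall X, sgen G (fun i => i <= m) X) -> findim G = Some 0%N.
Proof.
move=> GS; rewrite (findimE HS); apply: inf_nat0 => Y GY.
have Y0 : hom_zero Y Y.
  apply: (iso_hom_zero (shiftzNK HS Y (m + 1)) (iso_refl Y)).
  apply: (sgen_hom_zero HS (sgen_shiftz HS (m + 1) (GS _))) => i im.
  by apply: GY; lia.
by apply: (ec_zero (gen_closed HS _)); apply: Y0.
Qed.

End Finitistic.

(** * Bounded t-structures *)

Section Triangles.
Variables (S : triangulated_data) (HS : pretriangulated S).
Implicit Types X Y Z : S.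

Definition triangle_on X Y Z : Prop :=
  exists (f : hom X Y) (g : hom Y Z) (h : hom Z (shift X)), dist f g h.

Lemma triangle_on_iso X Y Z X' Y' Z' : triangle_on X Y Z ->
  isomorphic X X' -> isomorphic Y Y' -> isomorphic Z Z' -> triangle_on X' Y' Z'.
Proof.
move=> [f [g [h D]]] [a [a' [a'a aa']]] [b [b' [b'b bb']]] [c [c' [c'c cc']]].
exists (b ∘ f ∘ a'), (c ∘ g ∘ b'), (fmap shift a ∘ h ∘ c').
apply: (pt_iso HS _ D); exists a, b, c; split.
  by split; [exists a' | exists b' | exists c'].
by split; rewrite -compA ?a'a ?b'b ?c'c compm1.
Qed.

Lemma triangle_on_shiftz n X Y Z :
  triangle_on X Y Z -> triangle_on (shiftz X n) (shiftz Y n) (shiftz Z n).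
Proof.
move=> D; elim/int_step: n => // n [f [g [h D']]].
  apply: triangle_on_iso (iso_sym (shiftzS HS _ _)) (iso_sym (shiftzS HS _ _))
    (iso_sym (shiftzS HS _ _)); do 3 eexists; exact: (dist_shift HS D').
apply: triangle_on_iso (iso_sym (shiftzP HS _ _)) (iso_sym (shiftzP HS _ _))
  (iso_sym (shiftzP HS _ _)); exact: (dist_unshift HS D').
Qed.

Lemma dist_third_zero X Y Z (f : hom X Y) (g : hom Y Z) (h : hom Z (shift X)) :
  dist f g h -> is_zero Z -> is_iso f.
Proof.
move=> D Z0; have [|w fw] := dist_lift HS D (t := idm Y).
  by apply: hom_zero_to.
exists w; split=> //; apply: (shift_faithful HS).
apply/eqP; rewrite -subr_eq0 -[- _](fmapN shift) -fmapD; apply/eqP.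
have [|t <-] := dist_lift3 HS D (t := fmap shift (w ∘ f - idm X)).
  by rewrite -fmapM compBr compA fw comp1m compm1 subrr fmap0.
by rewrite (zero_hom Z0 h) comp0m.
Qed.

End Triangles.

Section TStructure.
Variables (S : triangulated_data) (HS : pretriangulated S) (t : t_structure S).
Implicit Types X Y : S.

Definition tle (k : int) X : Prop := t_le0 t (shiftz X k).
Definition tge (k : int) X : Prop := t_ge0 t (shiftz X k).

Lemma shift_classE (A : S -> Prop) n Y : (forall X Y, isomorphic X Y -> A X -> A Y) ->
  shift_class A n Y <-> A (shiftz Y (- n)).
Proof.
move=> A_iso; split=> [[X [AX YX]]|AY].
  apply: A_iso AX; apply: iso_trans (shiftzK HS X n) _.
  by apply: shiftz_iso; apply: iso_sym.
by exists (shiftz Y (- n)); split=> //; apply: shiftzNK.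
Qed.

Lemma t_leE k X : t_le t k X <-> tle k X.
Proof. by rewrite /t_le shift_classE ?opprK //; apply: t_le0_iso. Qed.

Lemma t_geE k X : t_ge t k X <-> tge k X.
Proof. by rewrite /t_ge shift_classE ?opprK //; apply: t_ge0_iso. Qed.

Lemma tle_iso k X Y : isomorphic X Y -> tle k X -> tle k Y.
Proof. by move=> XY; apply/t_le0_iso/shiftz_iso. Qed.

Lemma tge_iso k X Y : isomorphic X Y -> tge k X -> tge k Y.
Proof. by move=> XY; apply/t_ge0_iso/shiftz_iso. Qed.

Lemma tle_shiftz k n X : tle k (shiftz X n) <-> tle (k + n) X.
Proof.
by split; apply: t_le0_iso; rewrite addrC;
  [exact: shiftzD | apply: iso_sym; exact: shiftzD].
Qed.

Lemma tge_shiftz k n X : tge k (shiftz X n) <-> tge (k + n) X.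
Proof.
by split; apply: t_ge0_iso; rewrite addrC;
  [exact: shiftzD | apply: iso_sym; exact: shiftzD].
Qed.

Lemma tle_hom k X Y : tle k X -> tge (k + 1) Y -> hom_zero X Y.
Proof.
move=> Xk Yk; apply/(hom_zero_shiftz HS k) => f; apply: (t_hom0 f Xk).
rewrite shift_classE ?opprK; last exact: t_ge0_iso.
by apply: t_ge0_iso Yk; apply/iso_sym/shiftzD.
Qed.

Lemma t_truncate k X : exists A B (f : hom A X) (g : hom X B) (h : hom B (shift A)),
  [/\ tle k A, tge (k + 1) B & dist f g h].
Proof.
have [A [B [f [g [h [Ak Bk D]]]]]] := t_trunc t (shiftz X k).
have [f' [g' [h' D']]] : triangle_on (shiftz A (- k)) X (shiftz B (- k)).
  apply: (triangle_on_iso HS) (iso_refl _) (iso_sym (shiftzK HS X k)) (iso_refl _).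
  by apply: (triangle_on_shiftz HS); exists f, g, h.
exists (shiftz A (- k)), (shiftz B (- k)), f', g', h'; split=> //.
  by apply: t_le0_iso Ak; apply: shiftzNK.
move: Bk; rewrite shift_classE ?opprK; last exact: t_ge0_iso.
apply: t_ge0_iso; apply/iso_sym; have := shiftzD HS B (- k) (k + 1).
by rewrite addrA addNr add0r.
Qed.

Lemma tle_succ k X : tle k X -> tle (k + 1) X.
Proof.
move=> /(t_le01) /shift_classE; rewrite opprK => P.
by apply: t_le0_iso (P (@t_le0_iso _ t)); apply: shiftzD.
Qed.

Lemma tge_pred k X : tge (k + 1) X -> tge k X.
Proof.
move=> Xk; apply: t_ge10; apply/shift_classE; first exact: t_ge0_iso.
by rewrite opprK; apply: t_ge0_iso Xk; apply/iso_sym/shiftzD.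
Qed.

Lemma tle_mono k l X : k <= l -> tle k X -> tle l X.
Proof.
rewrite -subr_ge0 => /gez0_abs e Xk; rewrite -(subrK k l) -e addrC.
elim: `|l - k|%N => [|n IH]; first by rewrite addr0.
by rewrite -addn1 PoszD addrA; apply: tle_succ.
Qed.

Lemma tge_mono k l X : l <= k -> tge k X -> tge l X.
Proof.
rewrite -subr_ge0 => /gez0_abs e; rewrite -{1}(subrK l k) -e addrC.
elim: `|k - l|%N => [|n IH]; first by rewrite addr0.
by rewrite -addn1 PoszD addrA => /tge_pred.
Qed.

Lemma tle_shift k X : tle (k + 1) X -> tle k (shift X).
Proof. by move=> Xk; apply/(tle_shiftz k 1). Qed.

Lemma tge_shift k X : tge (k + 1) X -> tge k (shift X).
Proof. by move=> Xk; apply/(tge_shiftz k 1). Qed.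

(** If X maps trivially to the coaisle, then the map X -> B in its truncation A
    -> X -> B is zero, so B is a retract of A[1]. As A[1] has only zero maps to
    B, this forces B = 0. *)
Lemma tleP k X : tle k X <-> (forall Y, tge (k + 1) Y -> hom_zero X Y).
Proof.
split=> [Xk Y|P]; first exact: tle_hom.
have [A [B [f [g [h [Ak Bk D]]]]]] := t_truncate k X.
have B0 : is_zero B.
  have [|r rh] := dist_desc HS (pt_rot HS D) (t := idm B).
    by rewrite comp1m; apply: P.
  rewrite /is_zero -rh; rewrite (_ : r = 0) ?comp0m //.
  apply: (tle_hom (k := k)) => //; apply: tle_shift; exact: tle_succ.
by apply: tle_iso Ak; exists f; apply: (dist_third_zero HS D).
Qed.

Lemma tgeP k Y : tge (k + 1) Y <-> (forall X, tle k X -> hom_zero X Y).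
Proof.
split=> [Yk X Xk|P]; first exact: tle_hom Xk Yk.
have [A [B [f [g [h [Ak Bk D]]]]]] := t_truncate k Y.
have A0 : is_zero A.
  have SA0 : is_zero (shift A).
    have [|r rh] := dist_lift3 HS D (t := idm _).
      by rewrite compm1 (P _ Ak f) fmap0.
    rewrite /is_zero -rh; rewrite (_ : r = 0) ?compm0 //.
    apply: (tle_hom (k := k)) => //; apply: tle_shift; exact: tle_succ.
  by apply: (shift_faithful HS); rewrite fmap1 fmap0.
apply: tge_iso Bk; apply: iso_sym; exists g.
by apply: (dist_third_zero HS (pt_rot HS D)); apply: is_zero_fob.
Qed.

Lemma tle_closed k : ext_closed (tle k).
Proof.
split.
- by move=> X X0; apply/tleP => Y _; apply: zero_hom.
- move=> X Y Z f g h D /tleP Xk /tleP Zk; apply/tleP => W Wk.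
  by apply: (ec_ext (ec_hom_from HS W) D); [apply: Xk | apply: Zk].
- move=> X Z XZ /tleP Zk; apply/tleP => W Wk.
  by apply: (ec_retract (ec_hom_from HS W) XZ); apply: Zk.
Qed.

Lemma tge_closed k : ext_closed (tge k).
Proof.
rewrite -(subrK 1 k); split.
- by move=> X X0; apply/tgeP => Y _; apply: hom_zero_to.
- move=> X Y Z f g h D /tgeP Xk /tgeP Zk; apply/tgeP => W Wk.
  by apply: (ec_ext (ec_hom_to HS W) D); [apply: Xk | apply: Zk].
- move=> X Z XZ /tgeP Zk; apply/tgeP => W Wk.
  by apply: (ec_retract (ec_hom_to HS W) XZ); apply: Zk.
Qed.

Lemma tle_cone k X Y Z : triangle_on X Y Z -> tle (k + 1) X -> tle k Y -> tle k Z.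
Proof.
move=> [f [g [h D]]] Xk Yk; apply: (ec_ext (tle_closed k) (pt_rot HS D) Yk).
exact: tle_shift.
Qed.

Lemma tge_cocone k X Y Z : triangle_on X Y Z -> tge (k + 1) Y -> tge k Z -> tge (k + 1) X.
Proof.
move=> [f [g [h D]]] Yk Zk.
have SX : tge k (shift X).
  apply: (ec_ext (tge_closed k) (pt_rot HS (pt_rot HS D)) Zk).
  exact: tge_shift.
exact/(tge_shiftz k 1).
Qed.

Definition in_heart X := tle 0 X /\ tge 0 X.

(* A hypothesis that is preserved by passing to the opposite category;
   findim_heart is applied to S and to its opposite. *)
Variable G : S.
Hypothesis HG : forall X, in_heart X -> sgen G (fun i => i = 0) X.

Lemma sgen_slice k X : tle k X -> tge k X -> sgen G (fun i => i = k) X.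
Proof.
move=> Xk Xk'; have /(sgen_shiftz HS (- k)) : sgen G (fun i => i = 0) (shiftz X k).
  by apply: HG; split; [apply/tle_shiftz | apply/tge_shiftz]; rewrite add0r.
move=> GX; apply: (ec_iso (gen_closed HS _) (iso_sym (shiftzK HS X k))).
by apply: (sgen_sub HS) GX => i /eqP; rewrite subr_eq0 => /eqP.
Qed.

(** One degree at a time. If Y lives in degrees at least k < 0, its lowest slice
    A is built from G[-k], a positive shift of G. So A -> Y is zero, and Y is a
    retract of its truncation in degrees at least k + 1. *)
Lemma nonneg_tge n Y : nonneg_for G Y -> tge (- n%:Z) Y -> tge 0 Y.
Proof.
move=> GY; elim: n => [|n IH]; first by rewrite oppr0.
rewrite -addn1 PoszD opprD => Yn; apply: IH; move: Yn; set k := - n%:Z - 1 => Yk.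
rewrite -[- n%:Z](subrK 1) -/k.
have [A [B [f [g [h [Ak Bk D]]]]]] := t_truncate k Y.
have Ak' : tge k A.
  rewrite -(subrK 1 k); apply: (@tge_cocone _ A Y B); first by exists f, g, h.
    by rewrite subrK.
  by apply: tge_mono Bk; rewrite lerD2l.
have f0 : f = 0.
  apply: (sgen_hom_zero HS (sgen_slice Ak Ak')) => i ->; apply: GY.
  by rewrite /k opprB opprK lerDl.
exact: (ec_retract (tge_closed _) (dist_first0 HS D f0) Bk).
Qed.

Lemma sgen_interval n k Y : tge k Y -> tle (k + n%:Z) Y -> sgen G (fun i => k <= i) Y.
Proof.
elim: n k Y => [|n IH] k Y Yk Yn.
  apply: (sgen_sub HS) (sgen_slice _ Yk) => [i ->//|].
  by rewrite addr0 in Yn.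
have [A [B [f [g [h [Ak Bk D]]]]]] := t_truncate k Y.
have Ak' : tge k A.
  rewrite -(subrK 1 k); apply: (@tge_cocone _ A Y B); first by exists f, g, h.
    by rewrite subrK.
  by apply: tge_mono Bk; rewrite lerD2l.
have Bn : tle (k + 1 + n%:Z) B.
  rewrite -addrA -PoszD add1n; apply: (@tle_cone _ A Y B) => //; first by exists f, g, h.
  by apply: tle_mono Ak; rewrite -addrA lerDl.
apply: (ec_ext (gen_closed HS _) D).
  by apply: (sgen_sub HS) (sgen_slice Ak Ak') => i ->.
apply: (sgen_sub HS) (IH _ _ Bk Bn) => i; apply: le_trans.
by rewrite lerDl.
Qed.

Lemma findim_heart : t_bounded t -> findim G = Some 0%N.
Proof.
move=> [t_up t_low]; rewrite (findimE HS); apply: inf_nat0 => Y GY.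
have [a /t_geE Ya] := t_low Y; have [b /t_leE Yb] := t_up Y.
have Y0 : tge 0 Y.
  apply: (nonneg_tge (n := `|a|%N) GY); apply: tge_mono Ya.
  by rewrite lerN2; apply: ler_norm.
apply: (sgen_sub HS) (sgen_interval (n := `|b|%N) Y0 _) => [i|].
  by rewrite addr0.
by apply: tle_mono Yb; rewrite add0r; apply: ler_norm.
Qed.

End TStructure.

Section Bounded.
Variables (S : triangulated_data) (HS : pretriangulated S) (t : t_structure S).

(** X[-(a+b)] lies in the coaisle above all positive shifts of G, hence in the
    orthogonal of these. *)
Lemma bounded_generator (G : S) : t_bounded t -> finite_enat (findim G) ->
  forall X, sgen G (fun=> True) X.
Proof.
move=> [t_up t_low]; rewrite (findimE HS) inf_natP => -[n Gn] X.
have [a /(t_geE HS) Xa] := t_low X; have [b /(t_leE HS) Gb] := t_up G.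
apply: (ec_iso (gen_closed HS _) (iso_sym (shiftzNK HS X (a + b)))).
apply: (sgen_sub HS) (sgen_shiftz HS (a + b) (Gn (shiftz X (- (a + b))) _)) => // k k1.
apply: (tle_hom HS (t := t) (k := b - k)).
  by apply/(tle_shiftz HS); rewrite subrK.
by apply/(tge_shiftz HS); apply: (tge_mono HS) Xa; lia.
Qed.

(** The truncation A -> W of the cone to negative degrees is K[1] for the kernel
    K of f in the heart: the composite A -> W -> X[1] comes from a map K -> X
    killed by f, hence zero. So A -> W factors through Y, which receives only
    zero from A, and W is a retract of its truncation to degrees at least 0. *)
Lemma cone_mono_heart (X Y W : S) (f : hom X Y) (k : hom Y W) (l : hom W (shift X)) :
  in_heart t X -> in_heart t Y -> dist f k l ->
  (forall V (g : hom V X), in_heart t V -> f ∘ g = 0 -> g = 0) ->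
  in_heart t W.
Proof.
move=> [X_le X_ge] [Y_le Y_ge] D f_mono; split.
  apply: (tle_cone HS _ (tle_succ HS X_le) Y_le); by exists f, k, l.
have [A [L [a [b [h [A_le L_ge D']]]]]] := t_truncate HS t (- 1) W.
rewrite addNr in L_ge.
have W_ge : tge t (- 1) W.
  apply: (ec_ext (tge_closed HS _ _) (pt_rot HS D)).
    exact: (tge_mono HS _ Y_ge).
  by apply: (tge_shift HS); rewrite addNr.
have A_ge : tge t (- 1) A.
  rewrite -[- 1](subrK 1); apply: (@tge_cocone _ HS t _ A W L); first by exists a, b, h.
    by rewrite subrK.
  exact: (tge_mono HS _ L_ge).
have UA_heart : in_heart t (unshift A).
  by split; [apply/(tle_shiftz HS t 0 (- 1)) | apply/(tge_shiftz HS t 0 (- 1))].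
have la0 : l ∘ a = 0.
  have [v [vu uv]] := pt_unit_iso HS A.
  have [m mE] := shift_full HS (l ∘ a ∘ v).
  have m0 : m = 0.
    apply: f_mono => //; apply: (shift_faithful HS).
    by rewrite fmapM fmap0 mE !compA (dist_comp0_3 HS D) !comp0m.
  have e : l ∘ a ∘ v = 0 by rewrite -mE m0 fmap0.
  by rewrite -[l ∘ a]compm1 -vu compA e comp0m.
have [w wa] := dist_lift2 HS D la0.
have w0 : w = 0 by apply: (tle_hom HS A_le); rewrite addNr.
apply: (ec_retract (tge_closed HS _ _) (dist_first0 HS D' _) L_ge).
by rewrite -wa w0 compm0.
Qed.

(** In a step X' -> X -> Q of the filtration, the cone W of X' -> X is in the
    heart, where it is a cokernel of this map like Q. So X is an extension of a
    retract of Q by X'. *)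
Lemma heart_generated (G : S) n (s : 'I_n -> heart t) :
  simple_representatives s -> is_dsum (fun k => sval (s k)) G ->
  length_category (heart t) ->
  forall X, in_heart t X -> sgen G (fun i => i = 0) X.
Proof.
move=> [_ _ s_all] [i [p [pi _ _]]] fin.
have simple_gen (Q : heart t) : is_simple Q -> sgen G (fun i => i = 0) (sval Q).
  move=> /s_all[k [f [g [gf fg]]]].
  apply: (ec_retract (gen_closed HS _) (Z := sval (s k))); first by exists f, g.
  apply: (ec_retract (gen_closed HS _) (Z := G)); first by exists (i k), (p k).
  exact: (@sgen_base _ HS G (fun i => i = 0) 0).
suff gen_fil (X : heart t) : finite_filtration X -> sgen G (fun i => i = 0) (sval X).
  by move=> X HX; have := gen_fil (exist _ X HX); apply; apply: fin.
elim=> {X} [X X0|]; first exact: (ec_zero (gen_closed HS _)).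
move=> [X' HX'] [X HX] Q f c _ GX' f_mono [cf c_univ] /simple_gen GQ.
have [W [k [l D]]] := @pt_cone _ HS X' X f.
have HW : in_heart t W.
  apply: (cone_mono_heart HX' HX D) => V g HV.
  exact: (f_mono (exist _ V HV)).
have [j jk] := dist_desc HS D (t := c) cf.
have [j' j'c] : exists j' : hom (sval Q) W, @comp S _ _ _ j' c = k.
  by have [j' [j'c _]] := c_univ (exist _ W HW) k (dist_comp0 HS D); exists j'.
apply: (ec_ext (gen_closed HS _) D) => //.
apply: (ec_retract (gen_closed HS _) _ GQ); exists j, j'.
have [|w wl] := dist_desc HS (pt_rot HS D) (t := j' ∘ j - idm W).
  rewrite compBl -compA jk comp1m; by apply/eqP; rewrite subr_eq0; apply/eqP; exact: j'c.
apply/eqP; rewrite -subr_eq0 -wl; apply/eqP.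
rewrite (_ : w = 0) ?comp0m //; apply: (tle_hom HS (t := t) (k := - 1)).
  by apply: (tle_shift HS); rewrite addNr; exact: HX'.1.
by rewrite addNr; exact: HW.2.
Qed.

End Bounded.

Section OppositeTStructure.
Variables (S : triangulated_data) (HS : pretriangulated S) (t : t_structure S).

Definition op_t_structure : t_structure (op S).
Proof.
apply: (@TStructure (op S) (t_ge0 t) (t_le0 t)).
- by move=> X Y /op_isomorphic; apply: (@t_ge0_iso S t).
- by move=> X Y /op_isomorphic; apply: (@t_le0_iso S t).
- move=> X X_ge; exists (@unshift S X); split.
    by apply/(tge_shiftz HS t 0 (- 1)); apply: (tge_mono HS (k := 0)).
  by apply/op_isomorphic/(shift_unshift HS).
- move=> X [Y [Y_le /op_isomorphic XY]].
  apply: (@t_le0_iso S t) (iso_sym XY) _.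
  by apply/(tle_shiftz HS t 0 1); apply: (tle_mono HS (k := 0)).
- move=> X Y f X_ge [Z [Z_le /op_isomorphic YZ]].
  apply: (tle_hom HS (t := t) (k := -1)); last by rewrite addNr.
  apply: (tle_iso (iso_sym YZ)); apply/(tle_shiftz HS t (- 1) 1).
  by rewrite addNr.
- move=> X; have [A [B [f [g [h [A_le B_ge D]]]]]] := t_truncate HS t (- 1) X.
  have [h' D'] := dist_op HS D; exists B, A, g, f, h'; split=> //.
  exists (@unshift S A); split; first exact: A_le.
  by apply/op_isomorphic/(shift_unshift HS).
Defined.

Lemma op_tle k (X : S) : tle op_t_structure k X <-> tge t (- k) X.
Proof. by rewrite /tle op_shiftz. Qed.

Lemma op_tge k (X : S) : tge op_t_structure k X <-> tle t (- k) X.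
Proof. by rewrite /tge op_shiftz. Qed.

Lemma op_bounded : t_bounded t -> t_bounded op_t_structure.
Proof.
have HO := op_pretriangulated HS; move=> [t_up t_low]; split=> X.
  have [n /(t_geE HS) Xn] := t_low X; exists n.
  exact/(t_leE HO)/op_tle.
have [n /(t_leE HS) Xn] := t_up X; exists n.
by apply/(t_geE HO)/op_tge; rewrite opprK.
Qed.

Lemma op_in_heart (X : S) : in_heart op_t_structure X <-> in_heart t X.
Proof. by split=> -[]. Qed.

End OppositeTStructure.

Lemma finitistic_dimension_triangulated (S : triangulated) :
  [/\ (forall G H : S,
           generated H `]-oo, +oo[ G ->
           finite_enat (findim G) -> finite_enat (findim H)),
        (forall t : t_structure S, t_bounded t ->
         forall G : S,
           finite_enat (findim G) \/ finite_enat (@findim (op S) G) ->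
           classical_generator G),
        (forall t : t_structure S, t_algebraic t ->
         forall (n : nat) (s : 'I_n -> heart t) (G : S),
           simple_representatives s ->
           is_dsum (fun k => sval (s k)) G ->
           findim G = Some 0%N /\ @findim (op S) G = Some 0%N)
      & (forall (G : S) (m : int),
           (forall X : S, generated G `]-oo, m] X) -> findim G = Some 0%N) /\
        (forall (G : S) (n m : int),
           n <= m -> (forall X : S, generated G `[n, m] X) ->
           findim_finite S /\ findim_finite (op S))].
Proof.
have HS := triangulated_pre S; have HO := op_pretriangulated HS.
have genT (T : triangulated_data) (HT : pretriangulated T) (G X : T) :
    sgen G (fun=> True) X -> generated G `]-oo, +oo[ X.
  by apply: (sgen_sub HT) => i _.
split.
- move=> G H HG; apply: (findim_finite_sgen HS).
  by apply: (sgen_sub HS) HG.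
- move=> t tb G [] Gfin X; apply: (genT _ HS).
    exact: (bounded_generator HS tb Gfin).
  apply: (op_sgen HS G (fun=> True) X).1.
  exact: (@bounded_generator _ HO _ G (op_bounded HS tb) Gfin X).
- move=> t [tb fin _] n s G sP GP.
  have heart_gen := heart_generated HS sP GP fin.
  split; first exact: (findim_heart HS heart_gen tb).
  apply: (findim_heart HO (t := op_t_structure HS t)); last exact: op_bounded.
  move=> X /op_in_heart HX; apply/(op_sgen HS).
  by apply: (sgen_sub HS) (heart_gen X HX) => i ->.
- split=> [G m GS|G n m nm GS].
    apply: (findim_all_le HS (m := m)) => X; apply: (sgen_sub HS) (GS X) => i.
    by rewrite in_itv.
  split; exists G.
    exists 0%N; apply: (findim_all_le HS (m := m)) => X.
    by apply: (sgen_sub HS) (GS X) => i; rewrite in_itv /= => /andP[].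
  exists 0%N; apply: (findim_all_le HO (m := - n)) => X; apply/(op_sgen HS).
  by apply: (sgen_sub HS) (GS X) => i; rewrite in_itv /= => /andP[]; rewrite lerN2.
Qed.

(** * Homotopy categories of complexes *)

Section Biproducts.
Variable A : preadditive.
Variables (X Y Z : A) (i1 : hom X Z) (i2 : hom Y Z) (p1 : hom Z X) (p2 : hom Z Y).
Hypothesis B : is_biprod i1 i2 p1 p2.

Lemma biprod_ext W (f g : hom Z W) : f ∘ i1 = g ∘ i1 -> f ∘ i2 = g ∘ i2 -> f = g.
Proof.
move=> e1 e2; rewrite -[f]compm1 -[g]compm1 -(biprod_sum B) !compDr !compA.
by rewrite e1 e2.
Qed.

Lemma biprod_copair W (f : hom X W) (g : hom Y W) :
  (f ∘ p1 + g ∘ p2) ∘ i1 = f /\ (f ∘ p1 + g ∘ p2) ∘ i2 = g.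
Proof.
case: B => e11 e22 e12 e21 _.
by rewrite !compDl -!compA e11 e22 e12 e21 !compm0 !compm1 addr0 add0r.
Qed.

Lemma biprod_zero : is_zero X -> is_zero Y -> is_zero Z.
Proof.
by move=> X0 Y0; apply: biprod_ext; rewrite comp0m; [apply: zero_hom X0 _ | apply: zero_hom Y0 _].
Qed.

End Biproducts.

Section ChainMaps.
Variable A : preadditive.
Implicit Types X Y Z : complex A.

Lemma cd_next X Y (f : forall i, hom (X i) (Y i)) :
  (forall i, cd Y i (i + 1) ∘ f i = f (i + 1) ∘ cd X i (i + 1)) ->
  forall i j, cd Y i j ∘ f i = f j ∘ cd X i j.
Proof.
move=> fP i j; have [->//|ij] := eqVneq j (i + 1).
by rewrite !cd_shape // comp0m compm0.
Qed.

Lemma null_homotopicI X Y (f : chain_map X Y) (s : forall i j, hom (X i) (Y j)) :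
  (forall i, f (i + 1) = cd Y i (i + 1) ∘ s (i + 1) i
                         + s (i + 1 + 1) (i + 1) ∘ cd X (i + 1) (i + 1 + 1)) ->
  null_homotopic f.
Proof. by move=> sP; exists s => h i j -> ->. Qed.

Lemma kb_surj X Y (f : @hom (kb_cat A) X Y) : exists f0 : chain_map X Y, f = kb_class f0.
Proof. by exists (kb_repr f); rewrite kb_reprK. Qed.

Lemma kb_compC X Y Z (g : chain_map Y Z) (f : chain_map X Y) :
  @comp (kb_cat A) X Y Z (kb_class g) (kb_class f) = kb_class (cm_comp g f).
Proof. exact: kb_compE. Qed.

Lemma kb_idE X : @idm (kb_cat A) X = kb_class (cm_id X).
Proof. by []. Qed.

Lemma kb_class0 X Y : kb_class (0 : chain_map X Y) = 0.
Proof. by apply: (addrI (kb_class 0)); rewrite -kb_classD !addr0. Qed.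

Lemma kb_classN X Y (f : chain_map X Y) : kb_class (- f) = - kb_class f.
Proof. by apply: (addrI (kb_class f)); rewrite -kb_classD !subrr kb_class0. Qed.

Lemma kb_class_eq0 X Y (f : chain_map X Y) : kb_class f = 0 <-> null_homotopic f.
Proof. by rewrite -kb_class0 kb_classP subr0. Qed.

Lemma kb_zero X : (forall i, is_zero (X i)) -> @is_zero (kb_cat A) X.
Proof.
move=> X0; rewrite /is_zero kb_idE -kb_class0; congr kb_class.
by apply: chain_mapP => i; apply: (zero_hom (X0 i)).
Qed.

Lemma kb_iso_strict X Y (f : chain_map X Y) (g : forall i, hom (Y i) (X i)) :
  (forall i, g i ∘ f i = idm _) -> (forall i, f i ∘ g i = idm _) ->
  @is_iso (kb_cat A) X Y (kb_class f).
Proof.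
move=> gf fg; have gP i j : cd X i j ∘ g i = g j ∘ cd Y i j.
  apply: (@iso_mono _ _ _ _ (f j)); first by exists (g j).
  by rewrite compA -cm_comm -compA fg compm1 compA fg comp1m.
exists (kb_class (ChainMap gP)); rewrite !kb_compC; split; congr kb_class;
by apply: chain_mapP => i /=.
Qed.

End ChainMaps.

Definition has_biproducts (A : preadditive) : Prop :=
  forall X Y : A, exists (Z : A) (i1 : hom X Z) (i2 : hom Y Z)
    (p1 : hom Z X) (p2 : hom Z Y), is_biprod i1 i2 p1 p2.

Section Cones.
Variable A : preadditive.
Implicit Types X Y Z W : complex A.

Lemma biprod_choice (I : Type) (X Y : I -> A) : has_biproducts A ->
  exists (Z : I -> A) (i1 : forall i, hom (X i) (Z i)) (i2 : forall i, hom (Y i) (Z i))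
    (p1 : forall i, hom (Z i) (X i)) (p2 : forall i, hom (Z i) (Y i)),
    forall i, is_biprod (i1 i) (i2 i) (p1 i) (p2 i).
Proof.
move=> bp; pose b i := cid (bp (X i) (Y i)); pose b1 i := cid (projT2 (b i)).
pose b2 i := cid (projT2 (b1 i)); pose b3 i := cid (projT2 (b2 i)).
pose b4 i := cid (projT2 (b3 i)).
exists (fun i => projT1 (b i)), (fun i => projT1 (b1 i)), (fun i => projT1 (b2 i)).
exists (fun i => projT1 (b3 i)), (fun i => projT1 (b4 i)) => i.
exact: projT2 (b4 i).
Qed.

Lemma cone_exists X Y (phi : chain_map X Y) : has_biproducts A ->
  exists W (iota : chain_map Y W) (pi : chain_map W (cx_shift 1 X)), is_cone phi iota pi.
Proof.
move=> bp; have [W [u [iota [pi [r B]]]]] := @biprod_choice int (fun i => X (i + 1)) Y bp.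
pose D i j :=
  (- (u j ∘ cd X (i + 1) (j + 1)) + iota j ∘ cast Y (i + 1) j ∘ phi (i + 1)) ∘ pi i
  + (iota j ∘ cd Y i j) ∘ r i.
have Du i j : D i j ∘ u i =
    - (u j ∘ cd X (i + 1) (j + 1)) + iota j ∘ cast Y (i + 1) j ∘ phi (i + 1).
  by rewrite (biprod_copair (B i) _ _).1.
have Di i j : D i j ∘ iota i = iota j ∘ cd Y i j.
  by rewrite (biprod_copair (B i) _ _).2.
have D_shape i j : j != i + 1 -> D i j = 0.
  move=> ij; have ij' : j + 1 != i + 1 + 1 by apply: contra ij => /eqP/addIr->.
  by rewrite /D !cd_shape // cast_neq 1?eq_sym // !(compm0, comp0m, oppr0, addr0).
have D_sq i j k : D j k ∘ D i j = 0.
  have [->|ij] := eqVneq j (i + 1); last by rewrite [D i j]D_shape // compm0.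
  have [->|jk] := eqVneq k (i + 1 + 1); last by rewrite D_shape // comp0m.
  apply: (biprod_ext (B i)); rewrite comp0m -compA.
    rewrite Du cast_id compm1 compDr compmN !compA Du Di cast_id compm1.
    rewrite compDl compNm -!compA cd_sq compm0 oppr0 add0r.
    by rewrite cm_comm addNr.
  by rewrite Di compA Di -compA cd_sq compm0.
have W_bd : exists a b : int, forall i, ~~ (a <= i <= b) -> is_zero (W i).
  have [a [b abP]] := cx_bounded X; have [c [d cdP]] := cx_bounded Y.
  exists (Num.min (a - 1) c), (Num.max b d) => i ni.
  by apply: (biprod_zero (B i)); [apply: abP | apply: cdP]; lia.
pose WC := Complex D_shape D_sq W_bd.
have iotaP i j : cd WC i j ∘ iota i = iota j ∘ cd Y i j by exact: Di.
have piP i j : cd (cx_shift 1 X) i j ∘ pi i = pi j ∘ cd WC i j.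
  have [_ _ p1i2 _ _] := B j; have [p1i1' _ p1i2' _ _] := B i.
  have [p1i1 _ _ _ _] := B j.
  apply: (biprod_ext (B i)); rewrite -!compA /= ?Du ?Di ?p1i1' ?p1i2'.
    rewrite expr1 mulrNz mulr1z compm1 compDr compmN !compA p1i1 p1i2 comp1m.
    by rewrite !comp0m addr0.
  by rewrite compm0 compA p1i2 comp0m.
exists WC, (@ChainMap A Y WC iota iotaP), (@ChainMap A WC (cx_shift 1 X) pi piP), u, r.
split=> //.
Qed.

Lemma triangle_iso_refl (C : preadditive) (S : functor C C)
    (X Y Z : C) (f : hom X Y) (g : hom Y Z) (h : hom Z (S X)) :
  triangle_iso f g h f g h.
Proof.
exists (idm _), (idm _), (idm _); split; first by split; apply: is_iso_id.
by rewrite fmap1 !comp1m !compm1.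
Qed.

Lemma cone_dist X Y W (phi : chain_map X Y) (iota : chain_map Y W)
    (pi : chain_map W (cx_shift 1 X)) :
  is_cone phi iota pi -> @dist (Kb A) X Y W (kb_class phi) (kb_class iota) (kb_class pi).
Proof. by move=> C; exists X, Y, W, phi, iota, pi; split=> //; apply: triangle_iso_refl. Qed.

(** Let V be the cone of i, with V^k = X^(k+1) + Y^k. The projection V -> Y -> Z
    is a chain map, split by (delta, s), and the homotopy that sends Y^k to X^k
    inside V^(k-1) by r contracts the rest. The rotation of triangles, the
    trivial triangles and the triangles of brutal truncations are all instances. *)
Lemma split_dist X Y Z (i : chain_map X Y) (p : chain_map Y Z)
    (r : forall k, hom (Y k) (X k)) (s : forall k, hom (Z k) (Y k))
    (delta : chain_map Z (cx_shift 1 X)) : has_biproducts A ->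
  (forall k, is_biprod (i k) (s k) (r k) (p k)) ->
  (forall k, delta k = - (r (k + 1) ∘ cd Y k (k + 1) ∘ s k)) ->
  @dist (Kb A) X Y Z (kb_class i) (kb_class p) (kb_class delta).
Proof.
move=> bp B deltaE; have [V [iota [pi [u [q [BV Vu]]]]]] := cone_exists i bp.
have V1 k : cd V k (k + 1) ∘ u k =
    - (u (k + 1) ∘ cd X (k + 1) (k + 1 + 1)) + iota (k + 1) ∘ i (k + 1).
  by rewrite Vu cast_id compm1.
have Viota k : cd V k (k + 1) ∘ iota k = iota (k + 1) ∘ cd Y k (k + 1) by apply: cm_comm.
have ri k : r k ∘ i k = idm _ by case: (B k).
have pi0 k : p k ∘ i k = 0 by case: (B k).
have ps k : p k ∘ s k = idm _ by case: (B k).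
have rs k : r k ∘ s k = 0 by case: (B k).
have Bsum k : i k ∘ r k = idm _ - s k ∘ p k.
  by case: (B k) => _ _ _ _ <-; rewrite addrK.
have qu k : q k ∘ u k = 0 by case: (BV k).
have qiota k : q k ∘ iota k = idm _ by case: (BV k).
have piu k : pi k ∘ u k = idm _ by case: (BV k).
have piiota k : pi k ∘ iota k = 0 by case: (BV k).
have ds k : cd Y k (k + 1) ∘ s k = s (k + 1) ∘ cd Z k (k + 1) - i (k + 1) ∘ delta k.
  have e : i (k + 1) ∘ (r (k + 1) ∘ cd Y k (k + 1) ∘ s k) =
      cd Y k (k + 1) ∘ s k - s (k + 1) ∘ cd Z k (k + 1).
    rewrite !compA Bsum !compBl comp1m -(compA (s _) (p _)) -cm_comm.
    by rewrite -!compA ps compm1.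
  by rewrite deltaE compmN opprK e [RHS]addrC subrK.
have dd k : cd X (k + 1) (k + 1 + 1) ∘ delta k = - (delta (k + 1) ∘ cd Z k (k + 1)).
  rewrite -(cm_comm delta) /= expr1 mulrNz mulr1z compNm opprK //.
pose b k := iota k ∘ s k + u k ∘ delta k.
have bP k : cd V k (k + 1) ∘ b k = b (k + 1) ∘ cd Z k (k + 1).
  rewrite /b compDr !compA Viota V1 -(compA (iota _)) ds compBr.
  rewrite !compDl compNm -(compA (u _) _ (delta k)) dd compmN opprK !compA.
  by rewrite [X in _ + X = _]addrC addrA subrK.
pose bc := @ChainMap A Z V b (cd_next bP).
pose f k := p k ∘ q k.
have fP k : cd Z k (k + 1) ∘ f k = f (k + 1) ∘ cd V k (k + 1).
  apply: (biprod_ext (BV k)); rewrite /f -!compA ?V1 ?Viota.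
    rewrite qu !compm0 compDr compmN compDr compmN !compA -(compA (p _)) qu.
    by rewrite compm0 comp0m oppr0 add0r -(compA (p _)) qiota compm1 pi0.
  by rewrite qiota compm1 (compA (q _)) qiota comp1m cm_comm.
pose fc := @ChainMap A V Z f (cd_next fP).
have fb : cm_comp fc bc = cm_id Z.
  apply: chain_mapP => k /=; rewrite /f /b compDr -!compA (compA (q k)) qiota comp1m ps.
  by rewrite (compA (q k)) qu comp0m compm0 addr0.
have bf : null_homotopic (cm_id V - cm_comp bc fc).
  apply: (null_homotopicI (s := fun i j => u j ∘ cast X i (j + 1) ∘ r i ∘ q i)) => h /=.
  rewrite !cast_id !compm1 !compA V1; set k := h + 1.
  have e : idm (V k) - b k ∘ f k =
      (- (u k ∘ cd X k (k + 1)) + iota k ∘ i k) ∘ (r k ∘ q k)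
      + u k ∘ (r (k + 1) ∘ (q (k + 1) ∘ cd V k (k + 1))).
    apply: (biprod_ext (BV k)).
      rewrite compBl compDl comp1m -!compA qu V1 !compm0 add0r subr0.
      rewrite (compDr (q _)) compmN (compA (q _)) qu comp0m oppr0 add0r.
      by rewrite (compA (q _)) qiota comp1m ri compm1.
    rewrite compBl compDl comp1m -!compA qiota Viota (compA (q _)) qiota comp1m !compm1.
    rewrite /b compDl deltaE compmN compNm -!compA.
    have sp : s k ∘ p k = idm _ - i k ∘ r k by rewrite Bsum opprB addrC subrK.
    rewrite sp !compBr !compm1 compDl compNm -!compA.
    rewrite (compA (cd Y _ _)) cm_comm -(compA _ (cd X _ _)) (compA (r _)) ri comp1m.
    set x := iota k ∘ (i k ∘ r k); set y := u k ∘ (r (k + 1) ∘ _).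
    set z := u k ∘ (cd X _ _ ∘ _); set w := iota k.
    by rewrite !opprB [X in w + X]addrA [LHS]addrC subrK -[RHS]addrC addrA.
  by move: e; rewrite /k /f !compA.
have cf1 : @comp (kb_cat A) _ _ _ (kb_class bc) (kb_class fc) = @idm (kb_cat A) V.
  by rewrite kb_compC kb_idE; apply/esym/kb_classP.
have fc1 : @comp (kb_cat A) _ _ _ (kb_class fc) (kb_class bc) = @idm (kb_cat A) Z.
  by rewrite kb_compC fb.
exists X, Y, V, i, iota, pi; split; first by exists u, q.
exists (idm _), (idm _), (kb_class bc).
split; first by split; [exact: is_iso_id | exact: is_iso_id | exists (kb_class fc)].
split; first by rewrite comp1m compm1.
  have -> : kb_class p = @comp (kb_cat A) _ _ _ (kb_class fc) (kb_class iota).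
    rewrite kb_compC; congr kb_class; apply: chain_mapP => k /=.
    by rewrite /f -compA qiota compm1.
  by rewrite compA cf1 comp1m compm1.
rewrite fmap1 comp1m kb_compC; congr kb_class; apply: chain_mapP => k /=.
by rewrite /b compDr !compA piiota piu comp0m comp1m add0r.
Qed.

End Cones.

Section TriangleIso.
Variables (C : preadditive) (S : functor C C).

Lemma triangle_iso_trans (X Y Z : C) (f : hom X Y) (g : hom Y Z) (h : hom Z (S X))
    X' Y' Z' (f' : hom X' Y') (g' : hom Y' Z') (h' : hom Z' (S X'))
    X2 Y2 Z2 (f2 : hom X2 Y2) (g2 : hom Y2 Z2) (h2 : hom Z2 (S X2)) :
  triangle_iso f g h f' g' h' -> triangle_iso f' g' h' f2 g2 h2 ->
  triangle_iso f g h f2 g2 h2.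
Proof.
move=> [a [b [c [[Ia Ib Ic] [e1 e2 e3]]]]] [a' [b' [c' [[Ia' Ib' Ic'] [e1' e2' e3']]]]].
exists (a' ∘ a), (b' ∘ b), (c' ∘ c); split; first by split; apply: is_iso_comp.
split; first by rewrite -compA e1 compA e1' compA.
  by rewrite -compA e2 compA e2' compA.
by rewrite fmapM -compA e3 compA e3' compA.
Qed.

Lemma triangle_iso_sym (X Y Z : C) (f : hom X Y) (g : hom Y Z) (h : hom Z (S X))
    X' Y' Z' (f' : hom X' Y') (g' : hom Y' Z') (h' : hom Z' (S X')) :
  triangle_iso f g h f' g' h' -> triangle_iso f' g' h' f g h.
Proof.
move=> [a [b [c [[Ia Ib Ic] [e1 e2 e3]]]]].
have [a' [a'a aa']] := Ia; have [b' [b'b bb']] := Ib; have [c' [c'c cc']] := Ic.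
exists a', b', c'; split; first by split; [exists a | exists b | exists c].
split.
- by apply: (iso_mono Ib); rewrite !compA bb' comp1m e1 -compA aa' compm1.
- by apply: (iso_mono Ic); rewrite !compA cc' comp1m e2 -compA bb' compm1.
- apply: (iso_mono (fmap_iso S Ia)).
  by rewrite !compA e3 -fmapM aa' fmap1 comp1m -compA cc' compm1.
Qed.

Lemma triangle_iso_rot (X Y Z : C) (f : hom X Y) (g : hom Y Z) (h : hom Z (S X))
    X' Y' Z' (f' : hom X' Y') (g' : hom Y' Z') (h' : hom Z' (S X')) :
  triangle_iso f g h f' g' h' ->
  triangle_iso g h (- fmap S f) g' h' (- fmap S f').
Proof.
move=> [a [b [c [[Ia Ib Ic] [e1 e2 e3]]]]]; exists b, c, (fmap S a).
split; first by split=> //; apply: fmap_iso.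
by split=> //; rewrite compmN compNm -!fmapM e1.
Qed.

(** Completion to a map of triangles is invariant under isomorphism, so that it
    has to be verified for standard cones only. *)
Lemma triangle_iso_fill (X Y Z : C) (f : hom X Y) (g : hom Y Z) (h : hom Z (S X))
    (X' Y' Z' : C) (f' : hom X' Y') (g' : hom Y' Z') (h' : hom Z' (S X'))
    (V W T : C) (k : hom V W) (l : hom W T) (m : hom T (S V))
    (V' W' T' : C) (k' : hom V' W') (l' : hom W' T') (m' : hom T' (S V'))
    (a : hom X X') (b : hom Y Y') :
  triangle_iso f g h k l m -> triangle_iso f' g' h' k' l' m' ->
  (forall (a : hom V V') (b : hom W W'), b ∘ k = k' ∘ a ->
     exists c : hom T T', c ∘ l = l' ∘ b /\ fmap S a ∘ m = m' ∘ c) ->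
  b ∘ f = f' ∘ a ->
  exists c : hom Z Z', c ∘ g = g' ∘ b /\ fmap S a ∘ h = h' ∘ c.
Proof.
move=> [x [y [z [[Ix Iy Iz] [e1 e2 e3]]]]] [x' [y' [z' [[Ix' Iy' Iz'] [e1' e2' e3']]]]].
move=> fill e.
have [xi [xix xxi]] := Ix; have [yi [yiy yyi]] := Iy; have [zi [ziz zzi]] := Iz.
have [zi' [ziz' zzi']] := Iz'.
have [|c [c1 c2]] := fill (x' ∘ a ∘ xi) (y' ∘ b ∘ yi).
  apply: (iso_epi Ix); rewrite -!compA xix compm1 -e1 (compA yi) yiy comp1m.
  by rewrite e !compA e1'.
exists (zi' ∘ c ∘ z); split.
  apply: (iso_mono Iz'); rewrite !compA zzi' comp1m -compA e2 compA c1 -!compA.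
  by rewrite yiy compm1 (compA z') e2' !compA.
apply: (iso_mono (fmap_iso S Ix')).
rewrite (compA _ h') e3' -!compA (compA z') zzi' comp1m (compA m') -c2 !fmapM -!compA.
by rewrite -e3 (compA (fmap S xi)) -fmapM xix fmap1 comp1m.
Qed.

End TriangleIso.

Section KbTriangulated.
Variable A : preadditive.
Variables (O : A) (O0 : is_zero O) (bp : has_biproducts A).
Implicit Types X Y Z W : complex A.

Definition zero_complex : complex A.
Proof.
exists (fun=> O) (fun _ _ => 0) => [//|i j k|]; first by rewrite comp0m.
by exists 0, 0 => i _.
Defined.

Lemma zero_complexP : @is_zero (kb_cat A) zero_complex.
Proof. by apply: kb_zero => i. Qed.

Lemma cast_castV (X : int -> A) i j : i = j -> cast X j i ∘ cast X i j = idm (X i).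
Proof. by move=> <-; rewrite cast_id comp1m. Qed.

Lemma cast_nat (X Y : int -> A) (f : forall i, hom (X i) (Y i)) i j :
  f j ∘ cast X i j = cast Y i j ∘ f i.
Proof.
have [->|ij] := eqVneq i j; first by rewrite !cast_id comp1m compm1.
by rewrite !cast_neq // comp0m compm0.
Qed.

(** The homotopy s between b phi and phi' a is the off-diagonal entry of the map
    of cones. *)
Lemma cone_fill X Y W (phi : chain_map X Y) (iota : chain_map Y W)
    (pi : chain_map W (cx_shift 1 X)) X' Y' W' (phi' : chain_map X' Y')
    (iota' : chain_map Y' W') (pi' : chain_map W' (cx_shift 1 X'))
    (a : chain_map X X') (b : chain_map Y Y') :
  is_cone phi iota pi -> is_cone phi' iota' pi' ->
  null_homotopic (cm_comp b phi - cm_comp phi' a) ->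
  exists c : chain_map W W',
    cm_comp c iota = cm_comp iota' b /\ cm_comp (cm_shift 1 a) pi = cm_comp pi' c.
Proof.
move=> [u [r [B Wu]]] [u' [r' [B' Wu']]] [s sP].
have Wu1 k : cd W k (k + 1) ∘ u k =
    - (u (k + 1) ∘ cd X (k + 1) (k + 1 + 1)) + iota (k + 1) ∘ phi (k + 1).
  by rewrite Wu cast_id compm1.
have Wu1' k : cd W' k (k + 1) ∘ u' k =
    - (u' (k + 1) ∘ cd X' (k + 1) (k + 1 + 1)) + iota' (k + 1) ∘ phi' (k + 1).
  by rewrite Wu' cast_id compm1.
pose c i := (u' i ∘ a (i + 1) + iota' i ∘ s (i + 1) i) ∘ pi i + (iota' i ∘ b i) ∘ r i.
have cu i : c i ∘ u i = u' i ∘ a (i + 1) + iota' i ∘ s (i + 1) i.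
  exact: (biprod_copair (B i) _ _).1.
have ci i : c i ∘ iota i = iota' i ∘ b i by exact: (biprod_copair (B i) _ _).2.
have cP i : cd W' i (i + 1) ∘ c i = c (i + 1) ∘ cd W i (i + 1).
  apply: (biprod_ext (B i)); rewrite -!compA; last first.
    by rewrite ci compA cm_comm -compA cm_comm compA -ci -compA cm_comm.
  rewrite cu Wu1 !compDr !compmN !compA Wu1' cm_comm cu ci.
  have e : b (i + 1) ∘ phi (i + 1) = phi' (i + 1) ∘ a (i + 1) +
     (cd Y' i (i + 1) ∘ s (i + 1) i + s (i + 1 + 1) (i + 1) ∘ cd X (i + 1) (i + 1 + 1)).
    by have /= <- := sP i _ _ erefl erefl; rewrite [RHS]addrC subrK.
  rewrite -(compA (iota' _) (b _)) e !compDl !compDr compNm -!compA cm_comm.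
  set x := u' _ ∘ _; set y := iota' _ ∘ (phi' _ ∘ _); set z := iota' _ ∘ (cd _ _ _ ∘ _).
  set t := iota' _ ∘ (s _ _ ∘ _).
  by rewrite opprD [y + (z + t)]addrA [y + z + t]addrC [RHS]addrA subrK addrA.
exists (@ChainMap A W W' c (cd_next cP)); split; apply: chain_mapP => i /=; first exact: ci.
have [e1 _ e2 _ _] := B i; have [e1' _ e2' _ _] := B' i.
apply: (biprod_ext (B i)); rewrite -!compA ?cu ?ci ?e1 ?e2.
  by rewrite compDr !compA e1' e2' comp0m comp1m compm1 addr0.
by rewrite compA e2' comp0m compm0.
Qed.

Lemma kb_pretriangulated : pretriangulated (Kb A).
Proof.
have kiso : forall (X Y Z : Kb A) (f : hom X Y) (g : hom Y Z)
      (h : hom Z (shift X)) (X' Y' Z' : Kb A) (f' : hom X' Y') (g' : hom Y' Z')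
      (h' : hom Z' (shift X')),
    triangle_iso f g h f' g' h' -> dist f g h -> dist f' g' h'.
  move=> X Y Z f g h X' Y' Z' f' g' h' T [V [W [U [phi [iota [pi [C T']]]]]]].
  exists V, W, U, phi, iota, pi; split=> //.
  exact: triangle_iso_trans (triangle_iso_sym T) T'.
split=> //.
- by exists zero_complex; apply: zero_complexP.
- move=> X; change (@is_iso (kb_cat A) _ _ (kb_class (kb_unit_map X))).
  apply: (@kb_iso_strict A X _ (kb_unit_map X) (fun i => cast X (i + 1 - 1) i)) => i /=.
    by apply: cast_castV; rewrite addrK.
  by apply: cast_castV; rewrite addrK.
- move=> X Y f; have [f0 ->] := kb_surj f.
  change (kb_comp (kb_class (kb_unit_map Y)) (kb_class f0) =
    kb_comp (kb_fmap 1 (kb_fmap (-1) (kb_class f0))) (kb_class (kb_unit_map X))).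
  rewrite !kb_fmapE !kb_compE; congr kb_class; apply: chain_mapP => i /=.
  by rewrite cast_nat.
- move=> X; change (@is_iso (kb_cat A) _ _ (kb_class (kb_counit_map X))).
  apply: (@kb_iso_strict A _ X (kb_counit_map X) (fun i => cast X i (i - 1 + 1))) => i /=.
    by apply: cast_castV; rewrite subrK.
  by apply: cast_castV; rewrite subrK.
- move=> X Y f; have [f0 ->] := kb_surj f.
  change (kb_comp (kb_class f0) (kb_class (kb_counit_map X)) =
    kb_comp (kb_class (kb_counit_map Y)) (kb_fmap (-1) (kb_fmap 1 (kb_class f0)))).
  rewrite !kb_fmapE !kb_compE; congr kb_class; apply: chain_mapP => i /=.
  by rewrite cast_nat.
- move=> X Z Z0.
  have D : @dist (Kb A) X X zero_complex (kb_class (cm_id X)) (kb_class 0) (kb_class 0).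
    apply: (split_dist (r := fun k => idm (X k)) (s := fun k => 0)) => // k.
      split; rewrite ?comp1m ?compm0 ?comp0m ?addr0 //=.
    by rewrite /= compm0 oppr0.
  apply: kiso D; exists (idm _), (idm _), 0; split.
    split; [exact: is_iso_id | exact: is_iso_id | exists 0].
    by rewrite !comp0m Z0 (zero_complexP).
  by split; rewrite ?comp0m ?compm0 ?comp1m ?compm1 ?kb_class0 ?compm0.
- move=> X Y f; have [f0 ->] := kb_surj f.
  have [W [iota [pi C]]] := cone_exists f0 bp.
  by exists W, (kb_class iota), (kb_class pi); apply: cone_dist.
- move=> X Y Z f g h [V [W [U [phi [iota [pi [C T]]]]]]].
  apply: kiso (triangle_iso_sym (triangle_iso_rot T)) _.
  (* The sequence W -> U -> V[1] through the cone U of phi : V -> W is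
     degreewise split, with connecting map - phi[1]. *)
  change (@dist (Kb A) W U (cx_shift 1 V) (kb_class iota) (kb_class pi)
    (- kb_fmap 1 (kb_class phi))).
  rewrite kb_fmapE -kb_classN; case: C => u [r [B Uu]].
  apply: (@split_dist A W U (cx_shift 1 V) iota pi r u (- cm_shift 1 phi) bp) => k.
    by case: (B k) => e1 e2 e3 e4 e5; split=> //; rewrite addrC.
  rewrite /= -compA Uu cast_id compm1 compDr compmN !compA.
  by case: (B (k + 1)) => _ -> _ -> _; rewrite comp0m oppr0 add0r comp1m.
- move=> X Y Z f g h X' Y' Z' f' g' h' a b.
  move=> [V [W [U [phi [iota [pi [C T]]]]]]] [V' [W' [U' [phi' [iota' [pi' [C' T']]]]]]].
  apply: (triangle_iso_fill T T') => {}a {}b.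
  have [a0 ->] := kb_surj a; have [b0 ->] := kb_surj b.
  rewrite !kb_compC => /kb_classP N.
  have [c [c1 c2]] := cone_fill C C' N; exists (kb_class c).
  rewrite !kb_compC c1; split=> //.
  by rewrite -c2 -!kb_compE; congr kb_comp; exact: (kb_fmapE 1 a0).
Qed.

End KbTriangulated.

Lemma zero_hom_eq (C : preadditive) (X Y : C) (f g : hom X Y) : is_zero X -> f = g.
Proof. by move=> X0; rewrite (zero_hom X0 f) (zero_hom X0 g). Qed.

Lemma hom_eq_to_zero (C : preadditive) (X Y : C) (f g : hom X Y) : is_zero Y -> f = g.
Proof. by move=> Y0; rewrite (hom_zero_to Y0 f) (hom_zero_to Y0 g). Qed.

Section SplitTriangle.
Variable A : preadditive.

(** In split_dist, the connecting map - r d s is always a chain map. *)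
Lemma split_triangle (X Y Z : complex A) (i : chain_map X Y) (p : chain_map Y Z)
    (r : forall k, hom (Y k) (X k)) (s : forall k, hom (Z k) (Y k)) :
  has_biproducts A -> (forall k, is_biprod (i k) (s k) (r k) (p k)) ->
  exists h, @dist (Kb A) X Y Z (kb_class i) (kb_class p) h.
Proof.
move=> bp B; pose delta k := - (r (k + 1) ∘ cd Y k (k + 1) ∘ s k).
have deltaP k : cd (cx_shift 1 X) k (k + 1) ∘ delta k = delta (k + 1) ∘ cd Z k (k + 1).
  rewrite /= expr1 mulrNz mulr1z /delta !compNm compmN opprK.
  have [ri ps _ _ _] := B (k + 1 + 1); have [_ ps' _ _ e] := B (k + 1).
  have [_ ps0 _ _ _] := B k.
  rewrite -[cd X _ _]comp1m -ri -(compA (r _)) -cm_comm -!compA.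
  rewrite (compA (i _)) (_ : i (k + 1) ∘ r (k + 1) = idm _ - s (k + 1) ∘ p (k + 1)); last first.
    by rewrite -e addrK.
  rewrite compBl comp1m !compBr (compA (cd Y (k + 1) _) (cd Y k _)) cd_sq comp0m compm0 sub0r.
  congr (- (_ ∘ (_ ∘ _))); rewrite -!compA; congr (_ ∘ _).
  by rewrite compA -cm_comm -compA ps0 compm1.
pose dc := @ChainMap A Z (cx_shift 1 X) delta (cd_next deltaP).
by exists (kb_class dc); apply: (split_dist (r := r) (s := s)).
Qed.

End SplitTriangle.

(** * Brutal truncations and stalk complexes *)

Section Truncation.
Variable A : preadditive.
Variables (O : A) (O0 : is_zero O) (bp : has_biproducts A).
Implicit Types (X Y Z : complex A) (P : A) (p : pred int).

Let HK := kb_pretriangulated O0 bp.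

(** A summand that a boolean switches on or off. The maps sel_in and sel_out
    replace transports along equalities of objects in the complexes below. *)
Definition sel (b : bool) P : A := if b then P else O.

Definition sel_in (b : bool) (P : A) : hom (sel b P) P :=
  match b as b return hom (sel b P) P with true => idm P | false => 0 end.

Definition sel_out (b : bool) P : hom P (sel b P) :=
  match b as b return hom P (sel b P) with true => idm P | false => 0 end.

Lemma sel_outin (b : bool) P : sel_out b P ∘ sel_in b P = idm (sel b P).
Proof. by case: b; rewrite /= ?comp1m ?comp0m //; rewrite -O0. Qed.

Lemma sel_inoutT (b : bool) P : b -> sel_in b P ∘ sel_out b P = idm P.
Proof. by case: b => // _; rewrite comp1m. Qed.

Lemma sel_zero (b : bool) P : (b -> is_zero P) -> is_zero (sel b P).
Proof. by case: b => [|_]; [apply|]. Qed.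

Definition trunc p Y : complex A.
Proof.
exists (fun i => sel (p i) (Y i))
  (fun i j => sel_out (p j) (Y j) ∘ cd Y i j ∘ sel_in (p i) (Y i)).
- by move=> i j ij; rewrite cd_shape // compm0 comp0m.
- move=> i j k; rewrite -!compA (compA (sel_in _ _)).
  case: (p j); rewrite /= ?comp1m ?comp0m ?compm0 //.
  by rewrite (compA (cd Y _ _)) cd_sq comp0m compm0.
- have [a [b abP]] := cx_bounded Y; exists a, b => i ni.
  by apply: sel_zero => _; apply: abP.
Defined.

Definition trunc_in p Y : (forall i, p i -> p (i + 1)) -> chain_map (trunc p Y) Y.
Proof.
move=> pS; exists (fun i => sel_in (p i) (Y i)); apply: cd_next => i /=.
have := pS i; case: (p i) => [/(_ isT) pi1|_]; last by rewrite !compm0.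
by rewrite !compA sel_inoutT // comp1m.
Defined.

Definition trunc_out p Y : (forall i, p (i + 1) -> p i) -> chain_map Y (trunc p Y).
Proof.
move=> pS; exists (fun i => sel_out (p i) (Y i)); apply: cd_next => i /=.
have := pS i; case: (p (i + 1)) => [/(_ isT) pi|_]; last by rewrite !comp0m.
by rewrite -!compA sel_inoutT // compm1.
Defined.

Lemma trunc_triangle (m : int) Y
    (up : forall i, m <= i -> m <= i + 1) (down : forall i, i + 1 < m -> i < m) :
  exists h, @dist (Kb A) _ Y _
    (kb_class (@trunc_in (fun i => m <= i) Y up))
    (kb_class (@trunc_out (fun i => i < m) Y down)) h.
Proof.
apply: (@split_triangle A _ Y _ (@trunc_in (fun i => m <= i) Y up)
  (@trunc_out (fun i => i < m) Y down) (fun i => sel_out (m <= i) (Y i))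
  (fun i => sel_in (i < m) (Y i)) bp) => k /=.
split; rewrite ?sel_outin //; rewrite ltNge; case: (m <= k);
  by rewrite /= ?comp1m ?compm1 ?comp0m ?compm0 ?addr0 ?add0r.
Qed.

Lemma trunc_triangle_ex (m : int) Y : exists
    (up : forall i, m <= i -> m <= i + 1) (down : forall i, i + 1 < m -> i < m) h,
  @dist (Kb A) _ Y _
    (kb_class (@trunc_in (fun i => m <= i) Y up))
    (kb_class (@trunc_out (fun i => i < m) Y down)) h.
Proof.
have up i : m <= i -> m <= i + 1 by lia.
have down i : i + 1 < m -> i < m by lia.
by exists up, down; apply: trunc_triangle.
Qed.

Definition concentrated p Y : Prop := forall i, ~~ p i -> is_zero (Y i).

Lemma kb_hom_zero X Y : (forall i, is_zero (X i) \/ is_zero (Y i)) ->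
  @hom_zero (kb_cat A) X Y.
Proof.
move=> XY f; have [f0 ->] := kb_surj f; rewrite -kb_class0; congr kb_class.
apply: chain_mapP => i; case: (XY i) => z; first exact: zero_hom.
exact: hom_zero_to.
Qed.

Definition stalk_at (m : int) P : complex A.
Proof.
exists (fun i => sel (i == m) P) (fun i j => 0) => //.
  by move=> i j k; rewrite compm0.
exists m, m => i; rewrite -eq_le => im.
by apply: sel_zero => e; rewrite eq_sym e in im.
Defined.

Lemma stalk_at_conc m P : concentrated (pred1 m) (stalk_at m P).
Proof. by move=> i im; apply: sel_zero => e; rewrite /= e in im. Qed.

Lemma conc_stalk m Y : concentrated (pred1 m) Y ->
  @isomorphic (kb_cat A) Y (stalk_at m (Y m)).
Proof.
move=> Ym; pose f i : hom (Y i) (stalk_at m (Y m) i) := sel_out (i == m) (Y m) ∘ cast Y i m.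
have fP i : cd (stalk_at m (Y m)) i (i + 1) ∘ f i = f (i + 1) ∘ cd Y i (i + 1).
  rewrite comp0m; have [e|im] := eqVneq i m; last first.
    by rewrite (zero_hom (Ym _ im) (cd Y i (i + 1))) compm0.
  have im : ~~ pred1 m (i + 1) by rewrite /= e; lia.
  by rewrite (hom_zero_to (Ym _ im) (cd Y i (i + 1))) compm0.
pose fc := @ChainMap A Y (stalk_at m (Y m)) f (cd_next fP); exists (kb_class fc).
apply: (@kb_iso_strict A Y (stalk_at m (Y m)) fc
  (fun i => cast Y m i ∘ sel_in (i == m) (Y m))) => i /=.
  have [e|im] : i = m \/ i != m by case: (eqVneq i m) => ?; [left | right].
    rewrite /f -compA (compA (sel_in _ _)) sel_inoutT ?e ?eqxx // comp1m.
    exact: cast_castV.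
  by apply: zero_hom_eq; apply: Ym.
rewrite /f -compA (compA (cast Y _ _)).
have [e|im] : i = m \/ i != m by case: (eqVneq i m) => ?; [left | right].
  by rewrite cast_castV // comp1m sel_outin.
by apply: zero_hom_eq; apply: stalk_at_conc.
Qed.

(** Splitting off the lowest degree by a brutal truncation makes a bounded
    complex an iterated extension of stalk complexes. *)
Lemma conc_closed (C : Kb A -> Prop) p : ext_closed C ->
  (forall i P, p i -> C (stalk_at i P)) -> forall Y, concentrated p Y -> C Y.
Proof.
move=> HC CP.
have ind (n : nat) : forall (a : int) Y, concentrated (fun i => a <= i < a + n%:Z) Y ->
    concentrated p Y -> C Y.
  elim: n => [|n IH] a Y Ya Yp.
    by apply: (ec_zero HC); apply: kb_zero => i; apply: Ya; lia.
  have [up [down [h D]]] := trunc_triangle_ex (a + 1) Y.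
  apply: (ec_ext HC D).
    apply: (IH (a + 1)) => i ni; apply: sel_zero => ai; last exact: Yp.
    by apply: Ya; lia.
  set B := trunc _ _.
  have Ba : concentrated (pred1 a) B.
    by move=> i /= ni; apply: sel_zero => ia; apply: Ya; lia.
  have [pa|pa] := boolP (p a).
    by apply: (ec_iso HC (iso_sym (conc_stalk Ba))); apply: CP.
  apply: (ec_zero HC); apply: kb_zero => i.
  have [->|ia] := eqVneq i a; last exact: Ba.
  by apply: sel_zero => _; apply: Yp.
move=> Y Yp; have [a [b abP]] := cx_bounded Y.
apply: (ind (absz (b + 1 - a)%R) a) => // i ni; apply: abP; lia.
Qed.

Definition stalk_map m P Q (f : hom P Q) : chain_map (stalk_at m P) (stalk_at m Q).
Proof.
exists (fun i => sel_out (i == m) Q ∘ f ∘ sel_in (i == m) P) => i j.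
by rewrite comp0m compm0.
Defined.

Lemma stalk_map_comp m P Q T (g : hom Q T) (f : hom P Q) :
  @comp (kb_cat A) _ _ _ (kb_class (stalk_map m g)) (kb_class (stalk_map m f))
  = kb_class (stalk_map m (g ∘ f)).
Proof.
rewrite kb_compC; congr kb_class; apply: chain_mapP => i /=.
by case: (i == m); rewrite /= ?comp1m ?compm1 // !comp0m.
Qed.

Lemma stalk_map_id m P :
  kb_class (stalk_map m (idm P)) = @idm (kb_cat A) (stalk_at m P).
Proof. by congr kb_class; apply: chain_mapP => i /=; rewrite compm1 sel_outin. Qed.

Lemma stalk_mapD m P Q (f g : hom P Q) :
  kb_class (stalk_map m (f + g)) = kb_class (stalk_map m f) + kb_class (stalk_map m g).
Proof.
by rewrite -kb_classD; congr kb_class; apply: chain_mapP => i /=; rewrite compDr compDl.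
Qed.

Definition stalk_functor m : functor A (kb_cat A) :=
  @Functor A (kb_cat A) (stalk_at m) (fun P Q f => kb_class (stalk_map m f))
    (stalk_map_id m) (fun _ _ _ g f => esym (stalk_map_comp m g f))
    (fun P Q f g => stalk_mapD m f g).

Lemma shift_stalk m P : @isomorphic (kb_cat A) (cx_shift 1 (stalk_at m P)) (stalk_at (m - 1) P).
Proof.
have := @conc_stalk (m - 1) (cx_shift 1 (stalk_at m P)); rewrite /= subrK eqxx; apply.
by move=> i /= ni; apply: sel_zero; lia.
Qed.

Lemma unshift_stalk m P :
  @isomorphic (kb_cat A) (cx_shift (-1) (stalk_at m P)) (stalk_at (m + 1) P).
Proof.
have := @conc_stalk (m + 1) (cx_shift (-1) (stalk_at m P)); rewrite /= addrK eqxx; apply.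
by move=> i /= ni; apply: sel_zero; lia.
Qed.

Lemma shiftz_stalk n m P :
  @isomorphic (Kb A) (@shiftz (Kb A) (stalk_at m P) n) (stalk_at (m - n) P).
Proof.
elim/int_step: n => [|n IH|n IH]; first by rewrite subr0; apply: iso_refl.
  apply: iso_trans (shiftzS HK _ _) _; rewrite opprD addrA.
  exact: iso_trans (fob_iso (@shift (Kb A)) IH) (shift_stalk _ _).
apply: iso_trans (shiftzP HK _ _) _; rewrite opprB addrCA addrC.
exact: iso_trans (fob_iso (@unshift (Kb A)) IH) (unshift_stalk _ _).
Qed.

Lemma stalk_stalk P : @isomorphic (kb_cat A) (stalk P O0) (stalk_at 0 P).
Proof.
apply: conc_stalk => i /= /negPf ->; exact: O0.
Qed.

Lemma shiftz_stalk0 P i :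
  @isomorphic (Kb A) (@shiftz (Kb A) (stalk P O0) (- i)) (stalk_at i P).
Proof.
apply: iso_trans (@shiftz_iso (Kb A) (- i) _ _ (stalk_stalk P)) _.
by have := shiftz_stalk (- i) 0 P; rewrite sub0r opprK.
Qed.

(** The identity of Y is homotopic to a map that vanishes in all degrees below
    m. *)
Definition contracts_below (m : int) Y : Prop :=
  exists s : forall i j, hom (Y i) (Y j), forall h i j, i = h + 1 -> j = i + 1 -> i < m ->
    idm (Y i) = cd Y h i ∘ s i h + s j i ∘ cd Y i j.

Lemma trunc_out_null m Y (down : forall i, i + 1 < m -> i < m) :
  contracts_below m Y <-> null_homotopic (@trunc_out (fun i => i < m) Y down).
Proof.
split=> [[s sP]|[t tP]].
  exists (fun i j => sel_out (j < m) (Y j) ∘ s i j) => h i j ih ij /=.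
  have [im|im] := boolP (i < m); last first.
    by apply: hom_eq_to_zero; apply: sel_zero.
  have hm : h < m by lia.
  rewrite -[LHS]compm1 (sP h i j) // compDr !compA; congr (_ + _).
  by rewrite -(compA _ (sel_in _ _)) sel_inoutT // compm1.
exists (fun i j => sel_in (j < m) (Y j) ∘ t i j) => h i j ih ij im.
have hm : h < m by lia.
have := congr1 (fun f => sel_in (i < m) (Y i) ∘ f) (tP h i j ih ij).
by rewrite /= compDr !compA !sel_inoutT // comp1m.
Qed.


(** Let B be the brutal truncation of Y to degrees below m. An object built from
    P in degrees at least m has no nonzero map to B, for reasons of degree, so Y
    -> B is null-homotopic. Conversely, if Y -> B is null-homotopic, then Y is a
    retract of its truncation to degrees at least m, an iterated extension of
    stalks. *)
Lemma gen_contracts P m Y :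
  (forall i Q, m <= i -> @sgen (Kb A) (stalk P O0) (fun i => m <= i) (stalk_at i Q)) ->
  @sgen (Kb A) (stalk P O0) (fun i => m <= i) Y <-> contracts_below m Y.
Proof.
move=> Pgen; have [up [down [h D]]] := trunc_triangle_ex m Y.
rewrite (@trunc_out_null m Y down) -kb_class_eq0; split=> [GY|q0]; last first.
  apply: (ec_retract (gen_closed HK _) (dist_second0 HK D q0)).
  apply: (conc_closed (gen_closed HK _) (p := fun i => m <= i)) => // i mi.
  by apply: sel_zero => mi'; rewrite mi' in mi.
apply: (sgen_hom_zero HK GY) => i mi.
apply: (iso_hom_zero (shiftz_stalk0 P i) (iso_refl _)).
apply: kb_hom_zero => j; have [ij|ij] := eqVneq j i; [right | left].
  by apply: sel_zero; rewrite ij ltNge mi.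
by apply: sel_zero => e; rewrite e in ij.
Qed.

End Truncation.

(** * Modules and projective resolutions *)

Definition mk_linear (R : pzRingType) (U V : lmodType R) (f : U -> V)
    (f_lin : linear f) : {linear U -> V} :=
  HB.pack f (GRing.isLinear.Build R U V _ f f_lin).

Section Quotient.
Variables (R : pzRingType) (U : lmodType R) (K : zmodClosed U).
Hypothesis KZ : forall (a : R) x, x \in K -> a *: x \in K.

Definition lmod_quot := Quotient.quot K.
HB.instance Definition _ := GRing.Zmodule.on lmod_quot.

Definition quot_pi (x : U) : lmod_quot := (\pi_(Quotient.quot K) x)%qT.

Lemma quot_piD x y : quot_pi (x + y) = quot_pi x + quot_pi y.
Proof. by rewrite /quot_pi !piE. Qed.

Lemma quot_piP x y : quot_pi x = quot_pi y <-> x - y \in K.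
Proof. by rewrite Quotient.idealrBE; split=> [e|/eqP//]; apply/eqP. Qed.

Definition quot_repr (q : lmod_quot) : U := repr q.

Lemma quot_reprK q : quot_pi (quot_repr q) = q.
Proof. exact: reprK. Qed.

Definition quot_scale (a : R) (q : lmod_quot) : lmod_quot := quot_pi (a *: quot_repr q).

Lemma quot_scaleE a x : quot_scale a (quot_pi x) = quot_pi (a *: x).
Proof.
apply/quot_piP; rewrite -scalerBr; apply: KZ; apply/quot_piP.
by rewrite quot_reprK.
Qed.

Lemma quot_scaleA a b q : quot_scale a (quot_scale b q) = quot_scale (a * b) q.
Proof. by rewrite -[q]quot_reprK !quot_scaleE scalerA. Qed.

Lemma quot_scale1 : left_id 1 quot_scale.
Proof. by move=> q; rewrite -[q]quot_reprK quot_scaleE scale1r. Qed.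

Lemma quot_scaleDr : right_distributive quot_scale +%R.
Proof.
move=> a q q'; rewrite -[q]quot_reprK -[q']quot_reprK -quot_piD !quot_scaleE.
by rewrite scalerDr quot_piD.
Qed.

Lemma quot_scaleDl q : {morph quot_scale^~ q : a b / a + b}.
Proof. by move=> a b; rewrite -[q]quot_reprK !quot_scaleE scalerDl quot_piD. Qed.

Definition quot_lmod : lmodType R :=
  HB.pack lmod_quot (GRing.Zmodule_isLmodule.Build R lmod_quot
    quot_scaleA quot_scale1 quot_scaleDr quot_scaleDl).

Lemma quot_pi_linear : linear (quot_pi : U -> quot_lmod).
Proof. by move=> a x y; rewrite quot_piD -quot_scaleE. Qed.

End Quotient.

Section Modules.
Variable R : pzRingType.
Implicit Types U V W M N P Q : lmodType R.

Lemma quotient_exists V (K : V -> Prop) :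
  K 0 -> (forall (a : R) x y, K x -> K y -> K (a *: x + y)) ->
  exists (Q : lmodType R) (p : {linear V -> Q}),
    surjective p /\ forall x, p x = 0 <-> K x.
Proof.
move=> K0 KP; pose Kb : {pred V} := fun x => `[< K x >].
have K_closed : zmod_closed Kb.
  split=> [|x y /asboolP Kx /asboolP Ky]; apply/asboolP => //.
  by rewrite addrC -scaleN1r; apply: KP.
pose Kc : zmodClosed V := HB.pack Kb (GRing.isZmodClosed.Build V Kb K_closed).
have KZ (a : R) x : x \in Kc -> a *: x \in Kc.
  by move=> /asboolP Kx; apply/asboolP; rewrite -[_ *: _]addr0; apply: KP.
exists (quot_lmod KZ), (mk_linear (quot_pi_linear KZ)); split=> [q|x].
  by exists (quot_repr q); apply: quot_reprK.
have pi0 : quot_pi Kc 0 = 0 by apply: (addrI (quot_pi Kc 0)); rewrite -quot_piD !addr0.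
split=> [e|Kx].
  have : quot_pi Kc x = quot_pi Kc 0 by rewrite pi0; exact: e.
  by move/quot_piP; rewrite subr0 => /asboolP.
by apply: etrans pi0; apply/quot_piP; rewrite subr0; apply/asboolP.
Qed.

Lemma coker_exists U V (f : {linear U -> V}) :
  exists (Q : lmodType R) (p : {linear V -> Q}),
    surjective p /\ forall x, p x = 0 <-> exists y, f y = x.
Proof.
apply: quotient_exists; first by exists 0; rewrite linear0.
by move=> a x y [x' <-] [y' <-]; exists (a *: x' + y'); rewrite linearP.
Qed.

Lemma linear_descent U V W (e : {linear U -> V}) (h : {linear U -> W}) :
  surjective e -> (forall x, e x = 0 -> h x = 0) ->
  exists k : {linear V -> W}, forall x, k (e x) = h x.
Proof.
move=> e_surj eh; pose r y := sval (cid (e_surj y)).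
have rK y : e (r y) = y by rewrite /r; case: cid.
have he x x' : e x = e x' -> h x = h x'.
  move=> exx'; apply/eqP; rewrite -subr_eq0 -linearB; apply/eqP/eh.
  by rewrite linearB exx' subrr.
have k_lin : linear (fun y => h (r y)).
  by move=> a x y; rewrite -linearP; apply: he; rewrite linearP !rK.
by exists (mk_linear k_lin) => x; apply: he; rewrite rK.
Qed.

(** The map g is not surjective in general. One first maps P to U / ker g, where
    the preimage of f x is unique and therefore linear in x, and then lifts
    along the surjection from U. *)
Lemma projective_lift P U V (g : {linear U -> V}) (f : {linear P -> V}) :
  projective P -> (forall x, exists y, g y = f x) ->
  exists h : {linear P -> U}, forall x, g (h x) = f x.
Proof.
move=> Pproj gf.
have [Q [p [p_surj pK]]] : exists (Q : lmodType R) (p : {linear U -> Q}),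
    surjective p /\ forall x, p x = 0 <-> g x = 0.
  apply: quotient_exists; first exact: linear0.
  by move=> a x y gx gy; rewrite linearP gx gy scaler0 addr0.
pose r x := sval (cid (gf x)).
have rK x : g (r x) = f x by rewrite /r; case: cid.
have f'_lin : linear (fun x => p (r x)).
  move=> a x y; apply/eqP; rewrite -subr_eq0 -linearP -linearB; apply/eqP/pK.
  by rewrite linearB linearP !rK linearP subrr.
have [h hP] := Pproj U Q p (mk_linear f'_lin) p_surj; exists h => x.
have /eqP := hP x; rewrite /= -subr_eq0 -linearB => /eqP/pK/eqP.
by rewrite linearB subr_eq0 rK => /eqP.
Qed.

Definition resolves (P : nat -> lmodType R) (d : forall i, {linear P i.+1 -> P i})
    M (e : {linear P 0%N -> M}) : Prop :=
  [/\ surjective e, forall x, e x = 0 <-> exists y, d 0%N y = x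
    & forall i x, d i x = 0 <-> exists y, d i.+1 y = x].

(** A total function, so that lifts can be iterated by recursion on the degree
    before their properties are known. *)
Definition lift_along P U V (g : {linear U -> V}) (f : {linear P -> V}) : {linear P -> U} :=
  if pselect (exists h : {linear P -> U}, forall x, g (h x) = f x) is left ex
  then sval (cid ex) else 0.

Lemma lift_alongP P U V (g : {linear U -> V}) (f : {linear P -> V}) :
  projective P -> (forall x, exists y, g y = f x) ->
  forall x, g (lift_along g f x) = f x.
Proof.
move=> Pproj gf; rewrite /lift_along; case: pselect => [ex|[]].
  by case: cid.
exact: projective_lift.
Qed.

(* The comparison theorem: chain_lift is a chain map over the identity of M,
   and null_homotopy contracts every chain map c over the zero map. *)
Section Comparison.
Variables (M : lmodType R) (P Q : nat -> lmodType R).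
Variables (dP : forall i, {linear P i.+1 -> P i}) (eP : {linear P 0%N -> M}).
Variables (dQ : forall i, {linear Q i.+1 -> Q i}) (eQ : {linear Q 0%N -> M}).
Hypotheses (Pproj : forall i, projective (P i)) (resP : resolves dP eP) (resQ : resolves dQ eQ).

Fixpoint chain_lift i : {linear P i -> Q i} :=
  match i with
  | 0%N => lift_along eQ eP
  | j.+1 => lift_along (dQ j) (lin_comp (chain_lift j) (dP j))
  end.

Lemma chain_lift0 x : eQ (chain_lift 0%N x) = eP x.
Proof. by apply: lift_alongP => // y; case: resQ. Qed.

Lemma chain_liftS i x : dQ i (chain_lift i.+1 x) = chain_lift i (dP i x).
Proof.
have [_ P0 PS] := resP; have [_ Q0 QS] := resQ.
have PP k y : dP k (dP k.+1 y) = 0 by apply/PS; exists y.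
elim: i x => [|i IH] x; apply: (lift_alongP (f := lin_comp _ _)) => // y /=.
  by apply/Q0; rewrite chain_lift0; apply/P0; exists y.
by apply/QS; rewrite IH PP linear0.
Qed.

Variable c : forall i, {linear P i -> Q i}.
Hypotheses (c0 : forall x, eQ (c 0%N x) = 0)
  (cS : forall i x, dQ i (c i.+1 x) = c i (dP i x)).

Fixpoint null_homotopy i : {linear P i -> Q i.+1} :=
  match i with
  | 0%N => lift_along (dQ 0%N) (c 0%N)
  | j.+1 => lift_along (dQ j.+1) (c j.+1 - lin_comp (null_homotopy j) (dP j))
  end.

Lemma null_homotopy0 x : dQ 0%N (null_homotopy 0%N x) = c 0%N x.
Proof.
have [_ Q0 QS] := resQ.
by apply: lift_alongP => // y; apply/Q0.
Qed.

Lemma null_homotopyS i x :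
  c i.+1 x = dQ i.+1 (null_homotopy i.+1 x) + null_homotopy i (dP i x).
Proof.
have [_ P0 PS] := resP; have [_ Q0 QS] := resQ.
have PP k y : dP k (dP k.+1 y) = 0 by apply/PS; exists y.
suff e : dQ i.+1 (null_homotopy i.+1 x) = c i.+1 x - null_homotopy i (dP i x).
  by rewrite e subrK.
elim: i x => [|i IH] x; apply: (lift_alongP (f := _ - lin_comp _ _)) => // y /=.
  by apply/QS; rewrite linearB cS null_homotopy0 subrr.
by apply/QS; rewrite linearB cS IH PP linear0 subr0 subrr.
Qed.

End Comparison.

(** Let Q be a projective resolution of M of length n. The composite P -> Q -> P
    of two comparison maps is homotopic to the identity and vanishes in degrees
    above n. *)
Lemma resolution_splits n M (P : nat -> lmodType R)
    (d : forall i, {linear P i.+1 -> P i}) (e : {linear P 0%N -> M}) :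
  has_resolution (@projective R) n M -> (forall i, projective (P i)) -> resolves d e ->
  exists s : forall i, {linear P i -> P i.+1},
    forall i, (n <= i)%N -> forall x, x = d i.+1 (s i.+1 x) + s i (d i x).
Proof.
move=> [Q [dQ [eQ [Qproj Q0 eQs eQk dQk]]]] Pproj resP.
have resQ : resolves dQ eQ by [].
pose a := chain_lift d e dQ eQ; pose b := chain_lift dQ eQ d e.
pose c i : {linear P i -> P i} := lin_id (P i) - lin_comp (b i) (a i).
have a0 x : eQ (a 0%N x) = e x by apply: chain_lift0.
have aS i x : dQ i (a i.+1 x) = a i (d i x) by apply: chain_liftS.
have b0 x : e (b 0%N x) = eQ x by apply: chain_lift0.
have bS i x : d i (b i.+1 x) = b i (dQ i x) by apply: chain_liftS.
have c0 x : e (c 0%N x) = 0 by rewrite [c _ _]/= linearB b0 a0 subrr.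
have cS i x : d i (c i.+1 x) = c i (d i x) by rewrite [c _ _]/= linearB bS aS.
exists (null_homotopy d d c) => i ni x.
rewrite -(null_homotopyS Pproj resP resP c0 cS).
by rewrite [c _ _]/= (Q0 i.+1 ni (a i.+1 x)) linear0 subr0.
Qed.

Lemma has_resolution0 (C : lmodType R -> Prop) M : C M -> C 'rV[R]_0 -> has_resolution C 0 M.
Proof.
move=> CM C0.
pose P i : lmodType R := if i is 0%N then M else 'rV[R]_0.
have z (x : 'rV[R]_0) : x = 0 by rewrite [x]thinmx0.
exists P, (fun i => lin_zero (P i.+1) (P i)), (lin_id M); split.
- by case.
- by case.
- by move=> y; exists y.
- move=> x; split=> [e|[y <-] //]; by exists 0.
- by move=> i x; split=> // _; exists 0; rewrite [RHS]z.
Qed.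

Lemma has_resolutionS (C : lmodType R -> Prop) n M (K : lmodType R) P (k : {linear K -> P})
    (e : {linear P -> M}) :
  C P -> has_resolution C n K -> surjective e -> (forall x, k x = 0 -> x = 0) ->
  (forall x, e x = 0 <-> exists y, k y = x) -> has_resolution C n.+1 M.
Proof.
move=> CP [Q [d [eQ [CQ Q0 eQs eQk dk]]]] es k_inj ek.
pose P' i : lmodType R := if i is j.+1 then Q j else P.
pose d' i : {linear P' i.+1 -> P' i} :=
  match i with 0%N => lin_comp k eQ | j.+1 => d j end.
exists P', d', e; split=> //.
- by case.
- by case.
- move=> x; rewrite ek; split=> -[y <-]; last by exists (eQ y).
  by have [z <-] := eQs y; exists z.
- case=> [x|i x]; last exact: dk.
  split=> [/k_inj/eQk //|/eQk xe]; by rewrite /= xe linear0.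
Qed.

(** The splitting makes the cokernel of P_(n+1) -> P_n projective. The induction
    on n passes from M to its first syzygy, which is the cokernel of P_2 -> P_1
    and keeps the splitting. *)
Lemma truncate_resolution n M (P : nat -> lmodType R)
    (d : forall i, {linear P i.+1 -> P i}) (e : {linear P 0%N -> M}) :
  (forall i, projective (P i)) -> resolves d e ->
  (exists (s : {linear P n.+1 -> P n.+2}) (t : {linear P n -> P n.+1}),
     forall x, x = d n.+1 (s x) + t (d n x)) ->
  has_resolution (@projective R) n M.
Proof.
elim: n => [|n IH] in M P d e *; move=> Pproj [es ek dk] [s [t st]].
  apply: has_resolution0; last by case: (fg_projective_zero R).
  move=> U V g f g_surj.
  have [h hP] := Pproj 0%N U V g (lin_comp f e) g_surj.
  pose q : {linear P 0%N -> P 0%N} := lin_id _ - lin_comp (d 0%N) t.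
  have dd x : d 0%N (d 1%N x) = 0 by apply/dk; exists x.
  have [|k kP] := @linear_descent _ _ U e (lin_comp h q) es.
    move=> x /ek[y <-] /=; rewrite -linearB [X in h (_ X)](_ : _ = d 1%N (s y)).
      by rewrite dd linear0.
    by apply/eqP; rewrite subr_eq; apply/eqP; exact: st.
  exists k => x; have [y <-] := es x; rewrite kP /= hP /= linearB.
  by rewrite (_ : e (d 0%N _) = 0) ?subr0 //; apply/ek; exists (t y).
have [K [p [ps pk]]] := coker_exists (d 1%N).
have [|k kP] := @linear_descent _ _ _ p (d 0%N) ps.
  by move=> x /pk/dk.
apply: (@has_resolutionS _ n M K (P 0%N) k e) => //.
- apply: (IH K (fun i => P i.+1) (fun i => d i.+1) p) => //.
  by exists s, t.
- by move=> x; have [y <-] := ps x; rewrite kP => /dk/pk.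
- move=> x; rewrite ek; split=> -[y <-]; first by exists (p y).
  by have [z <-] := ps y; exists z.
Qed.

End Modules.

(** * Complexes of finitely generated projective modules *)

Section FGProjective.
Variable R : pzRingType.
Implicit Types U V : lmodType R.

Lemma fg_projective_pair U V : fg_projective U -> fg_projective V ->
  fg_projective (U * V)%type.
Proof.
move=> [[n [v vP]] Uproj] [[m [w wP]] Vproj]; split.
  exists (n + m)%N, (fun k => match split k with inl j => (v j, 0) | inr j => (0, w j) end).
  move=> [x y]; have [a xa] := vP x; have [b yb] := wP y.
  exists (fun k => match split k with inl j => a j | inr j => b j end).
  rewrite big_split_ord /=.
  under eq_bigr => i _ do rewrite (unsplitK (inl i)).
  under [X in _ + X]eq_bigr => i _ do rewrite (unsplitK (inr i)).
  rewrite [LHS](_ : _ = (x, 0) + (0, y)); last by congr pair; rewrite /= ?addr0 ?add0r.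
  congr (_ + _).
    rewrite xa; elim/big_rec2: _ => [//|i z1 z2 _ <-].
    by congr pair; rewrite /= scaler0 addr0.
  rewrite yb; elim/big_rec2: _ => [//|i z1 z2 _ <-].
  by congr pair; rewrite /= scaler0 addr0.
move=> T W g f gs.
have f1_lin : linear (fun x : U => f (x, 0)).
  by move=> a x y; rewrite -linearP; congr (f (_, _)); rewrite /= scaler0 addr0.
have f2_lin : linear (fun x : V => f (0, x)).
  by move=> a x y; rewrite -linearP; congr (f (_, _)); rewrite /= scaler0 addr0.
have [h1 h1P] := Uproj T W g (mk_linear f1_lin) gs.
have [h2 h2P] := Vproj T W g (mk_linear f2_lin) gs.
have h_lin : linear (fun x : (U * V)%type => h1 x.1 + h2 x.2).
  move=> a [x1 x2] [y1 y2] /=; rewrite !linearP scalerDr !addrA; congr (_ + _).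
  by rewrite -!addrA; congr (_ + _); rewrite addrC.
exists (mk_linear h_lin) => -[x y] /=; rewrite linearD h1P h2P /= -linearD.
by congr (f (_, _)); rewrite /= ?addr0 ?add0r.
Qed.

Lemma fg_projective_rV n : fg_projective 'rV[R]_n.
Proof.
split.
  exists n, (fun k => delta_mx 0 k) => x; exists (fun k => x 0 k).
  exact: row_sum_delta.
move=> U V g f gs; pose u k := sval (cid (gs (f (delta_mx 0 k)))).
have uP k : g (u k) = f (delta_mx 0 k) by rewrite /u; case: cid.
have h_lin : linear (fun x : 'rV[R]_n => \sum_k x 0 k *: u k).
  move=> a x y; rewrite scaler_sumr -big_split; apply: eq_bigr => k _ /=.
  by rewrite !mxE scalerDl scalerA.
exists (mk_linear h_lin) => x /=; rewrite [in RHS](row_sum_delta x) !linear_sum.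
by apply: eq_bigr => k _; rewrite !linearZ /= uP.
Qed.

Definition fgproj_free n : fgproj_cat R := exist _ _ (fg_projective_rV n).

Lemma fgproj_biproducts : has_biproducts (fgproj_cat R).
Proof.
move=> [U HU] [V HV].
have i1_lin : linear (fun x : U => (x, 0 : V)).
  by move=> a x y; congr pair; rewrite /= scaler0 addr0.
have i2_lin : linear (fun x : V => (0 : U, x)).
  by move=> a x y; congr pair; rewrite /= scaler0 addr0.
have p1_lin : linear (fun x : (U * V)%type => x.1) by [].
have p2_lin : linear (fun x : (U * V)%type => x.2) by [].
exists (exist _ _ (fg_projective_pair HU HV)).
exists (mk_linear i1_lin), (mk_linear i2_lin), (mk_linear p1_lin), (mk_linear p2_lin).
split; apply: linear_mapP => //.
by move=> [x y]; congr pair; rewrite /= ?addr0 ?add0r.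
Qed.

Definition lin (X Y : fgproj_cat R) (f : hom X Y) : {linear sval X -> sval Y} := f.

Lemma hom_sumE (X Y : fgproj_cat R) (I : Type) (r : seq I) (F : I -> hom X Y) x :
  lin (\sum_(k <- r) F k) x = \sum_(k <- r) lin (F k) x.
Proof. by elim: r => [|k r IH]; rewrite ?big_nil // !big_cons -IH. Qed.

Lemma fgproj_dsum n : is_dsum (fun _ : 'I_n => fgproj_regular R) (fgproj_free n).
Proof.
have i_lin k : linear (fun a : R^o => a *: (delta_mx 0 k : 'rV[R]_n)).
  by move=> a x y; rewrite scalerDl scalerA.
have p_lin k : linear (fun x : 'rV[R]_n => x 0 k : R^o).
  by move=> a x y; rewrite !mxE.
pose iR k : @hom (fgproj_cat R) (fgproj_regular R) (fgproj_free n) := mk_linear (i_lin k).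
pose pR k : @hom (fgproj_cat R) (fgproj_free n) (fgproj_regular R) := mk_linear (p_lin k).
exists iR, pR; split.
- by move=> k; apply: linear_mapP => x /=; rewrite !mxE !eqxx mulr1.
- by move=> j k jk; apply: linear_mapP => x /=; rewrite !mxE (negPf jk) andbF mulr0.
- apply: linear_mapP => x; rewrite /= [RHS](row_sum_delta x).
  exact: (@hom_sumE (fgproj_free n) (fgproj_free n)).
Qed.

Lemma fgproj_retract_free (P : fgproj_cat R) : exists n, retract P (fgproj_free n).
Proof.
case: P => P HP; have [[n [v vP]] Pproj] := HP; exists n.
have h_lin : linear (fun x : 'rV[R]_n => \sum_k x 0 k *: v k).
  move=> a x y; rewrite scaler_sumr -big_split; apply: eq_bigr => k _ /=.
  by rewrite !mxE scalerDl scalerA.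
have [|i iP] := Pproj _ _ (mk_linear h_lin) (lin_id P).
  move=> x; have [a ->] := vP x; exists (\row_k a k) => /=.
  by apply: eq_bigr => k _; rewrite mxE.
by exists i, (mk_linear h_lin); apply: linear_mapP => x; exact: iP.
Qed.

Let HK := kb_pretriangulated (fgproj_zeroP R) fgproj_biproducts.

(** A finitely generated projective module is a retract of a finite power of R. *)
Lemma stalk_generated (p : int -> Prop) i Q : p i ->
  @sgen (Kb_proj R) (Kb_regular R) p (stalk_at (fgproj_zeroP R) i Q).
Proof.
move=> pi; have [n QF] := fgproj_retract_free Q.
pose F := stalk_functor (fgproj_zeroP R) i.
apply: (ec_retract (gen_closed HK _) (@retract_fob _ _ F _ _ QF)).
apply: (ec_dsum HK (gen_closed HK _) _ (fob_dsum F (fgproj_dsum n))) => k.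
apply: (ec_iso (gen_closed HK _)
  (shiftz_stalk0 (fgproj_zeroP R) fgproj_biproducts (fgproj_regular R) i)).
exact: (sgen_base HK).
Qed.

Lemma regular_generates (Y : Kb_proj R) : sgen (Kb_regular R) (fun=> True) Y.
Proof.
apply: (conc_closed (O0 := fgproj_zeroP R) fgproj_biproducts (gen_closed HK _)
  (p := predT) _ (Y := Y)) => //.
by move=> i P _; apply: stalk_generated.
Qed.

Lemma sgen_contracts m (Y : Kb_proj R) :
  sgen (Kb_regular R) (fun i => m <= i) Y <-> contracts_below m (Y : complex _).
Proof.
apply: (gen_contracts fgproj_biproducts) => i Q mi.
exact: stalk_generated.
Qed.

End FGProjective.

Section StalkHom.
Variables (A : preadditive) (O : A) (O0 : is_zero O).

(** Homotopy classes of maps from P in degree h + 1 to Y are the cohomology of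
    Hom(P, Y) in that degree. *)
Lemma stalk_hom_zero (h : int) (P : A) (Y : complex A) :
  @hom_zero (kb_cat A) (stalk_at O0 (h + 1) P) Y <->
  (forall f : hom P (Y (h + 1)), cd Y (h + 1) (h + 1 + 1) ∘ f = 0 ->
     exists t : hom P (Y h), f = cd Y h (h + 1) ∘ t).
Proof.
set m := h + 1; split=> [z f df|lift g].
  pose g i : hom (stalk_at O0 m P i) (Y i) := cast Y m i ∘ f ∘ sel_in O (i == m) P.
  have gP i : cd Y i (i + 1) ∘ g i = g (i + 1) ∘ cd (stalk_at O0 m P) i (i + 1).
    rewrite compm0 /g; have [->|im] : i = m \/ i != m by case: (eqVneq i m) => ?; [left | right].
      by rewrite cast_id comp1m compA df comp0m.
    by rewrite cast_neq 1?eq_sym // !comp0m compm0.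
  have /kb_class_eq0[s sP] := z (kb_class (@ChainMap A _ Y g (cd_next gP))).
  exists (s m h ∘ sel_out O (m == m) P).
  have := congr1 (fun k => k ∘ sel_out O (m == m) P) (sP h m (m + 1) erefl erefl).
  by rewrite /= /g cast_id comp1m -compA sel_inoutT ?eqxx // compm1 compm0 addr0 compA.
have [g0 ->] := kb_surj g; apply/kb_class_eq0.
have [|t tP] := lift (g0 m ∘ sel_out O (m == m) P).
  by rewrite compA cm_comm compm0 comp0m.
exists (fun i j => cast Y h j ∘ t ∘ sel_in O (i == m) P) => h' i j ih ij.
rewrite compm0 addr0.
have [im|im] : i = m \/ i != m by case: (eqVneq i m) => ?; [left | right].
  subst i; have hh : h' = h by move: im; rewrite /m => /addIr.
  subst h'; rewrite cast_id comp1m compA -tP -compA.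
  change (g0 m = g0 m ∘ (sel_out O (m == m) P ∘ sel_in O (m == m) P)).
  by rewrite (sel_outin O0) compm1.
by apply: zero_hom_eq; apply: stalk_at_conc.
Qed.

End StalkHom.

(** * The finitistic dimension of a ring *)

Section Final.
Variable R : pzRingType.

Let HK := kb_pretriangulated (fgproj_zeroP R) (@fgproj_biproducts R).

(** R is free on 1, so a map out of it is an element of its target. *)
Definition at1 (Y : fgproj_cat R) (f : hom (fgproj_regular R) Y) : sval Y :=
  lin f (1 : R^o).

Lemma at1_surj (Y : fgproj_cat R) (x : sval Y) : exists f, at1 f = x.
Proof.
have f_lin : linear (fun a : R^o => (a : R) *: x).
  by move=> a b c; rewrite scalerDl scalerA.
by exists (mk_linear f_lin : hom (fgproj_regular R) Y); apply: scale1r.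
Qed.

Lemma at1_inj (Y : fgproj_cat R) (f g : hom (fgproj_regular R) Y) : at1 f = at1 g -> f = g.
Proof.
move=> fg; apply: linear_mapP => a.
have -> : a = a *: (1 : R^o) by rewrite /GRing.scale /= mulr1.
by rewrite !linearZ_LR; congr (_ *: _).
Qed.

Lemma at1_comp (Y Z : fgproj_cat R) (g : hom Y Z) (f : hom (fgproj_regular R) Y) :
  at1 (g ∘ f) = lin g (at1 f).
Proof. by []. Qed.

(** Hom(R[k], Y) is the cohomology of Y in degree -k. *)
Lemma nonneg_regular (Y : Kb_proj R) : nonneg_for (Kb_regular R) Y <->
  forall h i j : int, i = h + 1 -> j = i + 1 -> i < 0 ->
    forall x, lin (cd (Y : complex _) i j) x = 0 ->
      exists y, lin (cd (Y : complex _) h i) y = x.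
Proof.
split=> [HY h i j -> -> hi x dx|HY k k1].
  have z : @hom_zero (Kb_proj R) (stalk_at (fgproj_zeroP R) (h + 1) (fgproj_regular R)) Y.
    apply: (iso_hom_zero _ (iso_refl _) (HY (- (h + 1)) _)); last by lia.
    exact/iso_sym/(shiftz_stalk0 (fgproj_zeroP R) (@fgproj_biproducts R)).
  move/stalk_hom_zero: z => lift.
  have [f fx] := at1_surj x.
  have [|t tP] := lift f; first by apply: at1_inj; rewrite at1_comp fx dx.
  by exists (at1 t); rewrite -at1_comp -tP.
have e : k = - ((- k - 1) + 1) by lia.
rewrite e; apply: (iso_hom_zero _ (iso_refl _)).
  exact: (shiftz_stalk0 (fgproj_zeroP R) (@fgproj_biproducts R)).
apply/stalk_hom_zero => f df.
have [||y yP] := HY (- k - 1) _ _ erefl erefl _ (at1 f); first by lia.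
  by rewrite -at1_comp df.
have [t ty] := at1_surj y; exists t; apply: at1_inj.
by rewrite at1_comp ty yP.
Qed.

(** In nonpositive degrees Y is a finite resolution of the cokernel M of its
    last differential; it splits beyond n by resolution_splits. *)
Lemma nonneg_contracts n (Y : Kb_proj R) :
  (forall M : lmodType R, (exists N, has_resolution (@fg_projective R) N M) ->
     has_resolution (@projective R) n M) ->
  nonneg_for (Kb_regular R) Y -> contracts_below (- n%:Z) (Y : complex _).
Proof.
move=> pdn /nonneg_regular HY; change (complex (fgproj_cat R)) in Y.
pose P k : lmodType R := sval (Y (- k%:Z)).
pose d k : {linear P k.+1 -> P k} := lin (cd Y (- k.+1%:Z) (- k%:Z)).
have Pfg k : fg_projective (P k) by exact: svalP (Y (- k%:Z)).
have [M [e [es ek]]] := coker_exists (d 0%N).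
have dk i x : d i x = 0 <-> exists y, d i.+1 y = x.
  split=> [dx|[y <-]].
    by apply: (HY (- i.+2%:Z) (- i.+1%:Z) (- i%:Z)) => //; lia.
  have := congr1 (fun f => lin f y) (cd_sq Y (- i.+2%:Z) (- i.+1%:Z) (- i%:Z)).
  by [].
have resP : resolves d e by [].
have MP : has_resolution (@projective R) n M.
  apply: pdn; have [a [b abP]] := cx_bounded Y; exists (absz a).
  exists P, d, e; split=> // i ai x.
  have zi : is_zero (Y (- i%:Z)) by apply: abP; lia.
  exact: (congr1 (fun f => lin f x) zi).
have [s sP] := resolution_splits MP (fun k => (Pfg k).2) resP.
pose s0 k : hom (Y (- k%:Z)) (Y (- k.+1%:Z)) := s k.
(* s k is a map out of Y (- k); the casts extend the family to all pairs of
   degrees. *)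
pose s' i j : hom (Y i) (Y j) :=
  cast Y (- (absz i).+1%:Z) j ∘ s0 (absz i) ∘ cast Y i (- (absz i)%:Z).
have s'E k : s' (- k%:Z) (- k.+1%:Z) = s0 k.
  have ek' : absz (- k%:Z) = k by lia.
  rewrite /s'; move: ek'; move: (absz (- k%:Z)) => k' ->.
  by rewrite !cast_id comp1m compm1.
exists s' => h i j ih ij im.
pose k := (absz i).-1.
have ei : i = - k.+1%:Z by rewrite /k; lia.
have eh : h = - k.+2%:Z by lia.
have ej : j = - k%:Z by lia.
have nk : (n <= k)%N by lia.
clearbody k; clear ih ij im; subst h i j; rewrite !s'E; apply: linear_mapP => x.
exact: (sP k nk x).
Qed.

Section ResolutionComplex.
Variables (P : nat -> lmodType R) (d : forall i, {linear P i.+1 -> P i}).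
Hypotheses (Pfg : forall i, fg_projective (P i)) (dd : forall i x, d i (d i.+1 x) = 0).
Variable N : nat.
Hypothesis PN : forall i, (N < i)%N -> forall x : P i, x = 0.

Definition res_ob (i : int) : fgproj_cat R :=
  match i with
  | Posz 0 => exist _ (P 0%N) (Pfg 0%N)
  | Posz _ => fgproj_zero R
  | Negz k => exist _ (P k.+1) (Pfg k.+1)
  end.

(** A form of i + 1 that computes on the constructors of int, so that the
    differential d k has its source and target on the nose. *)
Definition res_next (i : int) : int :=
  match i with
  | Posz k => Posz k.+1
  | Negz 0 => Posz 0
  | Negz k.+1 => Negz k
  end.

Lemma res_nextE i : res_next i = i + 1.
Proof. by case: i => [k|[|k]] //=; lia. Qed.

Definition res_d (i : int) : hom (res_ob i) (res_ob (res_next i)) :=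
  match i return hom (res_ob i) (res_ob (res_next i)) with
  | Posz _ => 0
  | Negz 0 => d 0%N
  | Negz k.+1 => d k.+1
  end.

Lemma res_dd i : res_d (res_next i) ∘ res_d i = 0.
Proof.
case: i => [k|[|[|k]]]; [exact: comp0m | exact: comp0m | | ]; apply: linear_mapP => x.
  exact: (@dd 0%N x).
exact: (@dd k.+1 x).
Qed.

Definition resolution_complex : complex (fgproj_cat R).
Proof.
exists res_ob (fun i j => cast res_ob (res_next i) j ∘ res_d i).
- by move=> i j ij; rewrite cast_neq ?comp0m // res_nextE eq_sym.
- move=> i j k; have [<-|ij] := eqVneq (res_next i) j.
    by rewrite cast_id comp1m -compA res_dd compm0.
  by rewrite (cast_neq _ ij) comp0m compm0.
- exists (- N.+1%:Z), 0; case=> [[|k]|k] ni; first by lia.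
    exact: fgproj_zeroP.
  by apply: linear_mapP => x; apply: PN; lia.
Defined.

Lemma res_cdE i : cd resolution_complex i (res_next i) = res_d i.
Proof.
change (cast res_ob (res_next i) (res_next i) ∘ res_d i = res_d i).
by rewrite cast_id comp1m.
Qed.

Lemma resolution_nonneg :
  (forall i x, d i x = 0 -> exists y, d i.+1 y = x) ->
  nonneg_for (Kb_regular R) (resolution_complex : Kb_proj R).
Proof.
move=> dk; apply/nonneg_regular => h i j ih ij i0 x.
case: i => [//|k] in ih ij i0 x *.
have eh : h = Negz k.+1 by lia.
have ej : j = res_next (Negz k) by rewrite res_nextE.
clear ih ij i0; subst h j; rewrite res_cdE => dx.
have [y yx] : exists y, d k.+1 y = x.
  move: x dx; clear -dk; case: k => [|k] x dx; first exact: (@dk 0%N x dx).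
  exact: (@dk k.+1 x dx).
exists y; change (lin (cd resolution_complex (Negz k.+1) (res_next (Negz k.+1))) y = x).
by rewrite res_cdE.
Qed.

Lemma resolution_contracts n :
  contracts_below (- n%:Z) resolution_complex ->
  exists (s : {linear P n.+1 -> P n.+2}) (t : {linear P n -> P n.+1}),
     forall x, x = d n.+1 (s x) + t (d n x).
Proof.
move=> [s sP].
have E : idm (res_ob (Negz n)) =
    cd resolution_complex (Negz n.+1) (res_next (Negz n.+1)) ∘ s (Negz n) (Negz n.+1)
    + s (res_next (Negz n)) (Negz n) ∘ cd resolution_complex (Negz n) (res_next (Negz n)).
  by apply: (sP (Negz n.+1) (Negz n) (res_next (Negz n))); rewrite ?res_nextE; lia.
rewrite !res_cdE in E.
move: (s (Negz n) (Negz n.+1)) (s (res_next (Negz n)) (Negz n)) E => u v E.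
have Ex (x : sval (res_ob (Negz n))) := congr1 (fun f => @lin _ _ (res_ob (Negz n)) f x) E.
by case: n u v {sP E} Ex => [|n] u v Ex; exists u, v; exact: Ex.
Qed.

End ResolutionComplex.

Lemma proj_dim_le (M : lmodType R) n :
  le_enat (proj_dim M) (Some n) <-> has_resolution (@projective R) n M.
Proof.
apply: inf_nat_le => m k mk [P [d [e [Pp P0 H1 H2 H3]]]].
by exists P, d, e; split=> // i ki; apply: P0; apply: leq_ltn_trans ki.
Qed.

Lemma findim_regular : findim (Kb_regular R) = findim_ring R.
Proof.
rewrite (findimE HK) /findim_ring /sup_enat; congr inf_nat.
apply: functional_extensionality_dep => n; apply: propositional_extensionality.
have shiftE (Y : Kb_proj R) : sgen (Kb_regular R) (fun i => 0 <= i + n%:Z) Y <->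
    contracts_below (- n%:Z) (Y : complex _).
  rewrite -sgen_contracts; split; apply: (sgen_sub HK) => i; lia.
split=> [fin _ [M [[N [P [d [e [Pfg P0 es ek dk]]]]] ->]]|pd Y HY].
  apply/proj_dim_le.
  have dd i x : d i (d i.+1 x) = 0 by apply/dk; exists x.
  apply: (truncate_resolution (fun i => (Pfg i).2) (And3 es ek dk)).
  apply: (resolution_contracts (Pfg := Pfg) (dd := dd) (PN := P0)).
  by apply/shiftE/fin/resolution_nonneg => i x /dk.
apply/shiftE/nonneg_contracts => // M HM; apply/proj_dim_le/pd.
by exists M.
Qed.

Lemma findim_Kb_finite : finite_enat (findim_ring R) <-> findim_finite (Kb_proj R).
Proof.
rewrite -findim_regular; split=> [|[G]]; first by exists (Kb_regular R).
exact/(findim_finite_sgen HK)/regular_generates.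
Qed.

End Final.

Theorem lemma4p1 :
  (forall S : triangulated,
    [/\ (forall G H : S,
           generated H `]-oo, +oo[ G ->
           finite_enat (findim G) -> finite_enat (findim H)),
        (forall t : t_structure S, t_bounded t ->
         forall G : S,
           finite_enat (findim G) \/ finite_enat (@findim (op S) G) ->
           classical_generator G),
        (forall t : t_structure S, t_algebraic t ->
         forall (n : nat) (s : 'I_n -> heart t) (G : S),
           simple_representatives s ->
           is_dsum (fun k => sval (s k)) G ->
           findim G = Some 0%N /\ @findim (op S) G = Some 0%N)
      & (forall (G : S) (m : int),
           (forall X : S, generated G `]-oo, m] X) -> findim G = Some 0%N) /\
        (forall (G : S) (n m : int),
           n <= m -> (forall X : S, generated G `[n, m] X) ->
           findim_finite S /\ findim_finite (op S))]) /\
  (forall R : pzRingType,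
     findim (Kb_regular R) = findim_ring R /\
     (finite_enat (findim_ring R) <-> findim_finite (Kb_proj R))).
Proof.
split=> [S|R]; first exact: finitistic_dimension_triangulated.
by split; [apply: findim_regular | apply: findim_Kb_finite].
Qed.
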